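(* (1) Fix an integer $g \geq 4$. There does not exist any abelian variety of dimension $g$ whose Picard number $\rho$ satisfies \[ (g-1)^2+1 < \rho < g^2. \] (2) Fix an integer $g \geq 7$. There does not exist any abelian variety of dimension $g$ whose Picard number $\rho$ satisfies \[ (g-2)^2+4 < \rho < (g-1)^2+1. \]
   Context: Abelian varieties are over the field $\mathbb{C}$ of complex numbers. The Picard number $\rho(A)$ of an abelian variety $A$ is the rank of its Néron–Severi group $\operatorname{NS}(A)$. *)

(* Defs.v *)
From HB Require Import structures.
From mathcomp Require Import all_boot all_order all_algebra.
From mathcomp Require Import sesquilinear generic_quotient complex.
From mathcomp Require Import all_classical all_reals all_analysis.

Set Implicit Arguments.
Unset Strict Implicit.
Unset Printing Implicit Defensive.

Import Order.TTheory GRing.Theory Num.Theory.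
Import numFieldNormedType.Exports.

Local Open Scope classical_set_scope.
Local Open Scope ring_scope.
Local Open Scope quotient_scope.

(* The packed type makes the topology and norm of R[i] available on the
   carrier, and the coordinatewise ones on the row vectors C^g. *)
Definition Cplx (R : realType) : numClosedFieldType := R[i]%C.

Section AbelianVarieties.
Variables (R : realType) (g : nat).
Local Notation C := (Cplx R).
Local Notation V := 'rV[C]_g.

Definition cplx_of_real (x : R) : C := real_complex R x.

Definition is_lattice (L : set V) : Prop :=
  exists b : 'I_(2 * g) -> V,
    (forall a : 'I_(2 * g) -> R,
        \sum_i cplx_of_real (a i) *: b i = 0 -> forall i, a i = 0) /\
    L = [set v | exists n : 'I_(2 * g) -> int, v = \sum_i b i *~ n i].

(* {dot V for conj} is the type of positive definite Hermitian forms, linear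
   in the first variable; such a form with integral imaginary part on the
   lattice is a Riemann form, i.e. a polarization of V / L. *)
Definition is_polarization (L : set V) (H : {dot V for @Num.conj C}) : Prop :=
  forall x y, L x -> L y ->
    exists n : int, 'Im (H x y) = n%:~R.

(* Abelian varieties of dimension g over C, as complex tori C^g / L which
   admit a polarization. *)
Record abelian_variety := AbelianVariety {
  lattice : set V;
  latticeP : is_lattice lattice;
  polarizable : exists H, is_polarization lattice H
}.

(* Functions of class C^1 whose differential is C-linear: differentiability
   and 'D_u are here taken over the field C. *)
Definition holomorphic (f : V -> C) : Prop :=
  (forall v, differentiable f v) /\ (forall u, continuous (fun v => 'D_u f v)).

Lemma continuous_mul (f h : V -> C) :
  continuous f -> continuous h -> continuous (fun v => f v * h v).
Proof. by move=> cf ch v; exact: (continuousM (cf v) (ch v)). Qed.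

Lemma continuous_inv (f : V -> C) :
  (forall v, f v != 0) -> continuous f -> continuous (fun v => (f v)^-1).
Proof. by move=> f0 cf v; exact: (continuousV (f0 v) (cf v)). Qed.

Lemma holomorphicM (f h : V -> C) :
  holomorphic f -> holomorphic h -> holomorphic (fun v => f v * h v).
Proof.
move=> [df cf] [dh ch]; split=> [v|u].
  exact: (differentiableM (df v) (dh v)).
have -> : 'D_u (fun v => f v * h v) =
    (fun v => f v * 'D_u h v + h v * 'D_u f v).
  apply/funext => v.
  exact: (deriveM (diff_derivable (df v)) (diff_derivable (dh v))).
have cf0 : continuous f by move=> v; exact: (differentiable_continuous (df v)).
have ch0 : continuous h by move=> v; exact: (differentiable_continuous (dh v)).
have c1 := continuous_mul cf0 (ch u); have c2 := continuous_mul ch0 (cf u).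
by move=> v; exact: (continuousD (c1 v) (c2 v)).
Qed.

Lemma holomorphicV (f : V -> C) : (forall v, f v != 0) ->
  holomorphic f -> holomorphic (fun v => (f v)^-1).
Proof.
move=> f0 [df cf]; split=> [v|u]; first exact: (differentiableV (df v) (f0 v)).
have -> : 'D_u (fun v => (f v)^-1) = (fun v => - (f v * f v)^-1 * 'D_u f v).
  by apply/funext => v; rewrite (deriveV (f0 v) (diff_derivable (df v))) expr2.
have cf0 : continuous f by move=> v; exact: (differentiable_continuous (df v)).
apply: (continuous_mul _ (cf u)) => v.
have cV : continuous (fun v => (f v * f v)^-1).
  by apply: continuous_inv (continuous_mul cf0 cf0) => w; rewrite mulf_neq0.
exact: (continuousN (cV v)).
Qed.

Lemma holomorphic1 : holomorphic (fun=> 1).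
Proof.
split=> [v|u]; first exact: differentiable_cst.
rewrite (_ : 'D_u _ = cst 0); first exact: cst_continuous.
by apply/funext => v; rewrite derive_cst.
Qed.

Variable A : abelian_variety.
Local Notation L := (lattice A).

(* The holomorphic line bundles on A. The pullback of such a bundle to C^g is
   trivial, so that the bundle is the quotient of C^g x C by the action
   l . (v, t) = (v + l, f l v * t) of the lattice, where f is a factor of
   automorphy. The values of f l are irrelevant when l is not in the lattice. *)
Record line_bundle := LineBundle {
  factor : V -> V -> C;
  factor_holomorphic : forall l, L l -> holomorphic (factor l);
  factor_neq0 : forall l, L l -> forall v, factor l v != 0;
  factorD : forall l m, L l -> L m ->
    forall v, factor (l + m) v = factor l (v + m) * factor m v
}.

Definition tensor_factor (M N : line_bundle) : V -> V -> C :=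
  fun l v => factor M l v * factor N l v.

Lemma tensor_subproof1 M N l : L l -> holomorphic (tensor_factor M N l).
Proof. by move=> Ll; apply: holomorphicM; exact: factor_holomorphic. Qed.

Lemma tensor_subproof2 M N l : L l -> forall v, tensor_factor M N l v != 0.
Proof. by move=> Ll v; rewrite mulf_neq0 ?factor_neq0. Qed.

Lemma tensor_subproof3 M N l m : L l -> L m -> forall v,
  tensor_factor M N (l + m) v =
  tensor_factor M N l (v + m) * tensor_factor M N m v.
Proof. by move=> Ll Lm v; rewrite /tensor_factor !factorD// mulrACA. Qed.

Definition tensor (M N : line_bundle) : line_bundle :=
  LineBundle (@tensor_subproof1 M N) (@tensor_subproof2 M N)
    (@tensor_subproof3 M N).

Definition dual_factor (M : line_bundle) : V -> V -> C :=
  fun l v => (factor M l v)^-1.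

Lemma dual_subproof1 M l : L l -> holomorphic (dual_factor M l).
Proof.
by move=> Ll; apply: holomorphicV; [exact: factor_neq0|exact: factor_holomorphic].
Qed.

Lemma dual_subproof2 M l : L l -> forall v, dual_factor M l v != 0.
Proof. by move=> Ll v; rewrite invr_eq0 factor_neq0. Qed.

Lemma dual_subproof3 M l m : L l -> L m -> forall v,
  dual_factor M (l + m) v = dual_factor M l (v + m) * dual_factor M m v.
Proof. by move=> Ll Lm v; rewrite /dual_factor factorD// invfM. Qed.

Definition dual (M : line_bundle) : line_bundle :=
  LineBundle (@dual_subproof1 M) (@dual_subproof2 M) (@dual_subproof3 M).

Lemma trivial_subproof3 (l m : V) : L l -> L m -> forall v : V, 1 = 1 * 1 :> C.
Proof. by rewrite mulr1. Qed.

Definition trivial_bundle : line_bundle :=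
  @LineBundle (fun _ _ => 1) (fun _ _ => holomorphic1)
    (fun _ _ _ => oner_neq0 C) trivial_subproof3.

(* (v, t) |-> (v, h v * t) is an isomorphism between the topological complex
   line bundles underlying M and N. Since topological line bundles are
   classified by c_1, this says that c_1(M) = c_1(N) in H^2(A, Z). *)
Definition top_isomorphic (M N : line_bundle) : Prop :=
  exists h : V -> C,
    [/\ continuous h,
        forall v, h v != 0 &
        forall l, L l -> forall v, factor N l v * h v = h (v + l) * factor M l v].

Lemma top_isomorphic_refl M : top_isomorphic M M.
Proof.
exists (fun=> 1); split=> [|v|l _ v]; [exact: cst_continuous|exact: oner_neq0|].
by rewrite mulr1 mul1r.
Qed.

Lemma top_isomorphic_sym M N : top_isomorphic M N -> top_isomorphic N M.
Proof.
move=> [h [ch h0 hE]]; exists (fun v => (h v)^-1); split=> [|v|l Ll v].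
- exact: continuous_inv.
- by rewrite invr_eq0.
- apply: (mulfI (h0 (v + l))); apply: (mulIf (h0 v)).
  by rewrite mulrA mulfVK// -hE// mulVKf.
Qed.

Lemma top_isomorphic_trans M N P :
  top_isomorphic M N -> top_isomorphic N P -> top_isomorphic M P.
Proof.
move=> [h [ch h0 hE]] [k [ck k0 kE]].
exists (fun v => k v * h v); split=> [|v|l Ll v].
- exact: continuous_mul.
- by rewrite mulf_neq0.
- by rewrite mulrA kE// -!mulrA hE.
Qed.

Lemma top_isomorphic_tensor M M' N N' :
  top_isomorphic M M' -> top_isomorphic N N' ->
  top_isomorphic (tensor M N) (tensor M' N').
Proof.
move=> [h [ch h0 hE]] [k [ck k0 kE]].
exists (fun v => h v * k v); split=> [|v|l Ll v].
- exact: continuous_mul.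
- by rewrite mulf_neq0.
- by rewrite /= /tensor_factor mulrACA hE// kE// mulrACA.
Qed.

Lemma top_isomorphic_dual M M' :
  top_isomorphic M M' -> top_isomorphic (dual M) (dual M').
Proof.
move=> [h [ch h0 hE]]; exists (fun v => (h v)^-1); split=> [|v|l Ll v].
- exact: continuous_inv.
- by rewrite invr_eq0.
- by rewrite /= /dual_factor -!invfM hE.
Qed.

Lemma top_isomorphic_eq M N :
  (forall l, L l -> forall v, factor M l v = factor N l v) ->
  top_isomorphic M N.
Proof.
move=> MN; exists (fun=> 1); split=> [|v|l Ll v].
- exact: cst_continuous.
- exact: oner_neq0.
- by rewrite mulr1 mul1r MN.
Qed.

HB.instance Definition _ := gen_eqMixin line_bundle.
HB.instance Definition _ := gen_choiceMixin line_bundle.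

Definition top_isomorphicb : rel line_bundle :=
  fun M N => `[< top_isomorphic M N >].

Lemma top_isomorphicb_refl : reflexive top_isomorphicb.
Proof. by move=> M; apply/asboolP; exact: top_isomorphic_refl. Qed.

Lemma top_isomorphicb_sym : symmetric top_isomorphicb.
Proof. by move=> M N; apply/asboolP/asboolP; exact: top_isomorphic_sym. Qed.

Lemma top_isomorphicb_trans : transitive top_isomorphicb.
Proof.
by move=> N M P /asboolP MN /asboolP NP; apply/asboolP/top_isomorphic_trans/NP.
Qed.

Canonical top_isomorphic_equiv := EquivRel top_isomorphicb
  top_isomorphicb_refl top_isomorphicb_sym top_isomorphicb_trans.

(* The Neron-Severi group NS(A), i.e. the image of the first Chern class
   Pic(A) -> H^2(A, Z): holomorphic line bundles, with the tensor product,
   modulo those which are topologically trivial (equivalently, algebraically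
   equivalent to 0). *)
Definition neron_severi := {eq_quot top_isomorphicb}.

HB.instance Definition _ := Choice.on neron_severi.
HB.instance Definition _ := EqQuotient.on neron_severi.

Definition ns_add (x y : neron_severi) : neron_severi :=
  \pi_neron_severi (tensor (repr x) (repr y)).
Definition ns_opp (x : neron_severi) : neron_severi :=
  \pi_neron_severi (dual (repr x)).
Definition ns_zero : neron_severi := \pi_neron_severi trivial_bundle.

Lemma ns_eqP M N :
  reflect (top_isomorphic M N) (\pi_neron_severi M == \pi_neron_severi N).
Proof. by rewrite eqmodE; exact: asboolP. Qed.

Lemma ns_repr M : top_isomorphic (repr (\pi_neron_severi M)) M.
Proof. by apply/ns_eqP; rewrite reprK. Qed.

Lemma ns_addE M N :
  ns_add (\pi_neron_severi M) (\pi_neron_severi N) =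
  \pi_neron_severi (tensor M N).
Proof. by apply/eqP/ns_eqP/top_isomorphic_tensor; exact: ns_repr. Qed.

Lemma ns_oppE M : ns_opp (\pi_neron_severi M) = \pi_neron_severi (dual M).
Proof. by apply/eqP/ns_eqP/top_isomorphic_dual; exact: ns_repr. Qed.

Lemma ns_addA : associative ns_add.
Proof.
elim/quotW=> M; elim/quotW=> N; elim/quotW=> P; rewrite (ns_addE N P) (ns_addE M N) !ns_addE.
apply/eqP/ns_eqP/top_isomorphic_eq => l Ll v.
by rewrite /= /tensor_factor /= /tensor_factor mulrA.
Qed.

Lemma ns_addC : commutative ns_add.
Proof.
elim/quotW=> M; elim/quotW=> N; rewrite !ns_addE.
apply/eqP/ns_eqP/top_isomorphic_eq => l Ll v.
by rewrite /= /tensor_factor mulrC.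
Qed.

Lemma ns_add0 : left_id ns_zero ns_add.
Proof.
elim/quotW=> M; rewrite ns_addE.
apply/eqP/ns_eqP/top_isomorphic_eq => l Ll v.
by rewrite /= /tensor_factor mul1r.
Qed.

Lemma ns_addN : left_inverse ns_zero ns_opp ns_add.
Proof.
elim/quotW=> M; rewrite ns_oppE ns_addE.
apply/eqP/ns_eqP/top_isomorphic_eq => l Ll v.
by rewrite /= /tensor_factor /= /dual_factor mulVf// factor_neq0.
Qed.

HB.instance Definition _ :=
  GRing.isZmodule.Build neron_severi ns_addA ns_addC ns_add0 ns_addN.

End AbelianVarieties.

Definition Z_independent (M : zmodType) (r : nat) (x : 'I_r -> M) : Prop :=
  forall n : 'I_r -> int, \sum_i x i *~ n i = 0 -> forall i, n i = 0.

Definition has_rank (M : zmodType) (r : nat) : Prop :=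
  (exists x : 'I_r -> M, Z_independent x) /\
  (forall s (x : 'I_s -> M), Z_independent x -> (s <= r)%N).

Definition has_picard_number (R : realType) (g : nat)
    (A : abelian_variety R g) (rho : nat) : Prop :=
  has_rank (neron_severi A) rho.

(* Main.v *)
(** The pull-back of a line bundle to C^g is given by a factor of automorphy.
Taking continuous logarithms F_j of the factors attached to a lattice basis,
the constants F_j(v + b_k) - F_j(v) - F_k(v + b_j) + F_k(v) form an
alternating integral matrix e, the first Chern class. It vanishes exactly
when the bundle is topologically trivial: the cocycle is then a coboundary,
solved for explicitly one basis vector at a time. If the factors are
holomorphic, integrating dF_j over the face x_j = 0 of the fundamental cube
gives D with D(b_j, b_k) - D(b_k, b_j) = e_jk which is C-linear in its second
argument, so e has no part of type (0,2) and is invariant under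
multiplication by i. Conversely twice such a matrix comes from an exponential
(Appell-Humbert) factor. Hence rho is the dimension of the real span T of the
integral alternating matrices invariant under i.

If E_0 is a polarization, S = T E_0^-1 consists of operators which commute with
i and are self-adjoint for the metric E_0(i., .); it contains 1 and is closed
under x y + y x, with no need of Poincare's reducibility theorem or Albert's
classification. Write 1 as a sum of orthogonal idempotents e_i with
e_i S e_i = R e_i and let 2 r_i be the real rank of e_i, so that
sum r_i = g. An element of a Peirce space S_ij is zero or a multiple of an
isometry between the images of e_i and e_j; hence dim S_ij <= 2 min(r_i, r_j),
S_ij = 0 if r_i <> r_j, and if S_ij <> 0 then dim S_jk = dim S_ik. The
gaps follow by counting dimensions in the sum of the S_ij. *)

From HB Require Import structures.
Require Import Defs.
From mathcomp Require Import all_boot all_order all_algebra.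
From mathcomp Require Import sesquilinear generic_quotient complex boolp.
From mathcomp Require Import zify ring lra.

Set Implicit Arguments.
Unset Strict Implicit.
Unset Printing Implicit Defensive.

Import Order.TTheory GRing.Theory Num.Theory.

Local Open Scope ring_scope.
Local Open Scope quotient_scope.

(** * Formally real Jordan algebras of matrices *)

(** The rank over the integers is traded for a real dimension because a self-adjoint real operator
    has a real eigenvalue: this makes the corner of a minimal idempotent one-dimensional, where the
    rational endomorphism algebra would bring in division algebras. Self-adjoint operators are not
    closed under the product, whence [x y + y x]. A connected block of [m] indices with [r_i = 1] is
    counted like symmetric or complex Hermitian matrices, of dimension [m (m + 1) / 2] or [m ^ 2].
    So [g ^ 2] is a single Hermitian block, [(g - 1) ^ 2 + 1] comes from the splitting [1 + (g - 1)]
    and [(g - 2) ^ 2 + 4] from [2 + (g - 2)]; the hypotheses [4 <= g] and [7 <= g] keep a single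
    symmetric block out of the gaps, and indices with [r_i >= 2] contribute less. On the analytic
    side the logarithms are constructed as merely continuous functions, and the integral over a face
    is replaced by a sum over a finite grid: the telescoping is then exact, and only the
    Cauchy-Riemann equations enter through a limit. *)

Section JordanMatrixAlgebra.
Variables (R : realFieldType) (n' : nat).
Local Notation n := n'.+1.
Implicit Types (S : {vspace 'M[R]_n}) (x y z e p : 'M[R]_n).

Definition idempotent e := e * e = e.

(** These are the traces that the polarization leaves in the algebra: [jordan_reduced] and
    [jordan_eigen] replace the metric (the eigenvalue is postulated because the base field need not
    be real closed), and [jordan_even] remembers that the images of idempotents are complex vector
    spaces. *)
Record jordan_algebra S : Prop := JordanAlgebra {
  jordan1 : 1 \in S;
  jordanD : forall x y, x \in S -> y \in S -> x * y + y * x \in S;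
  jordan_reduced : forall x, x \in S -> x * x = 0 -> x = 0;
  jordan_eigen : forall e y, e \in S -> idempotent e -> e != 0 -> y \in S ->
    e * y = y -> y * e = y ->
    exists (l : R) (v : 'rV[R]_n), [/\ v != 0, v *m e = v & v *m y = l *: v];
  jordan_even : forall e, e \in S -> idempotent e -> ~~ odd (\rank e)
}.

Variables (S : {vspace 'M[R]_n}) (JS : jordan_algebra S).

Lemma half_mem x : x + x \in S -> x \in S.
Proof.
move=> h; suff -> : x = 2%:R^-1 *: (x + x) by rewrite memvZ.
by rewrite -mulr2n -scaler_nat scalerA mulVf ?pnatr_eq0 // scale1r.
Qed.

Lemma jordan_sqr x : x \in S -> x * x \in S.
Proof. by move=> xS; apply/half_mem/(jordanD JS). Qed.

(** Two Jordan products with [e] give [e x + 2 e x e + x e]; subtracting the first product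
    [e x + x e] leaves twice the compression. *)
Lemma jordan_compress e x : idempotent e -> e \in S -> x \in S -> e * x * e \in S.
Proof.
move=> ee eS xS; apply: half_mem.
have h := jordanD JS eS xS; have := jordanD JS eS h.
rewrite mulrDr mulrDl !mulrA ee -(mulrA _ e e) ee => h2.
move: (memvB h2 h).
by rewrite [e * x + e * x * e]addrC addrACA addrK.
Qed.

(** [x] commutes with its polynomials, so the Jordan product with [x] is twice the usual one. *)
Lemma jordan_horner x q : x \in S -> horner_mx x q \in S.
Proof.
move=> xS; elim/poly_ind: q => [|q c IH]; first by rewrite rmorph0 mem0v.
elim/poly_ind: q IH c => [_ c|q d _ IH c].
  by rewrite mul0r add0r horner_mx_C -scalemx1 memvZ // (jordan1 JS).
rewrite rmorphD rmorphM /= horner_mx_X horner_mx_C.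
apply: memvD; last by rewrite -scalemx1 memvZ // (jordan1 JS).
apply: half_mem.
have := jordanD JS IH xS.
have -> // : x * horner_mx x (q * 'X + d%:P) = horner_mx x (q * 'X + d%:P) * x.
by rewrite -{1 4}(horner_mx_X x) -!rmorphM mulrC.
Qed.

(* A singular element [z] has a minimal polynomial [X q] with [q(0) != 0],
   because [S] is reduced; [q(z)/q(0)] is then the projection on its kernel. *)
Lemma jordan_split e z (v : 'rV[R]_n) :
  e \in S -> idempotent e -> z \in S -> e * z = z -> z * e = z -> z != 0 ->
  v != 0 -> v *m e = v -> v *m z = 0 ->
  exists p, [/\ p \in S, idempotent p, p != 0, p != e & e * p = p /\ p * e = p].
Proof.
move=> eS ee zS ez ze z0 v0 ve vz.
have : root (mxminpoly z) 0.
  rewrite root_mxminpoly -eigenvalue_root_char; apply/eigenvalueP.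
  by exists v; rewrite ?scale0r.
case/factor_theorem => q; rewrite subr0 => mE.
have m0 : mxminpoly z != 0 by rewrite monic_neq0 ?mxminpoly_monic.
have q0 : q != 0 by apply: contraNneq m0 => q0; rewrite mE q0 mul0r.
have zq : horner_mx z q * z = 0.
  by rewrite -{2}(horner_mx_X z) -rmorphM /= -mE mx_root_minpoly.
(* If [X] divided [q], the square of [q(z)] would be a multiple of [q(z) z = 0]; by reducedness [q],
   of smaller degree than the minimal polynomial, would annihilate [z]. *)
have qz0 : q.[0] != 0.
  apply/negP => /factor_theorem[r]; rewrite subr0 => rE.
  have w0 : horner_mx z (r * 'X) = 0.
    apply: (jordan_reduced JS); first exact: jordan_horner.
    rewrite -rmorphM -{1}rE (mulrC r) mulrA rmorphM /= rmorphM /= horner_mx_X.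
    by rewrite zq mul0r.
  move: (mxminpoly_min w0); rewrite -rE mE => /(dvdp_leq q0).
  by rewrite size_mulX // ltnn.
pose s := (q - q.[0]%:P) %/ 'X.
have sE : q = s * 'X + q.[0]%:P.
  rewrite divpK ?subrK // -['X]subr0 -polyC0 dvdp_XsubCl.
  by rewrite /root !hornerE subrr.
pose f := (q.[0])^-1 *: horner_mx z q.
have fS : f \in S by rewrite memvZ // jordan_horner.
have fE : f = 1 + (q.[0])^-1 *: (horner_mx z s * z).
  rewrite /f {2}sE rmorphD rmorphM /= horner_mx_X horner_mx_C scalerDr.
  by rewrite -scalemx1 scalerA mulVf // scale1r addrC.
have zC r : horner_mx z r * z = z * horner_mx z r.
  by rewrite -{2 3}(horner_mx_X z) -!rmorphM /= mulrC.
have fz : f * z = 0 by rewrite /f -scalerAl zq scaler0.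
have ff : f * f = f.
  rewrite {2}fE mulrDr mulr1 -scalerAr zC mulrA fz mul0r scaler0 addr0 //.
have ef : e * f = f * e.
  by rewrite fE mulrDl mulrDr mulr1 mul1r -scalerAl -scalerAr -mulrA ze zC mulrA ez.
have efe : e * f * e = e * f by rewrite -mulrA -ef mulrA ee.
exists (e * f); split.
- by rewrite -efe; apply: jordan_compress.
- by rewrite /idempotent mulrA efe -mulrA ff.
- apply: contraNneq v0 => ef0; have : v *m (e * f) = v.
    rewrite -mulmxE mulmxA ve fE mulmxDr mulmx1 -scalemxAr zC -mulmxE mulmxA vz.
    by rewrite mul0mx scaler0 addr0.
  by rewrite ef0 mulmx0 => <-.
- apply: contra_neq z0 => efE; rewrite -ez -efE -mulrA fz mulr0 //.
- by rewrite efe mulrA ee.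
Qed.

Definition primitive e := forall x, x \in S -> exists c : R, e * x * e = c *: e.

(** Shifting a non-scalar [e x e] by one of its eigenvalues on the image of [e] gives a nonzero
    element that is singular there, as [jordan_split] requires. *)
Lemma jordan_primitiveVsplit e : e \in S -> idempotent e -> e != 0 ->
  ~ primitive e ->
  exists p, [/\ p \in S, idempotent p, p != 0, p != e & e * p = p /\ p * e = p].
Proof.
move=> eS ee e0 /existsNP[x] /not_implyP[xS] /forallNP nx.
have yS : e * x * e \in S by apply: jordan_compress.
have ey : e * (e * x * e) = e * x * e by rewrite !mulrA ee.
have ye : (e * x * e) * e = e * x * e by rewrite -!mulrA ee.
have [l [v [v0 ve vy]]] := jordan_eigen JS eS ee e0 yS ey ye.
apply: (@jordan_split e (e * x * e - l *: e) v) => //.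
- by rewrite memvB // memvZ.
- by rewrite mulrBr ey -scalerAr ee.
- by rewrite mulrBl ye -scalerAl ee.
- by rewrite subr_eq0; apply/eqP; apply: nx.
- by rewrite mulmxBr vy -scalemxAr ve subrr.
Qed.

Lemma idempotent_rank_lt e p : idempotent p -> p != e ->
  e * p = p -> p * e = p -> (\rank p < \rank e)%N.
Proof.
move=> pp pe ep pe'.
have le_pe : (p <= e)%MS by rewrite -pe'; apply: submxMl.
rewrite ltn_neqAle mxrankS // andbT; apply: contra pe => /eqP rpe.
have /submxP[z zE] : (e <= p)%MS by rewrite -(geq_leqif (mxrank_leqif_sup le_pe)) rpe.
by rewrite -ep zE -mulmxE -mulmxA mulmxE pp.
Qed.

Definition orthogonal_idempotents := fun x y => (x * y == 0) && (y * x == 0).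

(** Strong induction on the rank: a non-primitive [e] is the sum of [p] and [e - p], orthogonal
    idempotents of smaller rank whose frames are concatenated. *)
Lemma jordan_frame e : e \in S -> idempotent e ->
  exists s : seq 'M[R]_n,
  [/\ forall f, f \in s -> [/\ f \in S, idempotent f, f != 0, primitive f &
        e * f = f /\ f * e = f],
      pairwise orthogonal_idempotents s & \sum_(f <- s) f = e].
Proof.
have [m] := ubnP (\rank e); elim: m e => // m IH e lem eS ee.
have [->|e0] := eqVneq e 0; first by exists [::]; split=> //; rewrite big_nil.
have [pr|/(jordan_primitiveVsplit eS ee e0)] := pselect (primitive e).
  exists [:: e]; split => //; last by rewrite big_seq1.
  by move=> f; rewrite inE => /eqP ->; split.
case=> p [pS pp p0 pe [ep pe']].
pose q := e - p.
have qS : q \in S by rewrite memvB.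
have qq : idempotent q.
  by rewrite /idempotent mulrBr !mulrBl ee ep pe' pp subrr subr0.
have [eq qe] : e * q = q /\ q * e = q by rewrite mulrBr mulrBl ee ep pe'.
have qe' : q != e by rewrite /q -subr_eq0 addrC addKr oppr_eq0.
have pq : p * q = 0 by rewrite mulrBr pe' pp subrr.
have qp : q * p = 0 by rewrite mulrBl ep pp subrr.
have rp := leq_trans (idempotent_rank_lt pp pe ep pe') lem.
have rq := leq_trans (idempotent_rank_lt qq qe' eq qe) lem.
have [s1 [s1P s1o s1E]] := IH p rp pS pp.
have [s2 [s2P s2o s2E]] := IH q rq qS qq.
exists (s1 ++ s2); split.
- move=> f; rewrite mem_cat => /orP[/s1P|/s2P] [fS ff f0 fp [xf fx]]; split=> //.
    by split; [rewrite -{1}xf mulrA ep xf | rewrite -{1}fx -mulrA pe' fx].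
  by split; [rewrite -{1}xf mulrA eq xf | rewrite -{1}fx -mulrA qe fx].
- rewrite pairwise_cat s1o s2o !andbT; apply/allrelP => f f' /s1P[_ _ _ _ [pf fp]].
  move=> /s2P[_ _ _ _ [qf fq]]; rewrite /orthogonal_idempotents.
  rewrite -{1}fp -{1}qf mulrA -(mulrA f) pq mulr0 mul0r eqxx /=.
  by rewrite -{1}fq -{1}pf mulrA -(mulrA f') qp mulr0 mul0r.
- by rewrite big_cat /= s1E s2E addrC subrK.
Qed.
End JordanMatrixAlgebra.

(** Peirce spaces are indexed by unordered pairs, encoded by [i <= j], while the counting is easier
    over ordered pairs. The statement serves for matrices and for dimensions, hence the general
    [nmodType]. *)
Lemma sum_symmetric_pairs (V : nmodType) m (F : 'I_m -> 'I_m -> V) :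
  \sum_i \sum_j F i j = \sum_(p : 'I_m * 'I_m | (p.1 <= p.2)%N)
    (F p.1 p.2 + if p.1 == p.2 then 0 else F p.2 p.1).
Proof.
rewrite (pair_bigA _ F) /= (bigID (fun p : 'I_m * 'I_m => (p.1 <= p.2)%N)) /=.
rewrite big_split /=; congr (_ + _).
rewrite (reindex_inj (h := fun p : 'I_m * 'I_m => (p.2, p.1))) /=; last first.
  by move=> [a b] [c d] [-> ->].
rewrite [RHS](bigID (fun p : 'I_m * 'I_m => p.1 == p.2)) /= [X in _ = X + _]big1 ?add0r; last first.
  by move=> p /andP[_ ->].
apply: eq_big => [[i j]|[i j]] /=.
  by rewrite -ltnNge ltn_neqAle andbC.
by rewrite -ltnNge -val_eqE => /ltn_eqF ->.
Qed.

(** * Peirce decomposition along a frame of primitive idempotents *)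

Section PeirceDecomposition.
Variables (R : realFieldType) (n' : nat).
Local Notation n := n'.+1.
Variables (S : {vspace 'M[R]_n}) (JS : jordan_algebra S).
Variables (m : nat) (e : 'I_m -> 'M[R]_n).
Hypotheses (eS : forall i, e i \in S)
  (eM : forall i j, e i * e j = if i == j then e i else 0)
  (e0 : forall i, e i != 0) (eP : forall i, primitive S (e i))
  (e1 : \sum_i e i = 1).

(** For [i != j] the halves [e i * x * e j] and [e j * x * e i] need not lie in [S] separately; only
    their sum does. *)
Definition peirce i j (x : 'M[R]_n) : 'M[R]_n :=
  if i == j then e i * x * e i else e i * x * e j + e j * x * e i.

Fact peirce_linear i j : linear (peirce i j).
Proof.
move=> a x y; rewrite /peirce; case: eqP => _.
  by rewrite mulrDr mulrDl -scalerAr -scalerAl.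
by rewrite !mulrDr !mulrDl -!scalerAr -!scalerAl addrACA -scalerDr.
Qed.
HB.instance Definition _ i j :=
  GRing.isLinear.Build R 'M[R]_n 'M[R]_n *:%R (peirce i j) (peirce_linear i j).

Definition peirce_space i j : {vspace 'M[R]_n} := (linfun (peirce i j) @: S)%VS.
Local Notation W := peirce_space.

Lemma eMii i : e i * e i = e i. Proof. by rewrite eM eqxx. Qed.
Lemma eMij i j : i != j -> e i * e j = 0.
Proof. by move=> ij; rewrite eM (negPf ij). Qed.

Lemma peirce_id i j x : peirce i j (peirce i j x) = peirce i j x.
Proof.
rewrite /peirce; case: eqVneq => ij; first by rewrite !mulrA eMii -!mulrA eMii.
have ji : j != i by rewrite eq_sym.
rewrite !mulrDr !mulrDl !mulrA !eMii (eMij ij) (eMij ji) !mul0r.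
by rewrite -!mulrA !eMii addr0 add0r.
Qed.

(** Off the diagonal, this is the compression by the idempotent [e i + e j] minus the compressions
    by [e i] and by [e j]. *)
Lemma peirce_mem i j x : x \in S -> peirce i j x \in S.
Proof.
move=> xS; rewrite /peirce; case: eqVneq => ij.
  exact: jordan_compress (eMii _) _ _.
have ji : j != i by rewrite eq_sym.
have ii : idempotent (e i + e j).
  by rewrite /idempotent mulrDl !mulrDr !eMii (eMij ij) (eMij ji) addr0 add0r.
have h := jordan_compress JS ii (memvD (eS i) (eS j)) xS.
have hi := jordan_compress JS (eMii i) (eS i) xS.
have hj := jordan_compress JS (eMii j) (eS j) xS.
move: (memvB (memvB h hi) hj); rewrite !mulrDl !mulrDr.
set a := e i * x * e i; set b := e j * x * e j.
by rewrite -addrA -opprD [a + _]addrC addrACA addrK.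
Qed.

Lemma peirceP i j x : reflect (x \in S /\ peirce i j x = x) (x \in W i j).
Proof.
apply: (iffP memv_imgP) => [[y yS ->]|[xS xE]].
  by rewrite lfunE; split; [exact: peirce_mem|exact: peirce_id].
by exists x => //; rewrite lfunE.
Qed.

Lemma peirceC i j : W i j = W j i.
Proof.
apply/vspaceP => x; apply/peirceP/peirceP => -[xS xE]; split=> //; rewrite -{2}xE;
  rewrite /peirce eq_sym; case: eqP => [->//|_]; by rewrite addrC.
Qed.

Lemma dim_peirce_diag i : \dim (W i i) = 1.
Proof.
have -> : W i i = <[e i]>%VS; last by rewrite dim_vline e0.
apply/vspaceP => x; apply/peirceP/vlineP => [[xS]|[k ->]].
  by rewrite /peirce eqxx => <-; exact: eP.
by rewrite memvZ // /peirce eqxx -scalerAr eMii -scalerAl eMii.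
Qed.

Lemma peirce_off i j x : i != j -> x \in W i j ->
  [/\ e i * x = x * e j, e j * x = x * e i, x * e i + x * e j = x,
      e i * x + e j * x = x &
      forall k, k != i -> k != j -> e k * x = 0 /\ x * e k = 0].
Proof.
move=> ij /peirceP[xS]; rewrite /peirce (negPf ij) => xE.
have ji : j != i by rewrite eq_sym.
have a1 : e i * x = e i * x * e j.
  by rewrite -{1}xE mulrDr !mulrA eMii (eMij ij) !mul0r addr0.
have a2 : x * e j = e i * x * e j.
  by rewrite -{1}xE mulrDl -!mulrA eMii (eMij ij) !mulr0 addr0.
have a3 : e j * x = e j * x * e i.
  by rewrite -{1}xE mulrDr !mulrA eMii (eMij ji) !mul0r add0r.
have a4 : x * e i = e j * x * e i.
  by rewrite -{1}xE mulrDl -!mulrA eMii (eMij ji) !mulr0 add0r.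
split; first by rewrite a1.
- by rewrite a3.
- by rewrite a2 a4 addrC.
- by rewrite a1 a3.
move=> k ki kj; split.
  by rewrite -xE mulrDr !mulrA !eMij // !mul0r addr0.
by rewrite -xE mulrDl -!mulrA !eMij 1?eq_sym // !mulr0 addr0.
Qed.

(** [x] exchanges the images of [e i] and [e j], so [x * x] preserves both and, by primitivity, is a
    scalar [c] on one and [d] on the other. Since [x] commutes with [x * x], distinct scalars would
    force [x = 0]; so would [c = 0], by reducedness. *)
Lemma peirce_sqr i j x : i != j -> x \in W i j -> x != 0 ->
  exists2 c : R, c != 0 & x * x = c *: (e i + e j).
Proof.
move=> ij xW x0; have ji : j != i by rewrite eq_sym.
have [xi xj xr xl _] := peirce_off ij xW.
have [xS _] := peirceP _ _ _ xW.
have x2S := jordan_sqr JS xS.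
have [c cE] := eP i x2S; have [d dE] := eP j x2S.
have h k l : e k * x = x * e l -> e l * x = x * e k ->
    e k * (x * x) * e k = e k * (x * x).
  by move=> kl lk; rewrite mulrA kl -(mulrA x) lk !mulrA -(mulrA (x * x)) eMii.
have x2E : x * x = c *: e i + d *: e j.
  by rewrite -cE -dE (h i j) // (h j i) // !mulrA -mulrDl xl.
have cd : c = d.
  apply: contra_neq_eq x0 => cd.
  have : x * (x * x) = (x * x) * x by rewrite mulrA.
  rewrite x2E mulrDr mulrDl -!scalerAr -!scalerAl xi xj.
  rewrite [X in _ = X]addrC => /eqP; rewrite -subr_eq0 opprD addrACA -scalerBl -scalerBl => /eqP E.
  have xei : x * e i = 0.
    have := congr1 (fun z => z * e i) E.
    rewrite mul0r mulrDl -!scalerAl -!mulrA eMii (eMij ji) mulr0 scaler0 addr0.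
    by move/eqP; rewrite scaler_eq0 subr_eq0 (negPf cd) => /eqP.
  have xej : x * e j = 0.
    have := congr1 (fun z => z * e j) E.
    rewrite mul0r mulrDl -!scalerAl -!mulrA eMii (eMij ij) mulr0 scaler0 add0r.
    by move/eqP; rewrite scaler_eq0 subr_eq0 eq_sym (negPf cd) => /eqP.
  by rewrite -xr xei xej addr0.
exists c; last by rewrite scalerDr x2E -cd.
apply: contra_neq x0 => c0; apply: (jordan_reduced JS) => //.
by rewrite x2E -cd c0 !scale0r addr0.
Qed.

(** By [peirce_sqr], [x] is up to a scalar its own inverse between the two images, so [e i] factors
    through [e j]. *)
Lemma peirce_rank i j x : i != j -> x \in W i j -> x != 0 ->
  (\rank (e i) <= \rank (e j))%N.
Proof.
move=> ij xW x0; have [c c0 x2] := peirce_sqr ij xW x0.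
have [xi xj xr xl _] := peirce_off ij xW.
have -> : e i = (c^-1 *: x) *m (e j *m x).
  rewrite mulmxE xj mulrA -scalerAl x2 scalerA mulVf // scale1r mulrDl.
  by rewrite eMii eMij 1?eq_sym // addr0.
by rewrite (leq_trans (mxrankM_maxr _ _)) // mxrankM_maxl.
Qed.

(** Evaluation at a nonzero vector [v] of the image of [e j] maps the Peirce space into the image of
    [e i]. It is injective: for [y != 0], [y * y] acts on [v] as a nonzero scalar, so [v *m y]
    cannot vanish. *)
Lemma dim_peirce_rank i j : i != j -> (\dim (W i j) <= \rank (e i))%N.
Proof.
move=> ij.
have [v v0 vj] : exists2 v : 'rV[R]_n, v != 0 & v *m e j = v.
  have /rowV0Pn[v /submxP[w wE] v0] : e j != 0 by [].
  by exists v => //; rewrite wE -mulmxA mulmxE eMii.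
pose X := vbasis (W i j); pose M := \matrix_(k < \dim (W i j)) (v *m X`_k).
have XW (k : 'I_(\dim (W i j))) : X`_k \in W i j by rewrite vbasis_mem // mem_nth // size_tuple.
have ME : M *m e i = M.
  apply/row_matrixP => k; rewrite row_mul !rowK -mulmxA mulmxE.
  have [_ xj _ _ _] := peirce_off ij (XW k).
  by rewrite -xj -mulmxE mulmxA vj.
have Mf : row_free M.
  rewrite -kermx_eq0; apply/rowV0P => u /sub_kermxP uM.
  pose y := \sum_k u 0 k *: X`_k.
  have yW : y \in W i j by apply: memv_suml => k _; rewrite memvZ.
  have vy : v *m y = 0.
    rewrite -uM [RHS]mulmx_sum_row mulmx_sumr; apply: eq_bigr => k _.
    by rewrite rowK scalemxAr.
  have y0 : y = 0.
    apply/eqP; apply: contraT => y0; have [c c0 y2] := peirce_sqr ij yW y0.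
    have /eqP : v *m (y *m y) = 0 by rewrite mulmxA vy mul0mx.
    have vi : v *m e i = 0 by rewrite -vj -mulmxA mulmxE eMij 1?eq_sym // mulmx0.
    by rewrite mulmxE y2 -scalemxAr scaler_eq0 (negPf c0) mulmxDr vj vi add0r (negPf v0).
  apply/rowP => k; rewrite mxE.
  have /freeP Xf := basis_free (vbasisP (W i j)).
  exact: Xf (fun k => u 0 k) y0 k.
by rewrite -[X in (X <= _)%N](eqP Mf) -ME mxrankM_maxr.
Qed.

(** The Jordan product with [x] carries one Peirce space into the other. It is injective because
    [x * x] is a nonzero multiple of [e i + e j], so that multiplication by [x] can be undone. *)
Lemma dim_peirce_transfer i j k x : i != j -> i != k -> j != k ->
  x \in W i j -> x != 0 -> (\dim (W j k) <= \dim (W i k))%N.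
Proof.
move=> ij ik jk xW x0.
have ki : k != i by rewrite eq_sym. have kj : k != j by rewrite eq_sym.
have [xi xj xr xl /(_ k ki kj)[kx xk]] := peirce_off ij xW.
have [c c0 x2] := peirce_sqr ij xW x0.
have [xS _] := peirceP _ _ _ xW.
pose phi (y : 'M[R]_n) : 'M[R]_n := x * y + y * x.
have phi_lin : linear phi.
  move=> a y z; rewrite /phi mulrDr mulrDl -scalerAr -scalerAl addrACA.
  by rewrite -scalerDr.
pose lphi : {linear 'M[R]_n -> 'M[R]_n} :=
  HB.pack phi (GRing.isLinear.Build R 'M[R]_n 'M[R]_n *:%R phi phi_lin).
rewrite -(@limg_dim_eq _ _ _ (linfun lphi) (W j k)).
  apply/dimvS/subvP => z /memv_imgP[y yW ->]; rewrite lfunE /=.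
  have [yj yk yr yl /(_ i ij ik)[iy yi]] := peirce_off jk yW.
  have [yS _] := peirceP _ _ _ yW.
  apply/peirceP; split; first exact: (jordanD JS).
  rewrite /peirce (negPf ik) /phi.
  have xy : x * y = x * e j * y by rewrite -{1}xr !mulrDl -[x * e i * y]mulrA iy mulr0 add0r.
  have yx : y * x = y * e j * x by rewrite -{1}yr !mulrDl -[y * e k * x]mulrA kx mulr0 addr0.
  have ixy : e i * (x * y) = x * y by rewrite mulrA xi -xy.
  have xyk : x * y * e k = x * y by rewrite -mulrA -yj mulrA -xy.
  have kyx : e k * (y * x) = y * x by rewrite mulrA yk -yx.
  have yxi : y * x * e i = y * x by rewrite -mulrA -xj mulrA -yx.
  rewrite !mulrDr ixy kyx [e i * (y * x)]mulrA iy mul0r addr0.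
  by rewrite [e k * (x * y)]mulrA kx mul0r add0r xyk yxi.
apply/eqP; rewrite -subv0; apply/subvP => y /memv_capP[yW].
rewrite memv_ker lfunE /= /phi => /eqP y0; rewrite memv0.
have [yj yk yr yl /(_ i ij ik)[iy yi]] := peirce_off jk yW.
have xy : x * y = 0.
  have := congr1 (fun z => e i * z) y0.
  rewrite mulr0 mulrDr !mulrA iy mul0r addr0 xi => xjy.
  by rewrite -{1}xr !mulrDl -[x * e i * y]mulrA iy mulr0 add0r.
have jy : e j * y = 0.
  have /eqP : x * (x * y) = 0 by rewrite xy mulr0.
  rewrite mulrA x2 -scalerAl scaler_eq0 (negPf c0) mulrDl iy add0r.
  by move/eqP.
have yej : y * e j = 0.
  have /eqP : (y * x) * x = 0.
    by move/eqP: y0; rewrite xy add0r => /eqP ->; rewrite mul0r.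
  rewrite -mulrA x2 -scalerAr scaler_eq0 (negPf c0) mulrDr yi add0r.
  by move/eqP.
by rewrite -yl jy yk yej addr0.
Qed.

Lemma peirce_sum : S = (\sum_(p : 'I_m * 'I_m | (p.1 <= p.2)%N) W p.1 p.2)%VS.
Proof.
apply/eqP; rewrite eqEsubv; apply/andP; split; last first.
  by apply/subv_sumP => p _; apply/subvP => x /peirceP[].
apply/subvP => x xS.
have -> : x = \sum_(p : 'I_m * 'I_m | (p.1 <= p.2)%N) peirce p.1 p.2 x.
  have {1}-> : x = \sum_i \sum_j e i * x * e j.
    rewrite -{1}[x]mulr1 -e1 mulr_sumr -{1}[x]mul1r -e1 exchange_big.
    by apply: eq_bigr => j _ /=; rewrite mulr_suml mulr_suml.
  rewrite sum_symmetric_pairs; apply: eq_bigr => -[i j] _ /=; rewrite /peirce.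
  by case: eqP => [->|//]; rewrite addr0.
apply: memv_sumr => p _; apply/peirceP.
by rewrite peirce_id; split=> //; apply: peirce_mem.
Qed.

Lemma peirce_direct :
  directv (\sum_(p : 'I_m * 'I_m | (p.1 <= p.2)%N) W p.1 p.2)%VS.
Proof.
apply/directv_sum_independent => u uW u0 [i j] ij.
have /(peirceP i j)[_ uE] : u (i, j) \in W i j := uW (i, j) ij.
rewrite -uE; have := congr1 (peirce i j) u0; rewrite linear0 linear_sum (bigD1 (i, j)) //=.
rewrite big1 ?addr0 // => -[k l] /andP[/= kl].
rewrite xpair_eqE => ne; have /(peirceP k l)[_ <-] : u (k, l) \in W k l := uW (k, l) kl.
rewrite /= in ij kl *.
have z a b c d : (a == b) && (c == d) = false -> e a * (e b * u (k, l) * e c) * e d = 0.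
  rewrite !mulrA -mulrA !eM; case: eqP => [->|_]; last by rewrite !mul0r.
  by case: eqP => // _; rewrite mulr0.
have ne1 : (i == k) && (l == j) = false.
  by rewrite (eq_sym i) (negPf ne).
have ne2 : (j == l) && (k == i) = false.
  by rewrite andbC (eq_sym j) (negPf ne).
(* Both pairs are ordered, [i <= j] and [k <= l], so a match after exchanging the indices is
   possible only when all four agree. *)
have lk_ne : (i == l) && (k == j) -> (k == i) && (l == j).
  by case/andP => /eqP il /eqP kj; subst l k; rewrite eq_sym andbb -val_eqE eqn_leq ij.
have ne3 : (i == l) && (k == j) = false.
  by apply/negP => /lk_ne; rewrite (negPf ne).
have ne4 : (j == k) && (l == i) = false.
  by apply/negP; rewrite (eq_sym j) andbC (eq_sym l) => /lk_ne; rewrite (negPf ne).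
rewrite /peirce; case: (eqVneq k l) => [E|nkl]; case: (eqVneq i j) => [E'|nij].
- by subst l j; rewrite z.
- by subst l; rewrite !z ?addr0.
- by subst j; rewrite mulrDr mulrDl !z ?addr0.
- by rewrite !mulrDr !mulrDl !z ?addr0.
Qed.

(** After doubling, the sum runs over ordered pairs: an off-diagonal space is met twice, and the
    line spanned by [e i] gets the entry 2. *)
Lemma dim_peirce_sum :
  (2 * \dim S)%N = (\sum_i \sum_j if i == j then 2 else \dim (W i j))%N.
Proof.
rewrite sum_symmetric_pairs /= {1}peirce_sum (directvP peirce_direct) /= big_distrr /=.
apply: eq_bigr => -[i j] _ /=; rewrite [j == i]eq_sym; case: eqVneq => [->|_].
  by rewrite dim_peirce_diag.
by rewrite (peirceC j i) mulSn mul1n.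
Qed.


Lemma rank_frame : (\sum_i \rank (e i))%N = n.
Proof.
have : mxdirect (\sum_i <<e i>>)%MS.
  apply/mxdirect_sumsP => i _; apply/eqP; rewrite -submx0; apply/rV_subP => u.
  rewrite sub_capmx genmxE => /andP[/submxP[w ->] h].
  have : (w *m e i <= kermx (e i))%MS.
    apply: submx_trans h _; apply/sumsmx_subP => j ji; rewrite genmxE.
    by apply/sub_kermxP; rewrite mulmxE eMij.
  by move=> /sub_kermxP; rewrite -mulmxA mulmxE eMii => ->; rewrite sub0mx.
move=> /mxdirectP /= E; transitivity (\sum_i \rank <<e i>>)%N.
  by apply: eq_bigr => i _; rewrite mxrank_gen.
apply/eqP; rewrite -E eqn_leq rank_leq_col /= -{1}(mxrank1 R n) mxrankS //.
change ((1 : 'M[R]_n) <= \sum_i <<e i>>)%MS; rewrite -e1.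
by apply: summx_sub => i _; rewrite (sumsmx_sup i) // genmxE.
Qed.


End PeirceDecomposition.

Local Close Scope ring_scope.

(** * Counting dimensions from the multiplicities *)

Section Multiplicities.
Variables (I : finType) (r : I -> nat) (d : I -> I -> nat).
Hypotheses (r_gt0 : forall i, 0 < r i) (dC : forall i j, d i j = d j i)
  (dii : forall i, d i i = 2) (d_le : forall i j, i != j -> d i j <= 2 * r i)
  (d_eqr : forall i j, i != j -> 0 < d i j -> r i = r j)
  (d_trans : forall i j k, i != j -> i != k -> j != k -> 0 < d i j ->
     d j k = d i k).

(** [r i] models half the rank of an idempotent and [d i j] the dimension of a Peirce space, with 2
    on the diagonal as in [dim_peirce_sum]. Over all indices the value is thus twice the dimension
    of the algebra. *)
Definition block_sum (A B : {set I}) := \sum_(i in A) \sum_(j in B) d i j.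

Lemma block_sum_split (A B : {set I}) : B \subset A ->
  (forall i j, i \in B -> j \in A :\: B -> d i j = 0) ->
  block_sum A A = block_sum B B + block_sum (A :\: B) (A :\: B).
Proof.
move=> BA d0; rewrite /block_sum (big_setID B) (setIidPr BA) /=.
congr (_ + _); apply: eq_bigr => i iB; rewrite (big_setID B) (setIidPr BA) /=.
  by rewrite [X in _ + X]big1 ?addn0 // => j jD; exact: d0.
by rewrite [X in X + _]big1 // => j jB; rewrite dC d0.
Qed.

Section RankOne.
Variable A : {set I}.
Hypothesis rA : forall i, i \in A -> r i = 1.

Lemma rank1_le2 i j : i \in A -> d i j <= 2.
Proof.
move=> iA; case: (eqVneq i j) => [->|ij]; first by rewrite dii.
by rewrite (leq_trans (d_le ij)) // rA.
Qed.

Lemma rank1_block_le (B : {set I}) : B \subset A -> block_sum B B <= 2 * #|B| ^ 2.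
Proof.
move=> BA; rewrite /block_sum (leq_trans (n := \sum_(i in B) \sum_(j in B) 2)) //.
  by apply: leq_sum => i iB; apply: leq_sum => j _; rewrite rank1_le2 // (subsetP BA).
by rewrite !sum_nat_const; lia.
Qed.

(** By [d_trans], the indices linked to a given one by a positive [d] have no link to the others, so
    either a block splits off or all pairs are linked. In the latter case [d] is constant off the
    diagonal, equal to 2 (Hermitian matrices) or to 1 (symmetric matrices). *)
Lemma rank1_cases (B : {set I}) : B \subset A ->
  [\/ block_sum B B = 2 * #|B| ^ 2, block_sum B B = #|B| ^ 2 + #|B| |
   exists C : {set I}, [/\ C \subset B, 0 < #|C|, #|C| < #|B| &
     block_sum B B = block_sum C C + block_sum (B :\: C) (B :\: C)]].
Proof.
move=> BA.
have [/exists_inP[i iB /exists_inP[j jB /eqP dij]]|/exists_inPn pos] :=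
    boolP [exists i in B, exists j in B, d i j == 0].
  apply: Or33; pose C := [set k in B | 0 < d i k].
  have CB : C \subset B by apply/subsetP => k; rewrite inE => /andP[].
  exists C; split=> //.
  - by apply/card_gt0P; exists i; rewrite inE iB dii.
  - by apply: proper_card; apply/properP; split=> //; exists j => //; rewrite inE dij andbF.
  apply: block_sum_split => // k l; rewrite !inE => /andP[kB ik] /andP[+ lB].
  rewrite lB /= -eqn0Ngt => /eqP il.
  have nil : i != l by apply: contra_eq_neq il => <-; rewrite dii.
  have nkl : k != l by apply: contraTneq ik => ->; rewrite il.
  case: (eqVneq i k) => [<-//|nik].
  by rewrite (d_trans nik nil nkl ik).
have {}pos i j : i \in B -> j \in B -> 0 < d i j.
  by move=> iB jB; rewrite lt0n; have /exists_inPn := pos i iB; apply.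
have [/exists_inP[i iB /exists_inP[j jB /andP[ij /eqP dij]]]|/exists_inPn two] :=
    boolP [exists i in B, exists j in B, (i != j) && (d i j == 1)].
  apply: Or32.
  have d1 p q : p \in B -> q \in B -> p != q -> d p q = 1.
    have step a b c : a \in B -> b \in B -> c \in B -> a != b -> a != c -> d a b = 1 -> d a c = 1.
      move=> aB bB cB ab ac dab; case: (eqVneq b c) => [<-//|bc].
      have ba : b != a by rewrite eq_sym. have ca : c != a by rewrite eq_sym.
      by rewrite dC (d_trans bc ba ca (pos b c bB cB)) dC.
    move=> pB qB pq; case: (eqVneq i p) => [ip|ip].
      by subst i; exact: step pB jB qB ij pq dij.
    apply: (step p i q) => //; first by rewrite eq_sym.
    by rewrite dC; exact: (step i j p).
  rewrite /block_sum (eq_bigr (fun=> #|B| + 1)); first by rewrite sum_nat_const; lia.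
  move=> k kB; rewrite (bigD1 k) //= dii (eq_bigr (fun=> 1)); last first.
    by move=> l /andP[lB lk]; rewrite d1 // eq_sym.
  rewrite sum1dep_card (cardsD1 k B) kB.
  transitivity (2 + #|B :\ k|); last by rewrite /=; lia.
  by congr (_ + _); apply: eq_card => x; rewrite !inE andbC.
apply: Or31; rewrite /block_sum (eq_bigr (fun=> #|B| * 2)).
  by rewrite sum_nat_const; lia.
move=> i iB; rewrite -sum_nat_const; apply: eq_bigr => j jB.
case: (eqVneq i j) => [<-|ij]; first by rewrite dii.
have := two i iB; move/exists_inPn => /(_ j jB); rewrite ij /=.
have := pos i j iB jB; have := rank1_le2 j (subsetP BA i iB).
by case: (d i j) => [|[|[|]]].
Qed.

(** A splitting of [b] indices into [c] and [b - c] gives at most [c ^ 2 + (b - c) ^ 2], which is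
    largest when one part has size 1. *)
Lemma rank1_gap1 (B : {set I}) : B \subset A -> 4 <= #|B| ->
  block_sum B B = 2 * #|B| ^ 2 \/ block_sum B B <= 2 * ((#|B| - 1) ^ 2 + 1).
Proof.
move=> BA B4; case: (rank1_cases BA) => [->|->|[C [CB C0 ltC ->]]]; first by left.
  (* Symmetric block: [b (b + 1) / 2 <= (b - 1) ^ 2 + 1] is an equality at [b = 4] and fails at
     [b = 3]. *)
  by right; nia.
right; have := rank1_block_le (subset_trans CB BA).
have := rank1_block_le (subset_trans (subsetDl B C) BA).
rewrite cardsD (setIidPr CB); move: ltC C0 B4.
move: #|C| #|B| => c b ltC C0 B4.
have [p [q [-> ->]]] : exists p q, c = p.+1 /\ b = p.+1 + q.+1.
  by exists c.-1, (b - c).-1; lia.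
rewrite addKn; have -> : p.+1 + q.+1 - 1 = p + q + 1 by lia.
have -> : (p + q + 1) ^ 2 = p ^ 2 + q ^ 2 + 1 + 2 * (p * q) + 2 * p + 2 * q by lia.
have E k : k.+1 ^ 2 = k ^ 2 + 2 * k + 1 by lia.
rewrite !E; lia.
Qed.

(** A part of size 1 contributes exactly 1, and [rank1_gap1] applies to the other [b - 1] indices;
    two parts of size at least 2 give at most [2 ^ 2 + (b - 2) ^ 2]. *)
Lemma rank1_gap2 (B : {set I}) : B \subset A -> 7 <= #|B| ->
  2 * ((#|B| - 1) ^ 2 + 1) <= block_sum B B \/
  block_sum B B <= 2 * ((#|B| - 2) ^ 2 + 4).
Proof.
move=> BA B7; case: (rank1_cases BA) => [->|->|[C [CB C0 ltC E]]]; first by left; nia.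
  (* Symmetric block: [b (b + 1) / 2 <= (b - 2) ^ 2 + 4] reads [28 <= 29] at [b = 7] and fails at
     [b = 6]. *)
  by right; nia.
pose D := B :\: C; have cD : #|D| = #|B| - #|C| by rewrite cardsD (setIidPr CB).
have CA := subset_trans CB BA; have DA := subset_trans (subsetDl B C) BA : D \subset A.
have one (F G : {set I}) : F \subset A -> G \subset A -> #|F| = 1 -> #|G| = #|B| - 1 ->
    block_sum B B = block_sum F F + block_sum G G ->
    2 * ((#|B| - 1) ^ 2 + 1) <= block_sum B B \/
    block_sum B B <= 2 * ((#|B| - 2) ^ 2 + 4).
  move=> FA GA F1 GB ->; have /eqP/cards1P[x Fx] := F1.
  have -> : block_sum F F = 2 by rewrite /block_sum Fx !big_set1.
  have := @rank1_gap1 G GA; rewrite GB => /(_ _)[|->|h]; [lia|left; lia|right].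
  by move: h; rewrite -subnDA; lia.
case: (eqVneq #|C| 1) => [C1|C1]; first by apply: (one C D); rewrite ?cD ?C1.
case: (eqVneq #|D| 1) => [D1|D1].
  by apply: (one D C); rewrite // 1?addnC ?E //; lia.
right; rewrite E; have := rank1_block_le CA; have := rank1_block_le DA.
rewrite -/D cD; move: cD D1 C1 C0 ltC B7; move: #|C| #|B| #|D| => c b e' -> D1 C1 C0 ltC B7.
have [k [l [cE bE]]] : exists k l, c = k + 2 /\ b = k + l + 4.
  by exists (c - 2), (b - c - 2); lia.
subst c b; have -> : k + l + 4 - (k + 2) = l + 2 by lia.
have -> : k + l + 4 - 2 = k + l + 2 by lia.
by nia.
Qed.
End RankOne.

Let g := \sum_i r i.

(** Indices with [r i = 1] and with [2 <= r i] are unlinked by [d_eqr]. Without the second kind, the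
    two previous gaps apply to [g] indices; otherwise the count is at most [(g - 2) ^ 2 + 4], which
    settles both claims. *)
Lemma multiplicity_gaps rho : 2 * rho = block_sum setT setT ->
  (4 <= g -> rho = g ^ 2 \/ rho <= (g - 1) ^ 2 + 1) /\
  (7 <= g -> (g - 1) ^ 2 + 1 <= rho \/ rho <= (g - 2) ^ 2 + 4).
Proof.
move=> rhoE; pose A := [set i | r i == 1]; pose B := ~: A.
have rA i : i \in A -> r i = 1 by rewrite inE => /eqP.
have gE : g = #|A| + \sum_(i in B) r i.
  rewrite /g (bigID (mem A)) /= (eq_bigr (fun=> 1) rA) sum1_card; congr (_ + _).
  by apply: eq_bigl => i; rewrite [RHS]inE.
have [B0|Bn0] := eqVneq #|B| 0.
  have AT : A = setT by rewrite -[A]setCK -/B (cards0_eq B0) setC0.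
  have gA : g = #|A| by rewrite gE (cards0_eq B0) big_set0 addn0.
  rewrite -AT in rhoE; split=> g4.
    by have := @rank1_gap1 A rA A (subxx _); rewrite -gA => /(_ g4); lia.
  by have := @rank1_gap2 A rA A (subxx _); rewrite -gA => /(_ g4); lia.
have E := @block_sum_split setT A (subsetT _) _.
rewrite setTD -/B in E.
have {}E : 2 * rho = block_sum A A + block_sum B B.
  rewrite rhoE E // => i j iA; rewrite inE => jA; apply/eqP; rewrite eqn0Ngt.
  have ij : i != j by apply: contraNneq jA => <-.
  by apply: contra jA => /(d_eqr ij); rewrite inE (rA i iA) => <-.
have hA := @rank1_block_le A rA A (subxx _).
pose N := \sum_(i in B) r i.
have rB i : i \in B -> 2 <= r i.
  by rewrite !inE; have := r_gt0 i; case: (r i) => [|[|]].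
have hN : 2 * #|B| <= N.
  by rewrite mulnC -sum_nat_const; apply: leq_sum.
(* In row [i] the off-diagonal entries are at most [2 * r j], so the whole row is at most
   [2 + 2 * (N - r i)]. *)
have hB : block_sum B B + 2 * N <= 2 * #|B| + 2 * (#|B| * N).
  rewrite /block_sum /N.
  have -> : 2 * #|B| + 2 * (#|B| * \sum_(i in B) r i) =
      \sum_(i in B) (2 + 2 * \sum_(j in B) r j).
    by rewrite big_split /= !sum_nat_const; lia.
  rewrite big_distrr -big_split /=; apply: leq_sum => i iB.
  rewrite -big_distrr /=.
  have -> : \sum_(j in B) d i j = 2 + \sum_(j in B | j != i) d i j.
    by rewrite (bigD1 i) //= dii.
  have -> : \sum_(j in B) r j = r i + \sum_(j in B | j != i) r j.
    by rewrite (bigD1 i).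
  suff : \sum_(j in B | j != i) d i j <= 2 * \sum_(j in B | j != i) r j by lia.
  rewrite big_distrr /=; apply: leq_sum => j /andP[_ ji].
  by rewrite dC d_le.
(* As [2 * #|B| <= N], the block [B] has dimension at most [N (N - 1) / 2]; for [2 <= N] this leaves
   [#|A| ^ 2 + N (N - 1) / 2 <= (#|A| + N - 2) ^ 2 + 4]. *)
have key : rho <= (g - 2) ^ 2 + 4 /\ 2 <= g.
  move: gE; rewrite -/N; clearbody N => gE.
  move: E hA hB hN Bn0 gE; move: (block_sum A A) (block_sum B B) #|A| #|B| => x y a b.
  move=> E hA hB hN Bn0 gE; rewrite gE.
  have [s Ns] : exists s, N = s + 2 by exists (N - 2); lia.
  subst N; have -> : a + (s + 2) - 2 = a + s by lia.
  have h1 : 2 * b * (s + 3) <= (s + 2) * (s + 3) by rewrite leq_mul2r; lia.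
  split; nia.
by split=> g4; right; have [h _] := key; first nia.
Qed.
End Multiplicities.

Local Open Scope ring_scope.

Theorem jordan_dim_gaps (R : realFieldType) (n' g : nat)
    (S : {vspace 'M[R]_n'.+1}) : jordan_algebra S -> n'.+1 = (2 * g)%N ->
  ((4 <= g)%N -> \dim S = (g ^ 2)%N \/ (\dim S <= (g - 1) ^ 2 + 1)%N) /\
  ((7 <= g)%N -> ((g - 1) ^ 2 + 1 <= \dim S)%N \/ (\dim S <= (g - 2) ^ 2 + 4)%N).
Proof.
move=> JS ng.
have [s [sP so s1]] := jordan_frame JS (jordan1 JS) (mulr1 (1 : 'M[R]_n'.+1)).
pose e (i : 'I_(size s)) := s`_i.
have es i : e i \in s by apply: mem_nth.
have eS i : e i \in S by have [] := sP _ (es i).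
have ee i : e i * e i = e i by have [] := sP _ (es i).
have e0 i : e i != 0 by have [] := sP _ (es i).
have eP i : primitive S (e i) by have [] := sP _ (es i).
have eM i j : e i * e j = if i == j then e i else 0.
  case: eqVneq => [<-//|]; rewrite -val_eqE /= neq_ltn.
  by case/orP => ij; have /pairwiseP -/(_ 0 _ _ (ltn_ord _) (ltn_ord _) ij) := so;
     case/andP => /eqP ? /eqP ?.
have e1 : \sum_i e i = 1 by rewrite -s1 (big_nth 0) big_mkord.
pose W := peirce_space S e.
pose r i := (\rank (e i))./2.
have rE i : \rank (e i) = (2 * r i)%N.
  by rewrite -[LHS]odd_double_half (negPf (jordan_even JS (eS i) (ee i))) add0n mul2n.
pose d i j := if i == j then 2%N else \dim (W i j).
have gE : g = (\sum_i r i)%N.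
  have := rank_frame eM e1; rewrite (eq_bigr _ (fun i _ => rE i)) -big_distrr /=.
  by move=> /(fun h => etrans h ng)/eqP; rewrite eqn_mul2l => /eqP.
rewrite gE; apply: (@multiplicity_gaps _ r d).
- by move=> i; have := e0 i; rewrite -mxrank_eq0 rE; lia.
- by move=> i j; rewrite /d eq_sym /W (peirceC JS eS eM i j).
- by move=> i; rewrite /d eqxx.
- by move=> i j ij; rewrite /d (negPf ij) -rE; exact: (dim_peirce_rank JS eS eM e0 eP).
- move=> i j ij; rewrite /d (negPf ij) lt0n dimv_eq0 -vpick0 => x0.
  have xW := memv_pick (W i j); move: (vpick _) x0 xW => x x0 xW.
  have ji : j != i by rewrite eq_sym.
  have a := peirce_rank JS eS eM eP ij xW x0.
  rewrite /W (peirceC JS eS eM) in xW.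
  have b := peirce_rank JS eS eM eP ji xW x0.
  by move: a b; rewrite !rE; lia.
- move=> i j k ij ik jk; rewrite /d (negPf ij) (negPf ik) (negPf jk).
  rewrite lt0n dimv_eq0 -vpick0 => x0.
  have xW := memv_pick (W i j); move: (vpick _) x0 xW => x x0 xW.
  have ji : j != i by rewrite eq_sym.
  have a := dim_peirce_transfer JS eS eM eP ij ik jk xW x0.
  rewrite /W (peirceC JS eS eM) in xW.
  have b := dim_peirce_transfer JS eS eM eP ji jk ik xW x0.
  by apply/eqP; rewrite eqn_leq a b.
rewrite (dim_peirce_sum JS eS eM e0 eP e1) /block_sum.
by rewrite [RHS](eq_bigl predT) => [|i]; rewrite ?inE //; apply: eq_bigr => i _;
   apply: eq_bigl => j; rewrite inE.
Qed.

(** * Riemann forms of a polarized complex torus *)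

(** In the row vector convention [t] is the Gram matrix of an alternating form [E] and [J] is
    multiplication by [i]; the second condition says [E(i x, i y) = E(x, y)]. *)
Definition is_riemann_form (R : nzRingType) n (J t : 'M[R]_n) : Prop :=
  t^T = - t /\ J *m t *m J^T = t.

Section RiemannForms.
Variables (R : rcfType) (n' : nat).
Local Notation n := n'.+1.
Local Notation "e ^R" := (map_mx (intr : int -> R) e) (at level 2, format "e ^R").
Variables (J : 'M[R]_n) (J2 : J * J = -1).
Local Notation riemann_form := (is_riemann_form J).

Variables (T : {vspace 'M[R]_n}) (e0 : 'M[int]_n).
Hypotheses (riemann_mem : forall e : 'M[int]_n, riemann_form e^R -> e^R \in T)
  (riemann_span : exists2 s : seq 'M[int]_n,
     {in s, forall e : 'M[int]_n, riemann_form e^R} &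
     (T <= <<[seq e^R | e : 'M[int]_n <- s]>>)%VS)
  (e0_riemann : riemann_form e0^R)
  (e0_pos : forall v : 'rV[R]_n, v != 0 -> 0 < (v *m (J *m e0^R) *m v^T) 0 0).

Local Notation E0 := (e0^R).
Definition polarized : {vspace 'M[R]_n} :=
  (linfun (mulmxr (invmx E0)) @: T)%VS.

(** [T] is the real span of the integral forms, possibly smaller than the space of all real
    invariant ones. Hence membership in [T] must be established from integer matrices, to which this
    induction reduces linear statements. *)
Lemma riemann_ind (P : 'M[R]_n -> Prop) :
  P 0 -> (forall a x y, P x -> P y -> P (a *: x + y)) ->
  (forall e : 'M[int]_n, riemann_form e^R -> P e^R) -> forall t, t \in T -> P t.
Proof.
move=> P0 PD Pe t tT; have [s sP /subvP/(_ t tT)] := riemann_span.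
move=> /(@coord_span _ _ _ (in_tuple _)) ->; elim/big_ind: _ => //.
  by move=> x y Px Py; rewrite -[x]scale1r; apply: PD.
move=> i _; rewrite -[_ *: _]addr0; apply: PD => //.
have : nth 0 [seq e^R | e <- s] i \in [seq e^R | e : 'M[int]_n <- s].
  by apply: mem_nth; rewrite ltn_ord.
by case/mapP => e /sP eP ->; apply: Pe.
Qed.

Lemma riemannP t : t \in T -> riemann_form t.
Proof.
apply: riemann_ind => //; first by split; rewrite ?trmx0 ?oppr0 // mulmx0 mul0mx.
move=> a x y [xT xJ] [yT yJ]; split.
  by rewrite linearD linearZ /= xT yT scalerN opprD.
by rewrite mulmxDr mulmxDl -scalemxAr -scalemxAl xJ yJ.
Qed.

Lemma e0_unit : E0 \in unitmx.
Proof.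
rewrite -row_free_unit -kermx_eq0; apply/rowV0P => v /sub_kermxP vE.
apply/eqP; apply: contraT => v0.
have vJJ : v *m J *m J = - v by rewrite -mulmxA mulmxE J2 mulmxN mulmx1.
have w0 : v *m J != 0.
  by apply: contra_neq v0 => w0; rewrite -[v]opprK -vJJ w0 mul0mx oppr0.
(* Positivity is tested at [v *m J], where applying [J *m E0] gives [- v *m E0], that is 0. *)
have := e0_pos w0.
by rewrite !mulmxA vJJ !mulNmx vE mul0mx oppr0 mxE ltxx.
Qed.

Let Q := J *m E0.

Lemma J_riemann t : riemann_form t -> J *m t = - (t *m J^T).
Proof.
move=> [_ tJ]; rewrite -{2}tJ -!mulmxA.
have -> : J^T *m J^T = - 1 by rewrite -trmx_mul mulmxE J2 linearN /= trmx1.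
by rewrite mulmxN mulmx1 mulmxN opprK.
Qed.

Lemma polarization_sym : Q^T = Q.
Proof.
by rewrite trmx_mul e0_riemann.1 mulNmx /Q (J_riemann e0_riemann).
Qed.

Lemma polarizedP x : reflect (exists2 t, t \in T & x = t *m invmx E0) (x \in polarized).
Proof.
apply: (iffP memv_imgP) => [[t tT ->]|[t tT ->]]; exists t => //; by rewrite lfunE.
Qed.

Lemma invE0_riemann : (invmx E0)^T = - invmx E0 /\ J^T *m invmx E0 = - (invmx E0 *m J).
Proof.
have h := J_riemann e0_riemann; split.
  rewrite trmx_inv e0_riemann.1 -scaleN1r invmxZ ?invrN1 ?scaleN1r //.
  by rewrite -scaleN1r unitmxZ ?unitrN1 ?e0_unit.
apply: (can_inj (mulKmx e0_unit)); apply: (can_inj (mulmxK e0_unit)).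
rewrite /= mulmxA (mulmxKV e0_unit) mulmxN (mulKVmx e0_unit) mulNmx h opprK //.
Qed.

Lemma polarized_J x : x \in polarized -> J *m x = x *m J.
Proof.
case/polarizedP => t /riemannP tR ->.
by rewrite mulmxA (J_riemann tR) mulNmx -!(mulmxA t) invE0_riemann.2 mulmxN opprK.
Qed.

Lemma polarized_adj x : x \in polarized -> x *m Q = Q *m x^T.
Proof.
move=> xS; rewrite mulmxA -(polarized_J xS); case/polarizedP: xS => t /riemannP tR ->.
rewrite -!mulmxA mulVmx ?e0_unit // mulmx1 /Q trmx_mul invE0_riemann.1 tR.1.
by rewrite mulNmx !mulmxN opprK (mulKVmx e0_unit).
Qed.

(** The claim is that [t E0^-1 u + u E0^-1 t] lies in [T]. By bilinearity [t] and [u] may be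
    integral; the adjugate of [e0] then clears the denominator [\det E0], and the result is an
    integral Riemann form. *)
Lemma polarizedD x y : x \in polarized -> y \in polarized -> x * y + y * x \in polarized.
Proof.
case/polarizedP => t tT ->; case/polarizedP => u uT ->.
apply/polarizedP; exists (t *m invmx E0 *m u + u *m invmx E0 *m t); last first.
  by rewrite mulmxDl -!mulmxE !mulmxA.
elim/riemann_ind: t / tT u uT => [u _|a x' y' IHx IHy u uT|e eR u].
- by rewrite !mul0mx !mulmx0 addr0 mem0v.
- rewrite !mulmxDl !mulmxDr -!scalemxAl -!scalemxAr addrACA -scalerDr.
  by rewrite memvD ?memvZ ?IHx ?IHy.
elim/riemann_ind: u / => [|a x' y' IHx IHy|f fR].
- by rewrite !mul0mx !mulmx0 addr0 mem0v.
- rewrite !mulmxDl !mulmxDr -!scalemxAl -!scalemxAr addrACA -scalerDr.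
  by rewrite memvD ?memvZ.
pose h := e *m \adj e0 *m f + f *m \adj e0 *m e.
have hE : h^R = \det E0 *: (e^R *m invmx E0 *m f^R + f^R *m invmx E0 *m e^R).
  rewrite /h map_mxD !map_mxM map_mx_adj /= /invmx e0_unit.
  rewrite -!scalemxAr -!scalemxAl scalerDr !scalerA mulfV ?scale1r //.
  by rewrite -unitfE -unitmxE e0_unit.
have d0 : \det E0 != 0 by rewrite -unitfE -unitmxE e0_unit.
have -> : e^R *m invmx E0 *m f^R + f^R *m invmx E0 *m e^R = (\det E0)^-1 *: h^R.
  by rewrite hE scalerA mulVf // scale1r.
apply/memvZ/riemann_mem; rewrite hE.
have [eT eJ] := eR; have [fT fJ] := fR; have [iT iJ] := invE0_riemann.
split.
  rewrite linearZ linearD /= !trmx_mul eT fT iT !mulNmx !mulmxN !opprK -scalerN opprD.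
  by rewrite !mulmxA addrC.
rewrite -scalemxAr -scalemxAl; congr (_ *: _); rewrite mulmxDr mulmxDl.
have aux t u : riemann_form t -> riemann_form u ->
    J *m (t *m invmx E0 *m u) *m J^T = t *m invmx E0 *m u.
  move=> tR [_ uJ]; rewrite !mulmxA (J_riemann tR) !mulNmx -(mulmxA t J^T) iJ.
  by rewrite mulmxN !mulNmx opprK -[in RHS]uJ !mulmxA.
by rewrite !aux.
Qed.

(** By self-adjointness the squared norm of [v *m x] is the pairing of [v *m x *m x] with [v]. *)
Lemma adj_pos x (v : 'rV[R]_n) : x \in polarized -> v *m x *m x = 0 -> v *m x = 0.
Proof.
move=> xS vxx; apply/eqP; apply: contraT => /e0_pos; rewrite -/Q.
by rewrite trmx_mul mulmxA -(mulmxA _ Q) -(polarized_adj xS) !mulmxA vxx !mul0mx mxE ltxx.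
Qed.

Lemma polarized_reduced x : x \in polarized -> x * x = 0 -> x = 0.
Proof.
move=> xS xx; apply/row_matrixP => i; rewrite row0 rowE.
by apply: adj_pos => //; rewrite -mulmxA mulmxE xx mulmx0.
Qed.

Lemma polarized1 : 1 \in polarized.
Proof.
apply/polarizedP; exists E0; first exact: riemann_mem.
by rewrite mulmxV ?e0_unit.
Qed.

(** [J] commutes with [e], so it acts on the image of [e] by a real matrix [K] of square -1; then
    [(\det K) ^ 2] is -1 to the power of the rank. *)
Lemma polarized_even e : e \in polarized -> idempotent e -> ~~ odd (\rank e).
Proof.
move=> eS ee; pose B := row_base e; pose K := B *m J *m pinvmx B.
have BJ : K *m B = B *m J.
  rewrite mulmxKpV // eq_row_base; have /submxP[z zE] : (B <= e)%MS by rewrite eq_row_base.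
  by rewrite zE -mulmxA -(polarized_J eS) mulmxA submxMl.
have KK : K *m K = - 1%:M.
  apply: (row_free_inj (row_base_free e)).
  rewrite /= -/B -(mulmxA K K) BJ (mulmxA K B) BJ -(mulmxA B) mulmxE J2.
  by rewrite mulmxN mulmx1 mulNmx mul1mx.
have := congr1 determinant KK; rewrite det_mulmx -scaleN1r detZ det1 mulr1 -expr2 -signr_odd.
apply: contra_eqN => o; rewrite o expr1; apply/eqP => h.
by have := sqr_ge0 (\det K); rewrite h ler0N1.
Qed.

(** Spectral theorem: an eigenvector [w1 + i w2] with eigenvalue [a + i b] exists after extension to
    the complex numbers. Symmetry of [y] between [w1] and [w2] gives
    [b (q(w1, w1) + q(w2, w2)) = 0], so [b = 0] and a nonzero part of [w] is a real eigenvector. *)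
Lemma polarized_eigen e y : e \in polarized -> idempotent e -> e != 0 ->
  y \in polarized -> e * y = y -> y * e = y ->
  exists (l : R) (v : 'rV[R]_n), [/\ v != 0, v *m e = v & v *m y = l *: v].
Proof.
move=> eS ee e0' yS ey ye; pose B := row_base e; pose K := B *m y *m pinvmx B.
have BK : K *m B = B *m y.
  by rewrite mulmxKpV // eq_row_base -ye -mulmxE mulmxA submxMl.
have Be : B *m e = B.
  have /submxP[z ->] : (B <= e)%MS by rewrite eq_row_base.
  by rewrite -mulmxA mulmxE ee.
pose c := map_mx (real_complex R).
have [l /eigenvalueP[u uK u0]] : exists l : R[i], eigenvalue (c _ _ K) l.
  have /closed_rootP[l] : size (char_poly (c _ _ K)) != 1%N.
    by rewrite size_char_poly eqSS mxrank_eq0.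
  by rewrite -eigenvalue_root_char; exists l.
pose w := u *m c _ _ B.
have w0 : w != 0.
  have cBf : row_free (c _ _ B) by rewrite /row_free mxrank_map; apply: row_base_free.
  apply: contra_neq u0 => w0; apply: (row_free_inj cBf).
  by rewrite /= -/w w0 mul0mx.
have wy : w *m c _ _ y = l *: w.
  by rewrite /w -mulmxA -map_mxM -BK map_mxM mulmxA uK scalemxAl.
have we : w *m c _ _ e = w by rewrite /w -mulmxA -map_mxM Be.
clearbody w; pose w1 := map_mx (@complex.Re R) w; pose w2 := map_mx (@complex.Im R) w.
have Re_mul (x : 'M[R]_n) : map_mx (@complex.Re R) (w *m c _ _ x) = w1 *m x.
  apply/rowP => k; rewrite !mxE raddf_sum; apply: eq_bigr => i _; rewrite !mxE.
  by case: (w 0 i) => a b /=; rewrite mulr0 subr0.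
have Im_mul (x : 'M[R]_n) : map_mx (@complex.Im R) (w *m c _ _ x) = w2 *m x.
  apply/rowP => k; rewrite !mxE raddf_sum; apply: eq_bigr => i _; rewrite !mxE.
  by case: (w 0 i) => a b /=; rewrite mulr0 add0r.
have e1 : w1 *m e = w1 by rewrite -Re_mul we.
have e2 : w2 *m e = w2 by rewrite -Im_mul we.
have y1 : w1 *m y = complex.Re l *: w1 - complex.Im l *: w2.
  rewrite -Re_mul wy; apply/rowP => k; rewrite !mxE.
  by case: l (w 0 k) {uK wy} => p q [r s].
have y2 : w2 *m y = complex.Re l *: w2 + complex.Im l *: w1.
  rewrite -Im_mul wy; apply/rowP => k; rewrite !mxE.
  by case: l (w 0 k) {y1 uK wy} => p q [r s].
move: (complex.Re l) (complex.Im l) y1 y2 => a b y1 y2.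
pose q (v v' : 'rV[R]_n) := (v *m Q *m v'^T) 0 0.
have w12 : w1 != 0 \/ w2 != 0.
  have [w10|] := eqVneq w1 0; last by left.
  right; apply: contra_neq w0 => w20; apply/rowP => k.
  have := congr1 (fun v : 'rV__ => v 0 k) w10; have := congr1 (fun v : 'rV__ => v 0 k) w20.
  by rewrite !mxE; case: (w 0 k) => r s /= -> ->.
have qge v : 0 <= q v v.
  have [->|/e0_pos/ltW//] := eqVneq v 0.
  by rewrite /q !mul0mx mxE.
have qsym v v' : q (v *m y) v' = q v (v' *m y).
  rewrite /q trmx_mul; move: (polarized_adj yS); move: Q => Q' h.
  by rewrite mulmxA -(mulmxA v Q') -h !mulmxA.
have qC v v' : q v v' = q v' v.
  rewrite /q; move: polarization_sym; move: Q => Q' Qs.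
  by rewrite -[in LHS](trmxK (v *m Q' *m v'^T)) mxE !trmx_mul trmxK Qs mulmxA.
have b0 : b = 0.
  have qD a' b' v v' v'' : q (a' *: v + b' *: v') v'' = a' * q v v'' + b' * q v' v''.
    rewrite /q 2!mulmxDl -4!scalemxAl [LHS]mxE; congr (_ + _); exact: mxE.
  have := qsym w1 w2; rewrite y1 y2 (qC w1 (_ + _)) -scaleNr !qD (qC w2 w1) => E.
  have {}E : b * (q w1 w1 + q w2 w2) = 0 by rewrite mulrDr; lra.
  have p : q w1 w1 + q w2 w2 != 0.
    apply: lt0r_neq0; case: w12 => /e0_pos h.
      by rewrite ltr_pwDl.
    by rewrite ltr_wpDl.
  by apply/eqP; move/eqP: E; rewrite mulf_eq0 (negPf p) orbF.
case: w12 => w0'; [exists a, w1|exists a, w2]; split=> //.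
  by rewrite y1 b0 scale0r subr0.
by rewrite y2 b0 scale0r addr0.
Qed.

Theorem polarized_jordan : jordan_algebra polarized /\ \dim polarized = \dim T.
Proof.
split; first split.
- exact: polarized1.
- exact: polarizedD.
- exact: polarized_reduced.
- exact: polarized_eigen.
- exact: polarized_even.
apply: limg_dim_eq; apply/eqP; rewrite -subv0; apply/subvP => t /memv_capP[_].
rewrite memv_ker lfunE /= => /eqP tE; rewrite memv0.
by rewrite -[t](mulmxKV e0_unit) tE mul0mx.
Qed.

End RiemannForms.

From mathcomp Require Import all_classical all_reals all_analysis.
Require Import Defs.
Import numFieldNormedType.Exports.
Import ComplexField.Normc.
Local Open Scope classical_set_scope.

(** * Complex exponential and logarithms *)

Section ComplexTopology.
Variable R : realType.
Local Notation C := (Cplx R).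

Definition re (z : C) : R := complex.Re z.
Definition im (z : C) : R := complex.Im z.
Definition cplx (x y : R) : C := Complex x y.
Definition cabs (z : C) : R := normc z.

Lemma cplxE z : z = cplx (re z) (im z). Proof. by case: z. Qed.
Lemma cplxP z w : re z = re w -> im z = im w -> z = w.
Proof. by move=> h1 h2; rewrite (cplxE z) (cplxE w) h1 h2. Qed.
Lemma reD z w : re (z + w) = re z + re w. Proof. by case: z; case: w. Qed.
Lemma imD z w : im (z + w) = im z + im w. Proof. by case: z; case: w. Qed.
Lemma reN z : re (- z) = - re z. Proof. by case: z. Qed.
Lemma imN z : im (- z) = - im z. Proof. by case: z. Qed.
Lemma reM z w : re (z * w) = re z * re w - im z * im w.
Proof. by case: z; case: w. Qed.
Lemma imM z w : im (z * w) = re z * im w + im z * re w.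
Proof. by case: z; case: w. Qed.
Lemma reR x : re (cplx_of_real x) = x. Proof. by []. Qed.
Lemma imR x : im (cplx_of_real x) = 0. Proof. by []. Qed.
Lemma re0 : re 0 = 0. Proof. by []. Qed.
Lemma im0 : im 0 = 0. Proof. by []. Qed.
Lemma re1 : re 1 = 1. Proof. by []. Qed.
Lemma im1 : im 1 = 0. Proof. by []. Qed.
Definition cplx_simp := (reD, imD, reN, imN, reM, imM, reR, imR, re0, im0, re1, im1).

HB.instance Definition _ := GRing.isZmodMorphism.Build C R re
  (fun z w => etrans (reD z (- w)) (congr1 _ (reN w))).
HB.instance Definition _ := GRing.isZmodMorphism.Build C R im
  (fun z w => etrans (imD z (- w)) (congr1 _ (imN w))).

HB.instance Definition _ := GRing.RMorphism.copy (@cplx_of_real R) (real_complex R).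

Lemma re_int (n : int) : re n%:~R = n%:~R.
Proof. by rewrite -(rmorph_int (@cplx_of_real R)) reR. Qed.
Lemma im_int (n : int) : im n%:~R = 0.
Proof. by rewrite -(rmorph_int (@cplx_of_real R)) imR. Qed.

Lemma normCE z : `|z| = cplx_of_real (cabs z).
Proof. by []. Qed.

Lemma cplx_of_real_lt x y : (cplx_of_real x < cplx_of_real y :> C) = (x < y).
Proof. exact: ltcR. Qed.
Lemma cplx_of_real_le x y : (cplx_of_real x <= cplx_of_real y :> C) = (x <= y).
Proof. exact: lecR. Qed.

Lemma cabs_ge0 z : 0 <= cabs z.
Proof. by rewrite -cplx_of_real_le -normCE rmorph0 normr_ge0. Qed.
Lemma cabs_eq0 z : (cabs z == 0) = (z == 0).
Proof.
apply/eqP/eqP => [h|->]; last exact: normc0.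
by apply/eqP; rewrite -normr_eq0 normCE h rmorph0.
Qed.
Lemma cabsM z w : cabs (z * w) = cabs z * cabs w. Proof. exact: normcM. Qed.
Lemma cabsD z w : cabs (z + w) <= cabs z + cabs w. Proof. exact: le_normcD. Qed.
Lemma cabsN z : cabs (- z) = cabs z. Proof. exact: normcN. Qed.
Lemma cabsV z : cabs z^-1 = (cabs z)^-1. Proof. exact: normcV. Qed.
Lemma cabs0 : cabs 0 = 0. Proof. exact: normc0. Qed.
Lemma cabs1 : cabs 1 = 1. Proof. exact: normc1. Qed.
Lemma cabsR x : cabs (cplx_of_real x) = `|x|.
Proof. by rewrite /cabs /= expr0n addr0 sqrtr_sqr. Qed.
Lemma cabs_sqr z : cabs z ^+ 2 = re z ^+ 2 + im z ^+ 2.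
Proof. by case: z => a b; rewrite /cabs /= sqr_sqrtr // addr_ge0 // sqr_ge0. Qed.
Lemma re_le_cabs z : `|re z| <= cabs z.
Proof.
rewrite -(@ler_pXn2r _ 2) ?nnegrE ?cabs_ge0 ?normr_ge0 // cabs_sqr real_normK ?num_real //.
by rewrite lerDl sqr_ge0.
Qed.
Lemma im_le_cabs z : `|im z| <= cabs z.
Proof.
rewrite -(@ler_pXn2r _ 2) ?nnegrE ?cabs_ge0 ?normr_ge0 // cabs_sqr real_normK ?num_real //.
by rewrite lerDr sqr_ge0.
Qed.
Lemma cabs_le z : cabs z <= `|re z| + `|im z|.
Proof.
rewrite -(@ler_pXn2r _ 2) ?nnegrE ?cabs_ge0 ?addr_ge0 ?normr_ge0 // cabs_sqr.
rewrite sqrrD !real_normK ?num_real // -addrA lerD2l -[leLHS]add0r lerD2r.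
by rewrite mulrn_wge0 // mulr_ge0.
Qed.
Lemma cabs_sum (I : Type) (s : seq I) (P : pred I) (F : I -> C) :
  cabs (\sum_(i <- s | P i) F i) <= \sum_(i <- s | P i) cabs (F i).
Proof.
elim/big_rec2: _ => [|i y z _ h]; first by rewrite cabs0.
by rewrite (le_trans (cabsD _ _)) // lerD2l.
Qed.

Lemma gt0_cplx_of_real (e : C) : 0 < e -> exists2 d : R, 0 < d & e = cplx_of_real d.
Proof.
case: e => a b; rewrite ltcE /= => /andP[/eqP -> a0]; exists a => //.
Qed.

(** The norm on [C] takes values in [C]; a positive complex number is real, which permits estimates
    with a real radius. *)
Lemma cvg_cplxP (T : Type) (F : set_system T) {FF : Filter F} (f : T -> C) (l : C) :
  f @ F --> l <-> forall e : R, 0 < e -> \forall x \near F, cabs (l - f x) < e.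
Proof.
split=> [/cvgrPdist_lt h e e0|h].
  have e0' : (0 : C) < cplx_of_real e by rewrite -(rmorph0 (@cplx_of_real R)) cplx_of_real_lt.
  by apply: filterS (h _ e0') => x; rewrite normCE cplx_of_real_lt.
apply/cvgrPdist_lt => e /gt0_cplx_of_real[d d0 ->].
by apply: filterS (h d d0) => x; rewrite normCE cplx_of_real_lt.
Qed.

Lemma cvg_re_imP (T : Type) (F : set_system T) {FF : Filter F} (f : T -> C) (l : C) :
  f @ F --> l <-> re (f x) @[x --> F] --> re l /\ im (f x) @[x --> F] --> im l.
Proof.
split=> [/cvg_cplxP h|[/cvgrPdist_lt h1 /cvgrPdist_lt h2]].
  split; apply/cvgrPdist_lt => e /h; apply: filterS => x; apply: le_lt_trans.
    by rewrite -raddfB re_le_cabs.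
  by rewrite -raddfB im_le_cabs.
apply/cvg_cplxP => e e0; have e2 : 0 < e / 2 by rewrite divr_gt0.
near=> x; rewrite (le_lt_trans (cabs_le _)) // [e]splitr !raddfB ltrD //.
  by near: x; exact: h1.
by near: x; exact: h2.
Unshelve. all: by end_near.
Qed.

Lemma continuous_re_im (T : topologicalType) (f : T -> C) :
  continuous f <-> continuous (re \o f) /\ continuous (im \o f).
Proof.
split=> [h|[h1 h2] x].
  by split=> x; have /cvg_re_imP[] := h x.
by apply/cvg_re_imP; split; [exact: h1|exact: h2].
Qed.

Lemma continuous_cplx (T : topologicalType) (f g : T -> R) :
  continuous f -> continuous g -> continuous (fun x => cplx (f x) (g x)).
Proof. by move=> cf cg; apply/continuous_re_im; split. Qed.

End ComplexTopology.

Section ComplexExponential.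
Variable R : realType.
Local Notation C := (Cplx R).
Implicit Types z w : C.

Definition cexp z : C := cplx (expR (re z) * cos (im z)) (expR (re z) * sin (im z)).

Lemma cexpD z w : cexp (z + w) = cexp z * cexp w.
Proof.
apply: cplxP; rewrite ?(reM, imM) /= reD imD expRD ?cosD ?sinD; ring.
Qed.

Lemma cexp0 : cexp 0 = 1.
Proof. by apply: cplxP; rewrite /= expR0 ?cos0 ?sin0 ?mulr1 ?mulr0. Qed.

Lemma cexp_neq0 z : cexp z != 0.
Proof.
apply/eqP => h; have := cexpD z (- z); rewrite subrr h mul0r cexp0 => /eqP.
by rewrite oner_eq0.
Qed.

Lemma cexpN z : cexp (- z) = (cexp z)^-1.
Proof. by apply: (mulfI (cexp_neq0 z)); rewrite -cexpD subrr cexp0 mulfV ?cexp_neq0. Qed.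

Lemma cabs_cexp z : cabs (cexp z) = expR (re z).
Proof.
apply/eqP; rewrite -(@eqrXn2 _ 2) ?cabs_ge0 ?expR_ge0 // cabs_sqr /= !exprMn -mulrDr.
by rewrite cos2Dsin2 mulr1.
Qed.

Lemma cos_periodz (x : R) (n : int) : cos (x + pi *+ 2 *~ n) = cos x.
Proof.
case: n => n; first by rewrite -pmulrn (periodicn (@cosD2pi R)).
by rewrite NegzE mulrNz -[in RHS](subrK (pi *+ 2 *+ n.+1) x) (periodicn (@cosD2pi R)).
Qed.

Lemma sin_periodz (x : R) (n : int) : sin (x + pi *+ 2 *~ n) = sin x.
Proof.
case: n => n; first by rewrite -pmulrn (periodicn (@sinD2pi R)).
by rewrite NegzE mulrNz -[in RHS](subrK (pi *+ 2 *+ n.+1) x) (periodicn (@sinD2pi R)).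
Qed.

Lemma cos_eq1 (y : R) : cos y = 1 -> exists n : int, y = pi *+ 2 *~ n.
Proof.
have p0 : 0 < pi *+ 2 :> R by rewrite mulrn_wgt0 // pi_gt0.
pose n := Num.floor (y / (pi *+ 2)); pose r := y - pi *+ 2 *~ n.
have yE : y = r + pi *+ 2 *~ n by rewrite subrK.
have r0 : 0 <= r.
  by rewrite subr_ge0 -mulrzl -ler_pdivlMr // floor_le_tmp.
have r1 : r < pi *+ 2.
  rewrite ltrBlDl -[X in _ + X]mulr1z -mulrzDr -mulrzl -ltr_pdivrMr //.
  by rewrite floorD1_gt.
rewrite {1}yE cos_periodz => c1.
suff r_eq0 : r = 0 by exists n; rewrite yE r_eq0 add0r.
have pi0 := @pi_gt0 R.
have [rp|rp] := leP r pi.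
  by apply: cos_inj; rewrite ?cos0 // in_itv /= ?lexx ?r0 ?rp ?(ltW pi0).
suff : pi *+ 2 - r = 0 by move/eqP; rewrite subr_eq0 => /eqP h; rewrite h ltxx in r1.
apply: cos_inj; rewrite ?in_itv /= ?lexx ?(ltW pi0) ?subr_ge0 ?(ltW r1) //=.
  by rewrite mulr2n; lra.
by rewrite cos0 addrC (cosD2pi (- r)) cosN.
Qed.

Lemma cexp_eq1 z : cexp z = 1 -> exists n : int, z = cplx 0 (pi *+ 2 *~ n).
Proof.
move=> h; have : cabs (cexp z) = 1 by rewrite h; exact: cabs1.
rewrite cabs_cexp -(expR0 R) => /expR_inj z0.
have := congr1 (@re R) h; rewrite /= z0 expR0 mul1r => /cos_eq1[n nE].
by exists n; rewrite -nE -z0 -cplxE.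
Qed.

Lemma cexp_periodz (n : int) : cexp (cplx 0 (pi *+ 2 *~ n)) = 1.
Proof.
by apply: cplxP; rewrite /= expR0 mul1r -[X in _ X = _]add0r ?cos_periodz ?sin_periodz ?cos0 ?sin0.
Qed.

Lemma derive_bound (f : R -> R) (l : R) : is_derive (0 : R) 1 f l ->
  forall e : R, 0 < e -> exists2 d : R, 0 < d &
    forall h : R, `|h| <= d -> `|f h - f 0 - l * h| <= e * `|h|.
Proof.
move=> [df fl] e e0.
have h0 : (fun h => h^-1 *: (f (h *: (1 : R) + 0) - f 0)) @ 0^' --> l.
  by rewrite -fl; exact: df.
move/cvgrPdist_lt: h0 => /(_ e e0) [d /= d0 dP]; exists (d / 2); first by rewrite divr_gt0.
move=> h hd; have [->|hn0] := eqVneq h 0; first by rewrite mulr0 subr0 subrr normr0 mulr0.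
have hd' : ball 0 d h.
  by rewrite /ball /= sub0r normrN (le_lt_trans hd) // ltr_pdivrMr // ltr_pMr // ltr1n.
have := dP h hd' hn0; rewrite /= addr0 [h%:A]mulr1 => /ltW.
have -> : l - h^-1 *: (f h - f 0) = - ((f h - f 0 - l * h) * h^-1).
  by rewrite [_ *: _]mulrC; field.
by rewrite normrN normrM normfV ler_pdivrMr ?normr_gt0.
Qed.

Lemma cexp_deriv0 (e : R) : 0 < e -> exists2 d : R, 0 < d &
  forall z, cabs z <= d -> cabs (cexp z - 1 - z) <= e * cabs z.
Proof.
(* The estimates of the real and imaginary parts lose factors 4 and 5, for which [e / 12] leaves
   room; the bound by 1 keeps [expR (re z)] at most 3. *)
move=> e0; have e8 : 0 < Num.min (e / 12) 1 by rewrite lt_min divr_gt0 // ltr01.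
set e' := Num.min _ _ in e8.
have e'1 : e' <= 1 by rewrite ge_min lexx orbT.
have e'e : e' <= e / 12 by rewrite ge_min lexx.
clearbody e'.
have [d1 d10 dexp] := derive_bound (is_derive_expR (0 : R)) e8.
have [d2 d20 dcos] := derive_bound (is_derive_cos (0 : R)) e8.
have [d3 d30 dsin] := derive_bound (is_derive_sin (0 : R)) e8.
exists (Num.min (Num.min d1 d2) (Num.min d3 e')).
  by rewrite (lt_min _ (Num.min d1 d2)) !(lt_min _ d1) d10 d20 lt_min d30 e8.
move=> z; rewrite !le_min => /andP[/andP[z1 z2] /andP[z3 z4]].
have rz := re_le_cabs z; have iz := im_le_cabs z; have z0 := cabs_ge0 z.
have {}dexp := dexp _ (le_trans rz z1); have {}dcos := dcos _ (le_trans iz z2).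
have {}dsin := dsin _ (le_trans iz z3).
move: dexp dcos dsin; rewrite expR0 cos0 sin0 oppr0 mul0r !mul1r ?addr0 ?subr0.
set x := re z in rz *; set y := im z in iz *; set E := expR x.
set c := cos y; set s := sin y; set Z := cabs z in rz iz z0 z1 z2 z3 z4 *.
move=> hE hc hs.
have xe : `|x| <= e' by exact: le_trans rz z4.
have x0 := normr_ge0 x; have y0 := normr_ge0 y.
have E3 : `|E| <= 3.
  have -> : E = (E - 1 - x) + (1 + x) by ring.
  rewrite (le_trans (ler_normD _ _)) // (_ : 3 = 1 + (1 + 1)); last by ring.
  rewrite lerD //.
    by rewrite (le_trans hE) // mulr_ile1 // ?(ltW e8) // (le_trans xe).
  by rewrite (le_trans (ler_normD _ _)) // normr1 lerD2l (le_trans xe).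
have h1 : `|E * c - 1 - x| <= 4 * (e' * Z).
  have -> : E * c - 1 - x = E * (c - 1) + (E - 1 - x) by ring.
  rewrite (le_trans (ler_normD _ _)) // normrM.
  have : `|E| * `|c - 1| <= 3 * (e' * Z).
    by rewrite ler_pM // (le_trans hc) // ler_wpM2l // ltW.
  have : `|E - 1 - x| <= e' * Z by rewrite (le_trans hE) // ler_wpM2l // ltW.
  by lra.
have h2 : `|E * s - y| <= 5 * (e' * Z).
  have -> : E * s - y = E * (s - y) + (E - 1 - x) * y + x * y by ring.
  have : `|E| * `|s - y| <= 3 * (e' * Z).
    by rewrite ler_pM // (le_trans hs) // ler_wpM2l // ltW.
  have : `|E - 1 - x| * `|y| <= e' * Z.
    rewrite ler_pM // (le_trans hE) // ger_pMr // (le_trans xe) //.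
  have : `|x| * `|y| <= e' * Z by rewrite ler_pM.
  rewrite -!normrM => a1 a2 a3.
  have b1 := ler_normD (E * (s - y) + (E - 1 - x) * y) (x * y).
  have b2 := ler_normD (E * (s - y)) ((E - 1 - x) * y).
  apply: le_trans (le_trans b1 (lerD (le_trans b2 (lerD a3 a2)) a1)) _.
  lra.
rewrite (le_trans (cabs_le _)) // !cplx_simp /= -/x -/y -/E -/c -/s subr0.
have h3 : e' * Z <= (e * Z) / 12 by rewrite mulrAC ler_wpM2r.
have h4 : 0 <= e * Z by rewrite mulr_ge0 // ltW.
apply: le_trans (lerD h1 h2) _; move: h3 h4; lra.
Qed.

Lemma continuous_cexp : continuous cexp.
Proof.
have [cre cim] : continuous (@re R) /\ continuous (@im R).
  by apply/(@continuous_re_im R C id) => z; exact: cvg_id.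
have cE : continuous (fun z => expR (re z)).
  by move=> z; exact: (continuous_comp (cre z) (@continuous_expR R _)).
have cc : continuous (fun z => cos (im z)).
  by move=> z; exact: (continuous_comp (cim z) (@continuous_cos R _)).
have cs : continuous (fun z => sin (im z)).
  by move=> z; exact: (continuous_comp (cim z) (@continuous_sin R _)).
apply: continuous_cplx => z; first exact: (continuousM (cE z) (cc z)).
exact: (continuousM (cE z) (cs z)).
Qed.

(** The principal branch, written by a formula valid on the right half-plane. *)
Definition clog z : C := cplx (ln (cabs z)) (atan (im z / re z)).

Lemma cabs_gt0 z : 0 < re z -> 0 < cabs z.
Proof. by move=> z0; rewrite (lt_le_trans _ (re_le_cabs z)) // normr_gt0 gt_eqF. Qed.

Lemma clogK z : 0 < re z -> cexp (clog z) = z.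
Proof.
move=> z0; have c0 := cabs_gt0 z0.
have ca : cos (atan (im z / re z)) = re z / cabs z.
  rewrite cos_atan.
  have -> : 1 + (im z / re z) ^+ 2 = (cabs z / re z) ^+ 2.
    by rewrite !exprMn cabs_sqr; field; rewrite gt_eqF.
  by rewrite sqrtr_sqr ger0_norm ?invf_div // divr_ge0 // ltW.
have sa : sin (atan (im z / re z)) = im z / cabs z.
  have ca0 : cos (atan (im z / re z)) != 0.
    by rewrite ca mulf_neq0 ?invr_neq0 // gt_eqF.
  have : tan (atan (im z / re z)) = im z / re z by rewrite atanK.
  rewrite /tan => /(congr1 (fun t => t * cos (atan (im z / re z)))).
  rewrite divfK // => ->; rewrite ca; field; by rewrite !gt_eqF.
apply: cplxP; rewrite /= lnK ?posrE // ?ca ?sa mulrC divfK // gt_eqF //.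
Qed.

Lemma clog1 : clog 1 = 0.
Proof. by rewrite /clog cabs1 ln1 im1 mul0r atan0. Qed.

Lemma continuous_clog z : 0 < re z -> {for z, continuous clog}.
Proof.
move=> z0; have [cre cim] : {for z, continuous (@re R)} /\ {for z, continuous (@im R)}.
  by apply/(@cvg_re_imP R _ (nbhs z) _ id z); exact: cvg_id.
have cca : {for z, continuous (@cabs R)}.
  suff : cabs w @[w --> z] --> cabs z by [].
  apply/(cvgrPdist_lt (FF := nbhs_filter (z : C))) => e e0.
  have /cvg_cplxP/(_ e e0) : id w @[w --> z] --> z by exact: cvg_id.
  apply: filterS => w; apply: le_lt_trans.
  have a1 := cabsD z (- (z - w)); have a2 := cabsD (z - w) w.
  rewrite cabsN subKr in a1; rewrite subrK in a2.
  by rewrite ler_norml; apply/andP; split; lra.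
have cdiv : {for z, continuous (fun z => im z / re z)}.
  have h : {for z, continuous (fun z => (re z)^-1)}.
    have rez : re z != 0 by rewrite gt_eqF.
    exact: (continuousV rez cre).
  exact: (continuousM cim h).
have h1 : {for cabs z, continuous (@ln R)} := continuous_ln (cabs_gt0 z0).
have {}h1 := continuous_comp cca h1.
have h2 := continuous_comp cdiv (@continuous_atan R _).
by apply/(cvg_re_imP (FF := nbhs_filter (z : C))); split; [exact: h1|exact: h2].
Qed.

(* [unexp z] is [exp (2 pi i z)]. *)
Definition tpi : C := cplx 0 (pi *+ 2).
Definition unexp z : C := cexp (tpi * z).

Lemma tpi_neq0 : tpi != 0.
Proof.
apply/eqP => /(congr1 (@im R)) /= /eqP; rewrite mulrn_eq0 /=.
by rewrite gt_eqF // pi_gt0.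
Qed.
Lemma unexpD z w : unexp (z + w) = unexp z * unexp w.
Proof. by rewrite /unexp mulrDr cexpD. Qed.
Lemma unexp0 : unexp 0 = 1.
Proof. by rewrite /unexp mulr0 cexp0. Qed.
Lemma unexp_neq0 z : unexp z != 0. Proof. exact: cexp_neq0. Qed.
Lemma unexpN z : unexp (- z) = (unexp z)^-1.
Proof. by rewrite /unexp mulrN cexpN. Qed.
Lemma tpi_int (n : int) : tpi * n%:~R = cplx 0 (pi *+ 2 *~ n).
Proof.
by apply: cplxP; rewrite !cplx_simp re_int im_int /= ?mul0r ?mulr0 ?addr0 ?subr0 ?add0r ?mulrzr.
Qed.
Lemma unexp_eq1 z : unexp z = 1 -> exists n : int, z = n%:~R.
Proof.
move/cexp_eq1 => [n nE]; exists n; apply: (mulfI tpi_neq0).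
by rewrite nE tpi_int.
Qed.
Lemma unexp_int (n : int) : unexp n%:~R = 1.
Proof. by rewrite /unexp tpi_int cexp_periodz. Qed.

Lemma continuous_unexp : continuous unexp.
Proof.
move=> z; have h : {for z, continuous (fun w : C => tpi * w)}.
  have idz : {for z, continuous (fun w : C => w)} by exact: cvg_id.
  exact: (continuousM (@cst_continuous C C tpi z) idz).
exact: (continuous_comp h (@continuous_cexp (tpi * z))).
Qed.

Definition unlog z : C := clog z / tpi.
Lemma unlogK z : 0 < re z -> unexp (unlog z) = z.
Proof. by move=> z0; rewrite /unexp /unlog mulrC divfK ?tpi_neq0 // clogK. Qed.
Lemma unlog1 : unlog 1 = 0. Proof. by rewrite /unlog clog1 mul0r. Qed.
Lemma continuous_unlog z : 0 < re z -> {for z, continuous unlog}.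
Proof.
by move=> z0; exact: (continuousM (continuous_clog z0) (@cst_continuous _ _ tpi^-1 z)).
Qed.

End ComplexExponential.

Lemma continuous_sum_at (K : numFieldType) (W : normedModType K) (T : topologicalType)
    (I : Type) (s : seq I) (P : pred I) (F : I -> T -> W) (v : T) :
  (forall i, P i -> {for v, continuous (F i)}) ->
  {for v, continuous (fun x => \sum_(i <- s | P i) F i x)}.
Proof. by move=> cF; apply: (cvg_big (@add_continuous W)). Qed.

(** * Continuous logarithms of nowhere vanishing functions *)

Section Logarithms.
Variable R : realType.
Local Notation C := (Cplx R).

(** [unlog] covers positive real parts and a factor -1 the negative ones. On the imaginary axis a
    square root of [z] is used: its real part is nonzero, since otherwise [z] would be a nonzero
    real number. *)
Lemma unexp_surj (z : C) : z != 0 -> exists w, unexp w = z.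
Proof.
have half : unexp (cplx_of_real (2^-1) : C) = -1.
  rewrite /unexp (_ : _ * _ = cplx 0 pi).
    by apply: cplxP; rewrite ?reN ?imN ?re1 ?im1 /= expR0 ?cospi ?sinpi ?mul1r ?oppr0.
  apply: cplxP; rewrite !cplx_simp /=; first by ring.
  by rewrite -mulr_natr; field.
have pos (w : C) : re w != 0 -> exists v, unexp v = w.
  rewrite neq_lt => /orP[w0|w0]; last by exists (unlog w); rewrite unlogK.
  exists (cplx_of_real (2^-1) + unlog (- w)).
  by rewrite unexpD half unlogK ?reN ?oppr_gt0 // mulrN mulN1r opprK.
move=> z0; have [z1|] := eqVneq (re z) 0; last exact: pos.
pose w : C := sqrtC z; have wz : w ^+ 2 = z := sqrtCK z.
have [|v vw] := pos w.
  apply: contra_neq z0 => w0; move: z1; rewrite -wz expr2 reM w0 mul0r sub0r.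
  move/eqP; rewrite oppr_eq0 mulf_eq0 orbb => /eqP w1.
  by rewrite (cplxE w) w0 w1 (_ : cplx 0 0 = 0) // mul0r.
by exists (v + v); rewrite unexpD vw -expr2.
Qed.

Lemma int_valued_path (f : R -> C) :
  (forall t : R, 0 <= t <= 1 -> {for t, continuous f}) ->
  (forall t : R, 0 <= t <= 1 -> exists m : int, f t = m%:~R) -> f 0 = f 1.
Proof.
move=> cf fint.
have [m0 E0] : exists m : int, f 0 = m%:~R by apply: fint; rewrite lexx ler01.
have [m1 E1] : exists m : int, f 1 = m%:~R by apply: fint; rewrite lexx ler01.
have cre : {within `[0, 1], continuous (@re R \o f)}.
  apply: continuous_in_subspaceT => t; rewrite inE /= in_itv /= => t01.
  by have /(cvg_re_imP (FF := nbhs_filter t))[] := cf t t01.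
rewrite E0 E1; congr (_%:~R); apply/eqP; apply: contraT => ne.
(* Distinct integer end values have this half-integer between them, and the real part would attain
   it. *)
pose h : R := (Order.min m0 m1)%:~R + 2^-1.
have [|c] := @IVT R (@re R \o f) 0 1 h ler01 cre.
  rewrite /= E0 E1 !re_int /h.
  have : (Order.min m0 m1)%:~R + 1 <= (Order.max m0 m1)%:~R :> R.
    by rewrite -[1]/(1%:~R) -intrD ler_int; case: (ltgtP m0 m1) ne => //; lia.
  have -> : Num.min (m0%:~R : R) m1%:~R = (Order.min m0 m1)%:~R.
    by case: (leP m0 m1) => [h1|/ltW h1]; [rewrite min_l ?ler_int|rewrite min_r ?ler_int].
  have -> : Num.max (m0%:~R : R) m1%:~R = (Order.max m0 m1)%:~R.
    by case: (leP m0 m1) => [h1|/ltW h1]; [rewrite max_r ?ler_int|rewrite max_l ?ler_int].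
  lra.
rewrite in_itv /= => /fint[m mE]; rewrite mE re_int /h => /eqP.
rewrite -subr_eq0 opprD addrA -intrB subr_eq0 => /eqP mh.
set k := m - _ in mh; have : (k * 2)%:~R = 1%:~R :> R.
  by rewrite intrM mh mulVf.
by move=> /eqP; rewrite eqr_int; lia.
Qed.

Lemma int_valued_constant (U : normedModType R) (f : U -> C) : continuous f ->
  (forall v, exists m : int, f v = m%:~R) -> forall u v, f u = f v.
Proof.
move=> cf fint u v; pose p (t : R) : U := u + t *: (v - u).
have cp : continuous p.
  move=> t; exact: (continuousD (@cst_continuous R U u t) (@scalel_continuous R U (v - u) t)).
have := @int_valued_path (f \o p); rewrite /p /= scale0r addr0 scale1r subrKC; apply.
  by move=> t _; exact: (continuous_comp (cp t) (cf (p t))).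
by move=> t _; exact: fint.
Qed.

(** A Lebesgue number argument for a relation that holds near each diagonal point of [K]; the second
    point [z] may leave [K]. *)
Lemma compact_uniform (U : normedModType R) (K : set U) (P : U -> U -> Prop) :
  compact K ->
  (forall x, K x -> exists2 e : R, 0 < e &
     forall a b, `|x - a| < e -> `|x - b| < e -> P a b) ->
  exists2 d : R, 0 < d & forall y z, K y -> `|y - z| < d -> P y z.
Proof.
move=> /compact_near_coveringP cK KP.
have := cK R (0^'+) (fun d y => forall z, `|y - z| < d -> P y z) _.
case=> [x /KP[e e0 eP]|d /= d0 dP].
  have e2 : 0 < e / 2 by rewrite divr_gt0.
  have xa : \forall a \near x, `|x - a| < e / 2.
    by apply/nbhs_ballP; exists (e / 2) => // a; rewrite -ball_normE.
  have dd : \forall d \near (0 : R)^'+, d < e / 2 by exact: nbhs_right_lt.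
  exists ([set a | `|x - a| < e / 2], [set d | d < e / 2]); first by [].
  move=> [a d] /= [xa' d2] z az; have ea : `|x - a| < e by move: xa'; lra.
  apply: eP => //; rewrite -(subrKA a) (le_lt_trans (ler_normD _ _)) // [e]splitr ltrD //.
  exact: lt_trans az d2.
exists (d / 2); first by rewrite divr_gt0.
move=> y z Ky yz; apply: (dP (d / 2)) => //=.
  by rewrite /ball_ /= sub0r normrN gtr0_norm ?divr_gt0 //; lra.
by rewrite divr_gt0.
Unshelve. all: by end_near. Qed.

Lemma continuous_uniform (U : normedModType R) (K : set U) (f : U -> C) (e : R) :
  compact K -> continuous f -> 0 < e ->
  exists2 d : R, 0 < d &
    forall y z, K y -> `|y - z| < d -> cabs (f y - f z) < e.
Proof.
move=> cK cf e0; apply: (@compact_uniform _ K (fun y z => cabs (f y - f z) < e)) => // x Kx.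
have e2 : 0 < e / 2 by rewrite divr_gt0.
have /(cvg_cplxP (FF := nbhs_filter x))/(_ _ e2) := cf x.
move=> /nbhs_ballP[d /= d0 dP]; exists d => // a b ad bd.
rewrite -(subrKA (f x)) (le_lt_trans (cabsD _ _)) // [e]splitr ltrD //.
  by rewrite -cabsN opprB; apply: dP; rewrite -ball_normE.
by apply: dP; rewrite -ball_normE.
Qed.

Section Lifting.
Variables (n : nat) (f : 'rV[R]_n -> C).
Hypotheses (cf : continuous f) (f0 : forall v, f v != 0).
Local Notation U := 'rV[R]_n.

(** The segment from 0 to [v] is cut into [N] pieces. When the ratios of consecutive values of [f]
    lie in the right half-plane ([good]), the sum of their principal logarithms is a logarithm of
    [f v / f 0]. *)
Let ratio (N k : nat) (v : U) : C :=
  f ((k.+1%:R / N%:R) *: v) / f ((k%:R / N%:R) *: v).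
Let good N v := forall k, (k < N)%N -> 0 < re (ratio N k v).
Let lift N v := \sum_(k < N) unlog (ratio N k v).

Lemma unexp_lift N v : (0 < N)%N -> good N v -> unexp (lift N v) = f v / f 0.
Proof.
move=> N0 gN; have h m : (m <= N)%N ->
    unexp (\sum_(k < m) unlog (ratio N k v)) = f ((m%:R / N%:R) *: v) / f 0.
  elim: m => [|m IH] mN.
    by rewrite big_ord0 unexp0 mul0r scale0r divff.
  rewrite big_ord_recr /= unexpD IH ?(ltnW mN) // unlogK ?gN //.
  by rewrite /ratio mulrC mulrA divfK.
by rewrite h // divff ?scale1r // pnatr_eq0 -lt0n.
Qed.

Lemma continuous_lift N v : good N v -> {for v, continuous (lift N)}.
Proof.
move=> gN; have cs (a : R) : continuous (fun v : U => f (a *: v)).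
  move=> w; have h1 : {for w, continuous (fun v : U => a *: v)} := @scaler_continuous R U a w.
  have h2 : {for a *: w, continuous f} by exact: cf.
  exact: (continuous_comp h1 h2).
apply: (@continuous_sum_at C C) => k _.
have cr : {for v, continuous (ratio N k)}.
  exact: (continuousM (cs _ v) (continuousV (f0 _) (cs _ v))).
exact: (continuous_comp cr (continuous_unlog (gN k (ltn_ord k)))).
Qed.

(** Along the segment from 0 to [v] the two lifts differ by a continuous integer-valued function
    that vanishes at 0. *)
Lemma lift_unique N M v : (0 < N)%N -> (0 < M)%N ->
  (forall t : R, 0 <= t <= 1 -> good N (t *: v) /\ good M (t *: v)) ->
  lift N v = lift M v.
Proof.
move=> N0 M0 g; apply/eqP; rewrite -subr_eq0; apply/eqP.
have z0 K : lift K 0 = 0.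
  by rewrite /lift big1 // => k _; rewrite /ratio !scaler0 divff // unlog1.
have := @int_valued_path (fun t => lift N (t *: v) - lift M (t *: v)).
rewrite scale0r scale1r !z0 subrr => -> // t /g[gN gM].
  have cs := @scalel_continuous R U v t.
  exact: (continuousB (continuous_comp cs (continuous_lift gN))
                      (continuous_comp cs (continuous_lift gM))).
by apply: unexp_eq1; rewrite unexpD unexpN !unexp_lift // divff // mulf_neq0 ?invr_neq0.
Qed.

Lemma good_exists (k : nat) : exists N, (0 < N)%N /\
  forall v : U, `|v| <= k%:R -> good N v.
Proof.
pose K : set U := [set v | `|v| <= k%:R].
have cK : compact K.
  apply: bounded_closed_compact.
    exists k%:R; split; first exact: num_real.
    by move=> M kM v /le_trans; apply; exact: ltW.
  by apply: (@closed_comp _ _ (fun v : U => `|v|) [set x | x <= k%:R]);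
    [move=> v _; exact: norm_continuous | exact: closed_le].
have [x Kx|d d0 dP] := @compact_uniform U K (fun y z => 0 < re (f z / f y)) cK.
  have c0 : 0 < cabs (f x) by rewrite lt0r cabs_eq0 f0 cabs_ge0.
  have c4 : 0 < cabs (f x) / 4 by rewrite divr_gt0.
  have /(cvg_cplxP (FF := nbhs_filter x))/(_ _ c4) := cf (x := x).
  move=> /nbhs_ballP[d /= d0 dP]; exists d => // a b ad bd.
  have ha : cabs (f x - f a) < cabs (f x) / 4 by apply: dP; rewrite -ball_normE.
  have hb : cabs (f x - f b) < cabs (f x) / 4 by apply: dP; rewrite -ball_normE.
  have a1 := cabsD (f x - f a) (f a); rewrite subrK in a1.
  have ab : cabs (f b - f a) < cabs (f a).
    have := cabsD (- (f x - f b)) (f x - f a); rewrite cabsN.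
    have -> : - (f x - f b) + (f x - f a) = f b - f a by ring.
    by move: ha hb a1; lra.
  have a0 : 0 < cabs (f a) by exact: le_lt_trans (cabs_ge0 _) ab.
  have r1 : cabs (f b / f a - 1) < 1.
    have -> : f b / f a - 1 = (f b - f a) / f a by rewrite mulrBl divff.
    by rewrite cabsM cabsV ltr_pdivrMr // mul1r.
  have := le_lt_trans (re_le_cabs _) r1; rewrite reD reN re1.
  by rewrite ltr_norml => /andP[h _]; lra.
pose N := (Num.truncn (k%:R / d)).+1.
have hN : k%:R / d < N%:R by exact: truncnS_gt.
exists N; split=> // v vk j jN.
have N0 : 0 < N%:R :> R by rewrite ltr0n.
apply: dP.
  rewrite /K /= normrZ ger0_norm ?divr_ge0 // (le_trans _ vk) // ler_piMl //.
  by rewrite ler_pdivrMr // mul1r ler_nat ltnW.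
rewrite -scalerBl -mulrBl normrZ -opprB -natrB // subSnn mulN1r normrN.
rewrite gtr0_norm ?invr_gt0 // mulrC ltr_pdivrMr //.
by rewrite (le_lt_trans vk) // mulrC -ltr_pdivrMr.
Qed.

(** The subdivision is chosen according to the integer radius of a ball containing [v]. By
    [lift_unique] the values agree, near a given point, with the lift for one slightly larger ball,
    so continuity survives the jumps of the radius. *)
Theorem continuous_log : exists F : U -> C,
  continuous F /\ forall v, unexp (F v) = f v.
Proof.
have [N NP] := choice good_exists.
have [w0 w0E] := unexp_surj (f0 0).
pose k (v : U) := (Num.truncn `|v|).+1.
have kv v : `|v| < (k v)%:R by exact: truncnS_gt.
have liftE v m : `|v| <= m%:R -> lift (N (k v)) v = lift (N m) v.
  move=> vm; apply: lift_unique; [by case: (NP (k v))|by case: (NP m)|].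
  move=> t /andP[t0 t1]; have tv : `|t *: v| <= `|v|.
    by rewrite normrZ ger0_norm // ler_piMl.
  split; first by apply: (NP (k v)).2; rewrite (le_trans tv) // ltW.
  by apply: (NP m).2; rewrite (le_trans tv).
exists (fun v => lift (N (k v)) v + w0); split; last first.
  move=> v; rewrite unexpD unexp_lift; [|by case: (NP (k v))|].
    by rewrite w0E divfK.
  by apply: (NP (k v)).2; exact: ltW.
move=> v; apply: (@cvgD _ _ _ (nbhs v)); last exact: cvg_cst.
have gv : good (N (k v).+1) v.
  by apply: (NP (k v).+1).2; rewrite ltW // (lt_trans (kv v)) // ltr_nat.
have vk1 : `|v| <= (k v).+1%:R by rewrite ltW // (lt_trans (kv v)) // ltr_nat.
rewrite (liftE v _ vk1); have h := continuous_lift gv.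
apply: cvg_trans h; apply: near_eq_cvg.
apply/nbhs_ballP; exists 1 => //= u; rewrite -ball_normE /= => uv.
apply/esym/liftE; have := ler_normD (- (v - u)) v; rewrite normrN opprB subrK.
by move=> /le_trans; apply; rewrite -natr1 addrC lerD // ltW.
Qed.

End Lifting.
End Logarithms.

(** * Cocycles and their Chern matrices *)

Lemma continuous_near_dist (R : realType) (T : topologicalType) (f : T -> R) (x : T)
    (e : R) : {for x, continuous f} -> 0 < e -> \forall y \near x, `|f x - f y| < e.
Proof. by move=> cf e0; move/cvgrPdist_lt: cf => /(_ e e0). Qed.

Section Cocycles.
Variables (R : realType) (n : nat).
Local Notation C := (Cplx R).
Local Notation U := 'rV[R]_n.
Local Notation ev j := (delta_mx 0 j : U).

(* The truncation of [t] to [[0, 1]]. *)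
Definition ramp (t : R) : R := (`|t| - `|t - 1| + 1) / 2.
Lemma ramp_le0 t : t <= 0 -> ramp t = 0.
Proof. by move=> t0; rewrite /ramp !ler0_norm; lra. Qed.
Lemma ramp_ge1 t : 1 <= t -> ramp t = 1.
Proof. by move=> t0; rewrite /ramp !ger0_norm; lra. Qed.
Lemma continuous_ramp : continuous ramp.
Proof.
have cn (a : R) : continuous (fun t : R => `|t - a|).
  move=> t; have h : {for t, continuous (fun t : R => t - a)}.
    exact: (continuousB (@cvg_id _ (nbhs t)) (@cst_continuous R R a t)).
  exact: (continuous_comp h (@norm_continuous R R (t - a))).
have c0 : continuous (fun t : R => `|t|) by exact: norm_continuous.
move=> t; have c1 : {for t, continuous (fun t : R => `|t| - `|t - 1| + 1)}.
  exact: (continuousD (continuousB (c0 t) (cn 1 t)) (@cst_continuous R R 1 t)).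
exact: (continuousM c1 (@cst_continuous R R 2^-1 t)).
Qed.

Lemma continuous_cplx_of_real : continuous (@cplx_of_real R).
Proof. by apply/continuous_re_im; split=> t; [exact: cvg_id|exact: cst_continuous]. Qed.

Section Solve.
Variables (j : 'I_n) (F : U -> C).
Hypothesis cF : continuous F.

(** A solution of [K (x + ev j) - K x = F x]. Formally one sums [F] over past translates, or minus
    [F] over future ones; to make the sums finite [F] is split by [ramp] into a piece vanishing for
    [x 0 j <= 0], summed over the past, and one vanishing for [x 0 j >= 1], summed over the future.
    [M] truncates the zero terms. *)
Let S (M : nat) (x : U) : C :=
  \sum_(i < M) (cplx_of_real (ramp (x 0 j - i.+1%:R)) * F (x - i.+1%:R *: ev j)) -
  \sum_(i < M) (cplx_of_real (1 - ramp (x 0 j + i%:R)) * F (x + i%:R *: ev j)).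

Lemma solve_stable M M' (x : U) : `|x 0 j| + 1 <= M%:R -> (M <= M')%N -> S M' x = S M x.
Proof.
move=> xM MM'; rewrite -(subnKC MM') /S !big_split_ord /=.
have [h1 h2] : x 0 j <= M%:R - 1 /\ 1 - M%:R <= x 0 j.
  by move: (ler_norm (x 0 j)) (ler_norm (- x 0 j)); rewrite normrN; lra.
rewrite [X in _ + X - _]big1 ?addr0 => [|i _]; last first.
  rewrite ramp_le0 ?rmorph0 ?mul0r // -natr1 natrD.
  by have : (0 : R) <= i%:R by []; lra.
rewrite [X in _ - (_ + X)]big1 ?addr0 // => i _.
rewrite ramp_ge1 ?subrr ?rmorph0 ?mul0r // natrD.
by have : (0 : R) <= i%:R by []; lra.
Qed.

Lemma coord_continuousU : continuous (fun x : U => x 0 j).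
Proof. exact: coord_continuous. Qed.

(** Both sums telescope: the far ends vanish because [ramp] is saturated there, and the near ends
    add up to [F x]. *)
Lemma solve_shift M (x : U) : `|x 0 j| + 2 <= M%:R -> S M (x + ev j) - S M x = F x.
Proof.
move=> xM; have [h1 h2] : x 0 j <= M%:R - 2 /\ 2 - M%:R <= x 0 j.
  by move: (ler_norm (x 0 j)) (ler_norm (- x 0 j)); rewrite normrN; lra.
have xj : (x + ev j) 0 j = x 0 j + 1 by rewrite !mxE !eqxx.
pose A (i : nat) := cplx_of_real (ramp (x 0 j - i%:R)) * F (x - i%:R *: ev j).
pose B (i : nat) := cplx_of_real (1 - ramp (x 0 j + i%:R)) * F (x + i%:R *: ev j).
have -> : S M (x + ev j) = \sum_(i < M) A i - \sum_(i < M) B i.+1.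
  rewrite /S xj; congr (_ - _); apply: eq_bigr => i _; rewrite /A /B; congr (cplx_of_real _ * F _).
  - by congr ramp; rewrite -natr1; ring.
  - by rewrite -natr1 scalerDl scale1r [i%:R *: _ + _]addrC addrKA.
  - by congr (1 - ramp _); rewrite -natr1; ring.
  - by rewrite -natr1 scalerDl scale1r -addrA [i%:R *: _ + _]addrC.
have -> : S M x = \sum_(i < M) A i.+1 - \sum_(i < M) B i by [].
have tele (G : nat -> C) : \sum_(i < M) G i.+1 - \sum_(i < M) G i = G M - G 0%N.
  by rewrite -sumrB -(big_mkord predT (fun i => G i.+1 - G i)) telescope_sumr.
have -> : \sum_(i < M) A i - \sum_(i < M) B i.+1 -
   (\sum_(i < M) A i.+1 - \sum_(i < M) B i) = (A 0%N - A M) - (B M - B 0%N).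
  have -> : A 0%N - A M = \sum_(i < M) A i - \sum_(i < M) A i.+1.
    by rewrite -[LHS]opprB -(tele A) opprB.
  rewrite -(tele B).
  have rearr (a b c d : C) : a - b - (c - d) = a - c - (b - d) by ring.
  exact: rearr.
rewrite /A /B [ramp (_ - M%:R)]ramp_le0 ?rmorph0 ?mul0r; last by lra.
rewrite [ramp (_ + M%:R)]ramp_ge1 ?subrr ?rmorph0 ?mul0r; last by lra.
rewrite !subr0 sub0r opprK scale0r !addr0 subr0 -mulrDl -rmorphD.
by rewrite addrC subrK rmorph1 mul1r.
Qed.

Lemma solve_continuous M : continuous (S M).
Proof.
have ct (v : U) : continuous (fun x : U => F (x + v)).
  move=> x; have h : {for x, continuous (fun x : U => x + v)}.
    exact: (continuousD (@cvg_id _ (nbhs x)) (@cst_continuous U U v x)).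
  have h2 : {for x + v, continuous F} by exact: cF.
  exact: (continuous_comp h h2).
have cr (a : R) : continuous (fun x : U => ramp (x 0 j + a)).
  move=> x; have h : {for x, continuous (fun x : U => x 0 j + a)}.
    exact: (continuousD (@coord_continuousU x) (@cst_continuous U R a x)).
  exact: (continuous_comp h (@continuous_ramp _)).
have cc (g : U -> R) : continuous g -> continuous (fun x => cplx_of_real (g x) : C).
  by move=> cg x; exact: (continuous_comp (cg x) (@continuous_cplx_of_real _)).
move=> x; apply: (@continuousB _ C); apply: (@continuous_sum_at C C) => i _.
  exact: (continuousM (cc _ (cr _) x) (ct _ x)).
have c1 : continuous (fun x : U => 1 - ramp (x 0 j + i%:R)).
  by move=> y; exact: (continuousB (@cst_continuous U R 1 y) (cr _ y)).
exact: (continuousM (cc _ c1 x) (ct _ x)).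
Qed.

(** The last clause keeps the periods of [F] transverse to [ev j], so that equations solved earlier
    in other directions stay solved. *)
Lemma solve_step : exists K : U -> C,
  [/\ continuous K, forall x, K (x + ev j) - K x = F x &
   forall p : U, p 0 j = 0 -> (forall x, F (x + p) = F x) ->
     forall x, K (x + p) = K x].
Proof.
(* The truncation plus 1 exceeds the absolute value of the coordinate; the 2 further terms leave
   room for the shift by [ev j] and for nearby points. *)
pose M (x : U) := (Num.truncn `|x 0 j|).+3.
have Mx (x : U) : `|x 0 j| + 2 <= (M x)%:R.
  have h : `|x 0 j| < (Num.truncn `|x 0 j|).+1%:R by exact: truncnS_gt.
  by rewrite /M -2!natr1; lra.
have SE (x : U) m : `|x 0 j| + 1 <= m%:R -> S (M x) x = S m x.
  move=> xm; have Mx1 : `|x 0 j| + 1 <= (M x)%:R by have := Mx x; lra.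
  case: (leqP m (M x)) => [h|/ltnW h]; last by rewrite (solve_stable Mx1 h).
  exact: solve_stable.
exists (fun x => S (M x) x); split.
- move=> x; have h := @solve_continuous (M x) x.
  have hn : \forall y \near x, S (M x) y = S (M y) y; last first.
    apply: cvg_trans h; apply: near_eq_cvg; first exact: (nbhs_filter x).
    by apply: filterS hn => y ->.
  near=> y; apply/esym/SE.
  have : `|y 0 j - x 0 j| < 1.
    near: y; have h1 := continuous_near_dist (@coord_continuousU x) ltr01.
    by apply: filterS h1 => y; rewrite distrC.
  have := ler_normD (y 0 j - x 0 j) (x 0 j); rewrite subrK.
  by have := Mx x; lra.
- move=> x; have xj : (x + ev j) 0 j = x 0 j + 1 by rewrite !mxE !eqxx.
  have hm : `|x 0 j| + 2 <= (M x)%:R by exact: Mx.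
  rewrite (SE (x + ev j) (M x)); last first.
    by rewrite xj; have := ler_normD (x 0 j) 1; rewrite normr1; lra.
  exact: solve_shift.
move=> p p0 Fp x; rewrite /M !mxE p0 addr0 /S; congr (_ - _); apply: eq_bigr => i _;
  by rewrite !mxE p0 addr0 addrAC Fp.
Unshelve. all: by end_near. Qed.
End Solve.

Lemma solve_cocycle (F : 'I_n -> U -> C) : (forall j, continuous (F j)) ->
  (forall j k x, F j (x + ev k) - F j x = F k (x + ev j) - F k x) ->
  exists2 K : U -> C, continuous K & forall j x, K (x + ev j) - K x = F j x.
Proof.
move=> cF FC.
suff H m : (m <= n)%N -> exists2 K : U -> C, continuous K &
    forall j : 'I_n, (j < m)%N -> forall x, K (x + ev j) - K x = F j x.
  by have [K cK KP] := H n (leqnn n); exists K => // j; apply: KP.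
elim: m => [_|m IH mn].
  by exists (fun=> 0) => // x; exact: cst_continuous.
have [K cK KP] := IH (ltnW mn); pose jm := Ordinal mn.
pose G x := F jm x - (K (x + ev jm) - K x).
have cKs (v : U) : continuous (fun x : U => K (x + v)).
  move=> x; have h : {for x, continuous (fun x : U => x + v)}.
    exact: (continuousD (@cvg_id _ (nbhs x)) (@cst_continuous U U v x)).
  have h2 : {for x + v, continuous K} by exact: cK.
  exact: (continuous_comp h h2).
have cG : continuous G.
  by move=> x; exact: (continuousB (cF jm x) (continuousB (cKs _ x) (cK x))).
have [H [cH HG Hp]] := solve_step jm cG.
exists (fun x => K x + H x); first by move=> x; exact: (continuousD (cK x) (cH x)).
move=> j; rewrite ltnS leq_eqVlt => /predU1P[jE|jm'] x.
  have -> : j = jm by apply: val_inj.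
  by have := HG x; rewrite /G => h; rewrite opprD addrACA h addrC subrK.
have -> : H (x + ev j) = H x.
  apply: Hp => [|y].
    by rewrite mxE eqxx; case: eqP => //= jmj; rewrite -jmj /= ltnn in jm'.
  rewrite /G; have h1 := FC jm j y; have h2 := KP j jm' (y + ev jm); have h3 := KP j jm' y.
  rewrite [y + ev j + ev jm]addrAC.
  have -> : F jm (y + ev j) = F jm y + (F j (y + ev jm) - F j y).
    by rewrite -h1 subrKC.
  by rewrite -h2 -h3; ring.
by rewrite opprD addrACA subrr addr0 KP.
Qed.

End Cocycles.

Section ChernMatrix.
Variables (R : realType) (n : nat).
Local Notation C := (Cplx R).
Local Notation U := 'rV[R]_n.
Local Notation ev j := (delta_mx 0 j : U).
Implicit Types (f F : 'I_n -> U -> C) (E : 'M[int]_n).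

Definition logs_of f F : Prop :=
  forall j, continuous (F j) /\ forall x, unexp (F j x) = f j x.

Definition is_chern f E : Prop := exists2 F, logs_of f F &
  forall j k x, F j (x + ev k) - F j x - (F k (x + ev j) - F k x) = (E j k)%:~R.

Lemma continuous_translate (V : topologicalType) (G : U -> V) (v : U) :
  continuous G -> continuous (fun x : U => G (x + v)).
Proof.
move=> cG x; have h : {for x, continuous (fun x : U => x + v)}.
  exact: (continuousD (@cvg_id _ (nbhs x)) (@cst_continuous U U v x)).
have h2 : {for x + v, continuous G} by exact: cG.
exact: (continuous_comp h h2).
Qed.

Lemma chern_exists f : (forall j, continuous (f j)) -> (forall j x, f j x != 0) ->
  (forall j k x, f j (x + ev k) * f k x = f k (x + ev j) * f j x) ->
  exists E, is_chern f E.
Proof.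
move=> cf f0 fC; have [F FP] := choice (fun j => continuous_log (cf j) (f0 j)).
pose D j k x := F j (x + ev k) - F j x - (F k (x + ev j) - F k x).
have cD j k : continuous (D j k).
  move=> x; have [cj _] := FP j; have [ck _] := FP k.
  have tj : continuous (fun x : U => F j (x + ev k)) := continuous_translate cj.
  have tk : continuous (fun x : U => F k (x + ev j)) := continuous_translate ck.
  exact: (continuousB (continuousB (tj x) (cj x)) (continuousB (tk x) (ck x))).
have Dint j k x : exists m : int, D j k x = m%:~R.
  apply: unexp_eq1; rewrite /D !(unexpD, unexpN) !(FP _).2.
  have := fC j k x; have := f0 j x; have := f0 k (x + ev j); have := f0 k x.
  move: (f j x) (f k x) (f j (x + ev k)) (f k (x + ev j)) => b d a c d0 c0 b0 h.
  have -> : a / b / (c / d) = (a * d) / (c * b) by field; apply/and3P.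
  by rewrite h divff // mulf_neq0.
have /choice[e eP] jk : exists m : int, forall x, D jk.1 jk.2 x = m%:~R.
  have [m mE] := Dint jk.1 jk.2 0; exists m => x.
  by rewrite -mE; apply: int_valued_constant (cD _ _) (Dint _ _) _ _.
exists (\matrix_(j, k) e (j, k)), F => // j k x.
by rewrite mxE -(eP (j, k) x).
Qed.

Lemma logs_unique f F F' : logs_of f F -> logs_of f F' ->
  forall j, exists m : int, forall x, F' j x = F j x + m%:~R.
Proof.
move=> lF lF' j; have [cF FE] := lF j; have [cF' FE'] := lF' j.
have cD : continuous (fun x => F' j x - F j x).
  by move=> x; exact: (continuousB (cF' x) (cF x)).
have Dint x : exists m : int, F' j x - F j x = m%:~R.
  apply: unexp_eq1; rewrite unexpD unexpN FE FE' divff // -FE; exact: unexp_neq0.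
have [m mE] := Dint 0; exists m => x.
by rewrite -mE -(int_valued_constant cD Dint x 0) subrKC.
Qed.

(** Two systems of logarithms differ by integer constants, which cancel in the differences. *)
Lemma chern_unique f E E' : is_chern f E -> is_chern f E' -> E = E'.
Proof.
move=> [F lF FE] [F' lF' FE']; apply/matrixP => j k.
have [m mE] := logs_unique lF lF' j; have [l lE] := logs_unique lF lF' k.
apply/eqP; rewrite -(eqr_int C) -(FE' j k 0) -(FE j k 0) !mE !lE; apply/eqP; ring.
Qed.

Lemma chern_skew f E : is_chern f E -> E^T = - E.
Proof.
move=> [F _ FE]; apply/matrixP => j k; rewrite !mxE; apply/eqP.
by rewrite -(eqr_int C) rmorphN /= -(FE j k 0) -(FE k j 0) [X in _ == X]opprB.
Qed.

Lemma chern_mul f f' E E' : is_chern f E -> is_chern f' E' ->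
  is_chern (fun j x => f j x * f' j x) (E + E').
Proof.
move=> [F lF FE] [F' lF' FE']; exists (fun j x => F j x + F' j x).
  move=> j; have [cF uF] := lF j; have [cF' uF'] := lF' j; split.
    by move=> x; exact: (continuousD (cF x) (cF' x)).
  by move=> x; rewrite unexpD uF uF'.
by move=> j k x; rewrite mxE rmorphD /= -(FE j k x) -(FE' j k x); ring.
Qed.

(** With [k] a logarithm of [h], each [F j] changes by [k (x + ev j) - k x], whose mixed differences
    are symmetric. *)
Lemma chern_coboundary f f' E (h : U -> C) : continuous h -> (forall x, h x != 0) ->
  (forall j x, f' j x * h x = h (x + ev j) * f j x) -> is_chern f E -> is_chern f' E.
Proof.
move=> ch h0 hE [F lF FE]; have [k [ck kE]] := continuous_log ch h0.
exists (fun j x => F j x + (k (x + ev j) - k x)).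
  move=> j; have [cF uF] := lF j; split.
    have tk : continuous (fun x : U => k (x + ev j)) := continuous_translate ck.
    by move=> x; exact: (continuousD (cF x) (continuousB (tk x) (ck x))).
  by move=> x; rewrite !(unexpD, unexpN) uF !kE mulrC mulrAC -hE mulfK.
move=> j l x; rewrite -(FE j l x) [x + ev l + ev j]addrAC; ring.
Qed.

Lemma chern0_trivial f : is_chern f 0 -> exists h : U -> C,
  [/\ continuous h, forall x, h x != 0 & forall j x, h (x + ev j) = f j x * h x].
Proof.
move=> [F lF FE]; have [||k ck kE] := @solve_cocycle R n F.
- by move=> j; have [] := lF j.
- by move=> j k x; apply/eqP; rewrite -subr_eq0 FE mxE.
exists (fun x => unexp (k x)); split.
- by move=> x; exact: (continuous_comp (ck x) (@continuous_unexp R _)).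
- by move=> x; exact: unexp_neq0.
by move=> j x; rewrite -(lF j).2 -unexpD -kE subrK.
Qed.

End ChernMatrix.

(** * Holomorphic factors have Chern matrices of type (1,1) *)

Section LatticeCoordinates.
Variables (R : realType) (g : nat).
Local Notation C := (Cplx R).
Local Notation V := 'rV[C]_g.
Local Notation n := (2 * g)%N.
Local Notation U := 'rV[R]_n.
Local Notation ev j := (delta_mx 0 j : U).
Local Notation "x %:C" := (cplx_of_real x).

Variable b : 'I_n -> V.
Hypothesis bfree : forall a : 'I_n -> R, \sum_i (a i)%:C *: b i = 0 -> forall i, a i = 0.

Definition of_coord (x : U) : V := \sum_i (x 0 i)%:C *: b i.
Definition realify (v : V) : 'rV[R]_(g + g) := row_mx (map_mx (@re R) v) (map_mx (@im R) v).
Definition period_mx : 'M[R]_(n, g + g) := \matrix_i realify (b i).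
(** The period matrix is invertible, but its sizes [2 * g] and [g + g] are distinct as types, hence
    the pseudo-inverse. *)
Definition to_coord (v : V) : U := realify v *m pinvmx period_mx.

Lemma of_coordD x y : of_coord (x + y) = of_coord x + of_coord y.
Proof.
rewrite /of_coord -big_split; apply: eq_bigr => i _ /=.
by rewrite mxE rmorphD scalerDl.
Qed.

Lemma of_coordZ a x : of_coord (a *: x) = a%:C *: of_coord x.
Proof.
rewrite /of_coord scaler_sumr; apply: eq_bigr => i _.
by rewrite mxE rmorphM scalerA.
Qed.

Lemma of_coord_ev j : of_coord (ev j) = b j.
Proof.
rewrite /of_coord (bigD1 j) //= big1 => [|i ij].
  by rewrite !mxE !eqxx rmorph1 scale1r addr0.
by rewrite !mxE (negPf ij) andbF rmorph0 scale0r.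
Qed.

Lemma of_coord0 : of_coord 0 = 0.
Proof. by rewrite -(scale0r 0) of_coordZ rmorph0 scale0r. Qed.

Lemma realifyD v w : realify (v + w) = realify v + realify w.
Proof. by rewrite /realify !map_mxD add_row_mx. Qed.

Lemma realifyZ a v : realify (a%:C *: v) = a *: realify v.
Proof.
rewrite /realify scale_row_mx; congr row_mx; apply/rowP => i;
  by rewrite !mxE !cplx_simp ?mul0r ?subr0 ?addr0.
Qed.

Lemma realify_inj : injective realify.
Proof.
move=> v w /eq_row_mx[/matrixP h1 /matrixP h2]; apply/rowP => i.
by apply: cplxP; [have := h1 0 i|have := h2 0 i]; rewrite !mxE.
Qed.

Lemma realify0 : realify 0 = 0.
Proof. by rewrite -(scale0r 0) -(rmorph0 (@cplx_of_real R)) realifyZ scale0r. Qed.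

Lemma realify_of_coord x : realify (of_coord x) = x *m period_mx.
Proof.
rewrite mulmx_sum_row /of_coord.
elim/big_rec2: _ => [|i y v _ IH]; first exact: realify0.
by rewrite realifyD realifyZ IH rowK.
Qed.

Lemma period_free : row_free period_mx.
Proof.
rewrite -kermx_eq0; apply/rowV0P => u /sub_kermxP uP.
apply/rowP => i; rewrite mxE; apply: (bfree (a := fun i => u 0 i)).
by apply: realify_inj; rewrite (realify_of_coord u) uP realify0.
Qed.

Lemma period_full : row_full period_mx.
Proof. by rewrite /row_full (eqP period_free) mul2n -addnn. Qed.

Lemma of_coordK : cancel of_coord to_coord.
Proof. by move=> x; rewrite /to_coord realify_of_coord mulmxKp // period_free. Qed.

Lemma to_coordK : cancel to_coord of_coord.
Proof.
move=> v; apply: realify_inj; rewrite realify_of_coord mulmxKpV //.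
exact/submx_full/period_full.
Qed.

Lemma to_coordD v w : to_coord (v + w) = to_coord v + to_coord w.
Proof. by rewrite /to_coord realifyD mulmxDl. Qed.

Lemma to_coord_basis j : to_coord (b j) = ev j.
Proof. by rewrite -of_coord_ev of_coordK. Qed.

Lemma continuous_of_coord : continuous of_coord.
Proof.
move=> x; apply: continuous_sum_at => i _.
have h : {for x, continuous (fun x : U => (x 0 i)%:C)}.
  have h1 : {for x, continuous (fun x : U => x 0 i)} by exact: coord_continuous.
  exact: (continuous_comp h1 (@continuous_cplx_of_real R _)).
exact: (continuousZr_tmp (a := b i) h).
Qed.

Lemma continuous_to_coord : continuous to_coord.
Proof.
move=> v; rewrite (_ : to_coord = fun v => \sum_i (to_coord v) 0 i *: ev i); last first.
  by apply/funext => w; rewrite {1}[to_coord w]row_sum_delta.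
apply: continuous_sum_at => i _; apply: (@continuousZr_tmp R U).
rewrite (_ : (fun z => _) = fun v => \sum_k realify v 0 k * (pinvmx period_mx) k i); last first.
  by apply/funext => w; rewrite mxE.
apply: (@continuous_sum_at R R) => k _.
have h : {for v, continuous (fun v : V => realify v 0 k)}.
  have hc j : continuous (fun v : V => v 0 j : C) by exact: coord_continuous.
  have [hr hi] : continuous (@re R) /\ continuous (@im R).
    by apply/(@continuous_re_im R C id) => z; exact: cvg_id.
  rewrite -[k](@splitK g g) /realify; case: (fintype.split k) => j /=.
    rewrite (_ : (fun v => _) = fun v : V => re (v 0 j)).
      exact: (continuous_comp (hc j v) (hr _)).
    by apply/funext => w; rewrite row_mxEl mxE.
  rewrite (_ : (fun v => _) = fun v : V => im (v 0 j)).
    exact: (continuous_comp (hc j v) (hi _)).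
  by apply/funext => w; rewrite row_mxEr mxE.
exact: (continuousM h (@cst_continuous V R (pinvmx period_mx k i) v)).
Qed.

Definition ii : C := 'i.
Definition J_mx : 'M[R]_n := \matrix_i to_coord (ii *: b i).

Lemma of_coord_J x : of_coord (x *m J_mx) = ii *: of_coord x.
Proof.
have -> : x *m J_mx = \sum_i x 0 i *: to_coord (ii *: b i).
  by rewrite mulmx_sum_row; apply: eq_bigr => i _; rewrite rowK.
rewrite /of_coord -/(of_coord (\sum_i x 0 i *: to_coord (ii *: b i))).
rewrite (big_morph of_coord of_coordD of_coord0) scaler_sumr.
by apply: eq_bigr => i _; rewrite of_coordZ to_coordK !scalerA mulrC.
Qed.

Lemma J_mx_sqr : J_mx *m J_mx = - 1%:M.
Proof.
apply/row_matrixP => i; rewrite !rowE; apply: (can_inj of_coordK).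
rewrite mulmxA !of_coord_J scalerA /ii -expr2 sqrCi mulmxN mulmx1.
by rewrite -[- ev i]scaleN1r of_coordZ rmorphN rmorph1.
Qed.

Lemma to_coord_J v : to_coord (ii *: v) = to_coord v *m J_mx.
Proof. by apply: (can_inj of_coordK); rewrite of_coord_J !to_coordK. Qed.

End LatticeCoordinates.

Section DirectionalDerivatives.
Variables (R : realType) (U : normedModType R).
Local Notation C := (Cplx R).
Local Notation "x %:C" := (cplx_of_real x).
Implicit Types (G D : U -> C) (x e : U) (l : C).

(** A directional derivative over real increments of a complex-valued function on a real space; the
    form without division by [h] also covers [h = 0]. *)
Definition has_ddir G e l x : Prop := forall eps : R, 0 < eps ->
  exists2 d : R, 0 < d & forall h : R, `|h| <= d ->
    cabs (G (x + h *: e) - G x - h%:C * l) <= eps * `|h|.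

Lemma cabs_tpi_ge1 : 1 <= cabs (tpi R).
Proof.
have p2 := @pi_ge2 R; rewrite /cabs /tpi /= expr0n add0r sqrtr_sqr.
by rewrite mulr2n ger0_norm; lra.
Qed.

(** Continuity of [G] makes its increment [dl] small, so [tpi R * dl] is close to [unexp dl - 1],
    the relative increment of [f], which is close to [h l / f x]. *)
Lemma ddir_log (G f : U -> C) e l x : continuous G -> (forall y, unexp (G y) = f y) ->
  has_ddir f e l x -> has_ddir G e (l / (tpi R * f x)) x.
Proof.
move=> cG Gf fl eps eps0.
have fx0 : f x != 0 by rewrite -Gf unexp_neq0.
pose m := cabs (l / f x).
have m0 : 0 <= m by exact: cabs_ge0.
(* The relative increment [q] is at most [m + 1] times the size of [h], and [tpi R * dl] at most
   twice [q]; the error of the exponential is then at most [eps / 2] times the size of [h]. *)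
pose k := eps / (4 * (m + 1)).
have k0 : 0 < k by rewrite divr_gt0 // mulr_gt0 //; lra.
have tp1 := cabs_tpi_ge1; have tp : 0 < cabs (tpi R) by exact: lt_le_trans tp1.
pose k1 := Num.min k 2^-1.
have k10 : 0 < k1 by rewrite lt_min k0 invr_gt0 ltr0n.
have [r r0 rP] := cexp_deriv0 k10.
have fx1 : 0 < cabs (f x) by rewrite lt0r cabs_eq0 fx0 cabs_ge0.
pose eps' := Num.min 1 (eps / 2) * cabs (f x).
have mn0 : 0 < Num.min 1 (eps / 2) by rewrite lt_min ltr01 divr_gt0.
have eps'0 : 0 < eps' by rewrite mulr_gt0.
have [d1 d10 d1P] := fl _ eps'0.
have cline : {for (0 : R), continuous (fun h : R => G (x + h *: e))}.
  have h1 : {for (0 : R), continuous (fun h : R => x + h *: e)}.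
    exact: (continuousD (@cst_continuous R U x 0) (@scalel_continuous R U e 0)).
  have h2 : {for x + 0 *: e, continuous G} by exact: cG.
  exact: (continuous_comp h1 h2).
have rt0 : 0 < r / cabs (tpi R) by rewrite divr_gt0.
have /(cvg_cplxP (FF := nbhs_filter (0 : R)))/(_ _ rt0) := cline.
rewrite scale0r addr0 => /nbhs_ballP[d2 /= d20 d2P].
exists (Num.min d1 (d2 / 2)); first by rewrite lt_min d10 divr_gt0.
move=> h; rewrite le_min => /andP[hd1 hd2].
set dl := G (x + h *: e) - G x.
have dl_small : cabs (tpi R * dl) <= r.
  rewrite cabsM mulrC -ler_pdivlMr // ltW // -cabsN /dl opprB; apply: d2P.
  by rewrite /ball /= sub0r normrN; lra.
pose q := f (x + h *: e) / f x - 1.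
have qE : unexp dl - 1 = q by rewrite /dl unexpD unexpN !Gf.
have h1 : cabs (q - tpi R * dl) <= k1 * cabs (tpi R * dl).
  by rewrite -qE; exact: rP.
have ql : cabs (q - h%:C * (l / f x)) <= Num.min 1 (eps / 2) * `|h|.
  have -> : q - h%:C * (l / f x) = (f (x + h *: e) - f x - h%:C * l) / f x.
    by rewrite /q; field.
  rewrite cabsM cabsV ler_pdivrMr // mulrAC; exact: d1P.
have h0 := normr_ge0 h.
have qb : cabs q <= (m + 1) * `|h|.
  have := cabsD (q - h%:C * (l / f x)) (h%:C * (l / f x)).
  rewrite subrK cabsM cabsR -/m.
  have : Num.min 1 (eps / 2) * `|h| <= 1 * `|h| by rewrite ler_wpM2r // ge_min lexx.
  by move: ql; lra.
have tdl : cabs (tpi R * dl) <= 2 * cabs q.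
  have := cabsD (- (q - tpi R * dl)) q; rewrite cabsN opprB subrK.
  have : k1 * cabs (tpi R * dl) <= 2^-1 * cabs (tpi R * dl).
    by rewrite ler_wpM2r ?cabs_ge0 // ge_min lexx orbT.
  by move: h1; lra.
have -> : dl - h%:C * (l / (tpi R * f x)) =
    - ((q - tpi R * dl) - (q - h%:C * (l / f x))) / tpi R.
  by field; rewrite fx0 tpi_neq0.
rewrite cabsM cabsV cabsN ler_pdivrMr //.
have a1 : k1 * cabs (tpi R * dl) <= k * (2 * ((m + 1) * `|h|)).
  rewrite ler_pM ?cabs_ge0 ?(ltW k10) // ?ge_min ?lexx //.
  by move: tdl qb; lra.
have a2 : k * (2 * ((m + 1) * `|h|)) = eps / 2 * `|h|.
  by rewrite /k; field; lra.
have a3 : Num.min 1 (eps / 2) * `|h| <= eps / 2 * `|h|.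
  by rewrite ler_wpM2r // ge_min lexx orbT.
have a4 : eps * `|h| <= eps * `|h| * cabs (tpi R).
  by rewrite ler_peMr // mulr_ge0 // ltW.
have := cabsD (q - tpi R * dl) (- (q - h%:C * (l / f x))); rewrite cabsN.
by move: h1 ql a1 a2 a3 a4; lra.
Qed.

Lemma ddir_re_im G D x e : (forall t : R, has_ddir G e (D (x + t *: e)) (x + t *: e)) ->
  forall t : R, is_derive t 1 (fun t : R => re (G (x + t *: e))) (re (D (x + t *: e))) /\
    is_derive t 1 (fun t : R => im (G (x + t *: e))) (im (D (x + t *: e))).
Proof.
move=> GD t.
have key (p : {additive C -> R}) : (forall z, `|p z| <= cabs z) ->
    (forall (a : R) z, p (a%:C * z) = a * p z) ->
    is_derive t 1 (fun t : R => p (G (x + t *: e))) (p (D (x + t *: e))).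
  move=> ple pZ; set f := fun t : R => _; set l := p (D _).
  have cvf : (fun h : R => h^-1 *: ((f \o shift t) (h *: (1 : R)) - f t)) @ 0^' --> l.
    apply/cvgrPdist_lt => eps eps0; have e2 : 0 < eps / 2 by rewrite divr_gt0.
    have [d d0 dP] := GD t _ e2.
    exists d => //= h; rewrite /ball_ /= sub0r normrN => hd h0.
    have := dP h (ltW hd); rewrite -(addrA x) -scalerDl.
    have -> : (h *: (1 : R) + t) = t + h by rewrite [h%:A]mulr1 addrC.
    move=> hP; have hP' : `|f (t + h) - f t - h * l| <= eps / 2 * `|h|.
      by have := le_trans (ple _) hP; rewrite !raddfB pZ.
    have -> : l - h^-1 *: (f (t + h) - f t) = - ((f (t + h) - f t - h * l) / h).
      by rewrite [_ *: _]mulrC; field.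
    rewrite normrN normrM normfV (@le_lt_trans _ _ (eps / 2)) //; last by lra.
    by rewrite ler_pdivrMr ?normr_gt0.
  apply: DeriveDef; first by apply/cvg_ex; exists l.
  exact: cvg_lim cvf.
split; [apply: (key (@re R))|apply: (key (@im R))].
- exact: re_le_cabs.
- by move=> a z; rewrite /= reM reR imR mul0r subr0.
- exact: im_le_cabs.
- by move=> a z; rewrite /= imM reR imR mul0r addr0.
Qed.

(** The factor 2 comes from applying the real mean value theorem to the real and imaginary parts
    separately. *)
Lemma ddir_mean_value G D x e (h eta : R) : 0 < h ->
  (forall t : R, has_ddir G e (D (x + t *: e)) (x + t *: e)) ->
  (forall t : R, 0 <= t <= h -> cabs (D (x + t *: e) - D x) <= eta) ->
  cabs (G (x + h *: e) - G x - h%:C * D x) <= 2 * eta * h.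
Proof.
move=> h0 GD Deta; have dP := ddir_re_im GD.
have key (p : {additive C -> R}) : (forall z, `|p z| <= cabs z) ->
    (forall (a : R) z, p (a%:C * z) = a * p z) ->
    (forall t : R, is_derive t 1 (fun t : R => p (G (x + t *: e))) (p (D (x + t *: e)))) ->
    `|p (G (x + h *: e) - G x - h%:C * D x)| <= eta * h.
  move=> ple pZ pd; have [|c] := MVT h0 (fun t _ => pd t).
    apply: derivable_within_continuous => t _; have [] := pd t; move=> dt _; exact: dt.
  rewrite in_itv /= => /andP[c0 ch]; rewrite scale0r addr0 subr0 => E.
  rewrite !raddfB pZ E mulrC -mulrBr -raddfB normrM gtr0_norm // mulrC.
  rewrite ler_wpM2r ?(ltW h0) // (le_trans (ple _)) //.
  by apply: Deta; rewrite !ltW.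
rewrite (le_trans (cabs_le _)) // (_ : 2 * eta * h = eta * h + eta * h); last by ring.
apply: lerD; [apply: (key (@re R))|apply: (key (@im R))].
- exact: re_le_cabs.
- by move=> a z; rewrite /= reM reR imR mul0r subr0.
- by move=> t; have [] := dP t.
- exact: im_le_cabs.
- by move=> a z; rewrite /= imM reR imR mul0r addr0.
- by move=> t; have [] := dP t.
Qed.

(** Uniform continuity of [D] near [K], fed into the mean value estimate, makes the difference
    quotients uniformly close to [D]; this is what lets sums over ever finer grids be controlled. *)
Lemma ddir_uniform G D e (K : set U) (eps : R) : compact K -> continuous D ->
  (forall x, has_ddir G e (D x) x) -> 0 < eps ->
  exists N0 : nat, forall N x, (N0 <= N)%N -> K x ->
    cabs (N.+1%:R%:C * (G (x + N.+1%:R^-1 *: e) - G x) - D x) <= eps.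
Proof.
move=> cK cD GD eps0; have e2 : 0 < eps / 2 by rewrite divr_gt0.
have [d d0 dP] := continuous_uniform cK cD e2.
pose N0 := Num.truncn ((1 + `|e|) / d).
have e0 : 0 < 1 + `|e| by rewrite ltr_pwDl.
exists N0 => N x NN Kx.
have N_gt0 : 0 < N.+1%:R :> R by rewrite ltr0n.
have hN : (1 + `|e|) / d < N.+1%:R.
  by rewrite (lt_le_trans (truncnS_gt _)) // ler_nat ltnS.
have h0 : 0 < N.+1%:R^-1 :> R by rewrite invr_gt0.
have small (t : R) : 0 <= t <= N.+1%:R^-1 -> cabs (D (x + t *: e) - D x) <= eps / 2.
  move=> /andP[t0 tN]; rewrite -cabsN opprB; apply/ltW/dP => //.
  rewrite opprD addNKr normrN normrZ ger0_norm //.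
  rewrite (@le_lt_trans _ _ (N.+1%:R^-1 * `|e|)) ?ler_wpM2r //.
  rewrite mulrC ltr_pdivrMr // (@lt_le_trans _ _ (1 + `|e|)) ?ltrDr //.
  by rewrite mulrC -ler_pdivrMr // ltW.
have := ddir_mean_value h0 (fun t => GD _) small.
have -> : N.+1%:R%:C * (G (x + N.+1%:R^-1 *: e) - G x) - D x =
    N.+1%:R%:C * (G (x + N.+1%:R^-1 *: e) - G x - N.+1%:R^-1%:C * D x).
  by rewrite [RHS]mulrBr [X in _ = _ - X]mulrA -rmorphM divff ?gt_eqF // rmorph1 mul1r.
rewrite cabsM cabsR gtr0_norm // => h; rewrite mulrC -ler_pdivlMr //.
by rewrite (le_trans h) // mulrCA divff ?pnatr_eq0 // mulr1.
Qed.
End DirectionalDerivatives.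

Section Holomorphic.
Variables (R : realType) (g : nat).
Local Notation C := (Cplx R).
Local Notation V := 'rV[C]_g.
Local Notation n := (2 * g)%N.
Local Notation U := 'rV[R]_n.
Variable b : 'I_n -> V.
Local Notation phi := (of_coord b).

Lemma holomorphic_ddir (f : V -> C) (e x : U) : holomorphic f ->
  has_ddir (f \o phi) e ('D_(phi e) f (phi x)) x.
Proof.
move=> [df _] eps eps0.
have dv : derivable f (phi x) (phi e) := diff_derivable (df (phi x)).
have cv : (fun h : C => h^-1 *: (f (h *: phi e + phi x) - f (phi x))) @ 0^' -->
    'D_(phi e) f (phi x) := dv.
move/cvg_cplxP: cv => /(_ eps eps0) [dC /= dC0 dP].
have [d d0 dE] := gt0_cplx_of_real dC0.
exists (d / 2); first by rewrite divr_gt0.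
move=> h hd; have [->|h0] := eqVneq h 0.
  by rewrite scale0r addr0 rmorph0 mul0r subrr subr0 cabs0 normr0 mulr0.
have hC0 : cplx_of_real h != 0 by rewrite -cabs_eq0 cabsR normr_eq0.
have hb : ball_ (fun z : C => `|z|) 0 dC (cplx_of_real h).
  by rewrite /ball_ /= sub0r normrN normCE cabsR dE cplx_of_real_lt; lra.
have := dP _ hb hC0; rewrite /= of_coordD of_coordZ [phi x + _]addrC.
set q := f (_ + _) - _; set D := 'D_ _ _ _ => hq.
have -> : q - cplx_of_real h * D = - (cplx_of_real h * (D - (cplx_of_real h)^-1 *: q)).
  by rewrite mulrBr [_ *: q]/((_)^-1 * q) mulVKf // opprB.
by rewrite cabsN cabsM cabsR mulrC ler_wpM2r // ltW.
Qed.
End Holomorphic.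

(** * Grid sums in place of integrals over the faces of the unit cube *)

Section GridAverages.
Variables (R : realType) (n : nat).
Local Notation C := (Cplx R).
Local Notation U := 'rV[R]_n.
Local Notation ev j := (delta_mx 0 j : U).

Definition clear_coord (j : 'I_n) (x : U) : U := \row_i (if i == j then 0 else x 0 i).

Lemma clear_coordD j x y : clear_coord j (x + y) = clear_coord j x + clear_coord j y.
Proof. by apply/rowP => i; rewrite !mxE; case: eqP; rewrite ?addr0. Qed.

Lemma clear_coord_ev j k (t : R) : j != k -> clear_coord j (t *: ev k) = t *: ev k.
Proof.
move=> jk; apply/rowP => i; rewrite !mxE; case: eqP => // ->.
by rewrite (negPf jk) andbF mulr0.
Qed.

Lemma clear_coordC j k x : clear_coord j (clear_coord k x) = clear_coord k (clear_coord j x).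
Proof. by apply/rowP => i; rewrite !mxE; case: eqP; case: eqP. Qed.

Section Grid.
Variable N : nat.
Local Notation grid := {ffun 'I_n -> 'I_N.+1}.
Local Notation step := (N.+1%:R^-1 : R).
Implicit Types a : grid.

Definition grid_point a : U := \row_i ((a i)%:R * step).
Definition update a k t : grid := [ffun i => if i == k then t else a i].

Lemma sum_fibers k (h : grid -> C) :
  \sum_a h a = \sum_(a : grid | a k == ord0) \sum_t h (update a k t).
Proof.
rewrite exchange_big (partition_big (fun a : grid => a k) predT) //=.
apply: eq_bigr => t _; rewrite (reindex_onto (fun a => update a k t)
  (fun a => update a k ord0)) /=; last first.
  by move=> a /eqP ak; apply/ffunP => i; rewrite !ffunE; case: eqP => // ->.
apply: eq_bigl => a; rewrite ffunE eqxx eqxx /=.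
apply/eqP/eqP => [<-|ak]; first by rewrite !ffunE eqxx.
by apply/ffunP => i; rewrite !ffunE; case: eqP => // ->.
Qed.

Lemma grid_point_update a k t :
  grid_point (update a k t) = clear_coord k (grid_point a) + (t%:R * step) *: ev k.
Proof.
apply/rowP => i; rewrite !mxE !ffunE; case: (i =P k) => _ /=.
  by rewrite mulr1 add0r.
by rewrite mulr0 addr0.
Qed.

Lemma clear_grid_update a k t :
  clear_coord k (grid_point (update a k t)) = clear_coord k (grid_point a).
Proof. by apply/rowP => i; rewrite !mxE !ffunE; case: eqP. Qed.

(** On each grid line in direction [k] the increments add up to a full period; the factor [N.+1]
    appears because the right-hand side counts every line once per grid point. *)
Lemma grid_telescope k (phi : U -> C) :
  N.+1%:R * \sum_(a : grid) (phi (grid_point a + step *: ev k) - phi (grid_point a)) =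
  \sum_(a : grid) (phi (clear_coord k (grid_point a) + ev k) - phi (clear_coord k (grid_point a))).
Proof.
rewrite !(sum_fibers k) mulr_sumr; apply: eq_bigr => a _.
rewrite [RHS](eq_bigr (fun=> phi (clear_coord k (grid_point a) + ev k) -
  phi (clear_coord k (grid_point a)))) => [|t _]; last by rewrite clear_grid_update.
rewrite sumr_const card_ord -[RHS]mulr_natl; congr (_ * _).
pose G (t : nat) := phi (clear_coord k (grid_point a) + (t%:R * step) *: ev k).
rewrite (eq_bigr (fun t : 'I_N.+1 => G t.+1 - G t)) => [|t _]; last first.
  by rewrite grid_point_update -(addrA (clear_coord k _)) -scalerDl /G -[t.+1%:R]natr1 mulrDl mul1r.
rewrite -(big_mkord predT (fun i => G i.+1 - G i)) telescope_sumr // /G.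
by rewrite mulfV ?pnatr_eq0 // scale1r mul0r scale0r addr0.
Qed.

Variables (F : 'I_n -> U -> C) (E : 'M[int]_n).
Hypothesis FE : forall j k x,
  F j (x + ev k) - F j x - (F k (x + ev j) - F k x) = (E j k)%:~R.

(** Up to the factor [N.+1 ^ n], a Riemann sum for the integral of the derivative of [F j] along
    [ev k] over the face [x_j = 0]; every face point occurs [N.+1] times. *)
Definition face_sum j k : C :=
  \sum_(a : grid) (N.+1%:R * (F j (clear_coord j (grid_point a) + step *: ev k) -
                     F j (clear_coord j (grid_point a)))).

Lemma face_sum_off j k : j != k -> face_sum j k =
  \sum_(a : grid) (F j (clear_coord j (clear_coord k (grid_point a)) + ev k) -
          F j (clear_coord j (clear_coord k (grid_point a)))).
Proof.
move=> jk; have h x (t : R) : clear_coord j x + t *: ev k = clear_coord j (x + t *: ev k).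
  by rewrite clear_coordD clear_coord_ev.
rewrite /face_sum -mulr_sumr; under eq_bigr do rewrite h.
rewrite (grid_telescope k (F j \o clear_coord j)) /=; apply: eq_bigr => a _.
by have := h (clear_coord k (grid_point a)) 1; rewrite scale1r => ->.
Qed.

(* Integrating [dF_j] over the face [x_j = 0] of the unit cube: the increment
   of [F_j] along [e_k] telescopes, and the cocycle relation gives [E]. *)
Lemma face_sum_sub j k :
  face_sum j k - face_sum k j = (N.+1 ^ n)%N%:R * (E j k)%:~R.
Proof.
case: (eqVneq j k) => [<-|jk].
  by rewrite subrr -(FE j j 0) subrr mulr0.
rewrite !face_sum_off // 1?eq_sym // -sumrB.
rewrite (eq_bigr (fun=> (E j k)%:~R)) => [|a _]; last first.
  by rewrite clear_coordC FE.
by rewrite sumr_const card_ffun !card_ord mulr_natl.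
Qed.

End Grid.

(** The discrete form of: the complexified direction [c] annihilates every [F j]. For [c] with
    [\sum_k c k *: b k = 0] these are the Cauchy-Riemann equations. *)
Definition asymptotically_flat (F : 'I_n -> U -> C) (c : 'I_n -> C) : Prop :=
  forall j (eps : R), 0 < eps -> exists N0 : nat, forall N (x : U), (N0 <= N)%N ->
    (forall i, 0 <= x 0 i <= 1) ->
    cabs (\sum_k c k * (N.+1%:R * (F j (x + N.+1%:R^-1 *: ev k) - F j x))) <= eps.

(** By [face_sum_sub], [E] is the normalized [face_sum] matrix minus its transpose. Flatness makes
    that matrix arbitrarily small once its second argument is [c] or [c'], so both terms of the
    pairing of [c'] with [c] tend to 0. *)
Lemma flat_isotropic (F : 'I_n -> U -> C) (E : 'M[int]_n) (c c' : 'I_n -> C) :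
  (forall j k x,
    F j (x + ev k) - F j x - (F k (x + ev j) - F k x) = (E j k)%:~R) ->
  asymptotically_flat F c -> asymptotically_flat F c' ->
  \sum_j \sum_k c' j * c k * (E j k)%:~R = 0.
Proof.
move=> FE fc fc'; set S := \sum_j _; apply/eqP; rewrite -cabs_eq0 eq_le cabs_ge0 andbT.
apply/ler_addgt0Pl => eps eps0; rewrite addr0.
pose m := \sum_j (cabs (c j) + cabs (c' j)) + 1.
have m0 : 0 < m.
  by rewrite ltr_wpDl // sumr_ge0 // => j _; rewrite addr_ge0 // cabs_ge0.
have e0 : 0 < eps / m by rewrite divr_gt0.
have [N1 P1] := choice (fun j => fc j _ e0); have [N2 P2] := choice (fun j => fc' j _ e0).
pose N := (\max_j maxn (N1 j) (N2 j))%N.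
have N1N j : (N1 j <= N)%N by rewrite (leq_trans (leq_maxl _ (N2 j))) // leq_bigmax.
have N2N j : (N2 j <= N)%N by rewrite (leq_trans (leq_maxr (N1 j) _)) // leq_bigmax.
have box j (a : {ffun 'I_n -> 'I_N.+1}) i : 0 <= clear_coord j (grid_point a) 0 i <= 1.
  rewrite !mxE; case: eqP => _; first by rewrite lexx ler01.
  by rewrite mulr_ge0 //= ler_pdivrMr // mul1r ler_nat ltnW.
have row_le j (d : 'I_n -> C) : (forall x : U, (forall i, 0 <= x 0 i <= 1) ->
     cabs (\sum_k d k * (N.+1%:R * (F j (x + N.+1%:R^-1 *: ev k) - F j x))) <= eps / m) ->
    cabs (\sum_k d k * face_sum N F j k) <= (N.+1 ^ n)%N%:R * (eps / m).
  move=> dP; rewrite /face_sum; under eq_bigr do rewrite mulr_sumr.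
  rewrite exchange_big /= (le_trans (cabs_sum _ _ _)) //.
  rewrite (le_trans (ler_sum _ (fun a _ => dP _ (box j a)))) //.
  by rewrite sumr_const card_ffun !card_ord mulr_natl.
have SE : (N.+1 ^ n)%N%:R * S = \sum_j c' j * (\sum_k c k * face_sum N F j k) -
     \sum_k c k * (\sum_j c' j * face_sum N F k j).
  rewrite /S mulr_sumr; under eq_bigr do rewrite mulr_sumr.
  under [X in _ = X - _]eq_bigr do rewrite mulr_sumr.
  under [X in _ = _ - X]eq_bigr do rewrite mulr_sumr.
  rewrite [X in _ = _ - X]exchange_big /= -sumrB; apply: eq_bigr => j _.
  rewrite -sumrB; apply: eq_bigr => k _.
  rewrite mulrCA -(face_sum_sub N FE) /=; ring.
have Nn0 : 0 < (N.+1 ^ n)%N%:R :> R by rewrite ltr0n expn_gt0.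
rewrite -(ler_pM2l Nn0).
have cabs_nat (k : nat) : cabs (k%:R : C) = k%:R.
  by rewrite -(rmorph_nat (@cplx_of_real R)) cabsR ger0_norm.
rewrite -[X in X * cabs S]cabs_nat -cabsM SE.
rewrite (le_trans (cabsD _ _)) // cabsN.
have h1 : cabs (\sum_j c' j * (\sum_k c k * face_sum N F j k)) <=
    \sum_j cabs (c' j) * ((N.+1 ^ n)%N%:R * (eps / m)).
  rewrite (le_trans (cabs_sum _ _ _)) // ler_sum // => j _.
  rewrite cabsM ler_wpM2l ?cabs_ge0 //; apply: row_le => x xb.
  exact: P1.
have h2 : cabs (\sum_k c k * (\sum_j c' j * face_sum N F k j)) <=
    \sum_j cabs (c j) * ((N.+1 ^ n)%N%:R * (eps / m)).
  rewrite (le_trans (cabs_sum _ _ _)) // ler_sum // => j _.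
  rewrite cabsM ler_wpM2l ?cabs_ge0 //; apply: row_le => x xb.
  exact: P2.
rewrite (le_trans (lerD h1 h2)) // -!mulr_suml -mulrDl mulrCA ler_wpM2l ?(ltW Nn0) //.
rewrite mulrA ler_pdivrMr // mulrC ler_wpM2l ?(ltW eps0) // /m big_split /=.
by rewrite addrC lerDl.
Qed.

End GridAverages.

(** * The first Chern class of a line bundle *)

Lemma iiE (R : realType) : ii R = cplx 0 1. Proof. by []. Qed.

Section FirstChernClass.
Variables (R : realType) (g : nat) (A : abelian_variety R g).
Local Notation C := (Cplx R).
Local Notation V := 'rV[C]_g.
Local Notation n := (2 * g)%N.
Local Notation U := 'rV[R]_n.
Local Notation ev j := (delta_mx 0 j : U).
Local Notation L := (lattice A).
Variable b : 'I_n -> V.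
Hypothesis bfree : forall a : 'I_n -> R,
  \sum_i cplx_of_real (a i) *: b i = 0 -> forall i, a i = 0.
Hypothesis bL : L = [set v | exists m : 'I_n -> int, v = \sum_i b i *~ m i].
Local Notation phi := (of_coord b).
Local Notation psi := (to_coord b).
Implicit Types M N : line_bundle A.

Lemma lattice_sub l m : L l -> L m -> L (l - m).
Proof.
rewrite bL => -[p ->] [q ->]; exists (fun i => p i - q i).
by rewrite -sumrB; apply: eq_bigr => i _; rewrite mulrzBr.
Qed.
Lemma lattice0 : L 0.
Proof. by rewrite bL; exists (fun=> 0); rewrite big1 // => i _; rewrite mulr0z. Qed.
Lemma latticeN l : L l -> L (- l).
Proof. by move=> Ll; rewrite -sub0r; apply: lattice_sub lattice0 Ll. Qed.
Lemma latticeD l m : L l -> L m -> L (l + m).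
Proof. by move=> Ll Lm; rewrite -[m]opprK; apply: lattice_sub Ll (latticeN Lm). Qed.
Lemma lattice_basis j : L (b j).
Proof.
rewrite bL; exists (fun i => (i == j)%:Z); rewrite (bigD1 j) //= eqxx mulr1z big1 ?addr0 //.
by move=> i /negPf ->; rewrite mulr0z.
Qed.

Lemma lattice_ind (P : V -> Prop) : P 0 -> (forall j, P (b j)) ->
  (forall l, L l -> P l -> P (- l)) ->
  (forall l m, L l -> L m -> P l -> P m -> P (l + m)) -> forall l, L l -> P l.
Proof.
move=> P0 Pb PN PD l; rewrite {1}bL => -[m ->].
suff [] : L (\sum_i b i *~ m i) /\ P (\sum_i b i *~ m i) by [].
elim/big_ind: _ => [|x y [Lx Px] [Ly Py]|i _]; first by split=> //; exact: lattice0.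
  by split; [exact: latticeD|exact: PD].
have nat_case k : L (b i *+ k) /\ P (b i *+ k).
  elim: k => [|k [Lk Pk]]; first by rewrite mulr0n; split=> //; exact: lattice0.
  by rewrite mulrS; split;
    [apply: latticeD (lattice_basis i) Lk|apply: PD => //; exact: lattice_basis].
case: (m i) => k; first by rewrite -pmulrn.
by rewrite NegzE mulrNz -pmulrn; have [Lk Pk] := nat_case k.+1; split;
  [exact: latticeN|exact: PN].
Qed.

Definition period_factor M (j : 'I_n) (x : U) : C := factor M (b j) (phi x).

Lemma period_factor_neq0 M j x : period_factor M j x != 0.
Proof. exact: (factor_neq0 M (lattice_basis j)). Qed.

Lemma continuous_factor M l : L l -> continuous (factor M l).
Proof.
by move=> Ll v; have [df _] := factor_holomorphic M Ll; exact: differentiable_continuous (df v).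
Qed.

Lemma continuous_period_factor M j : continuous (period_factor M j).
Proof.
move=> x; have h := @continuous_factor M _ (lattice_basis j).
exact: (continuous_comp (@continuous_of_coord R g b x) (h (phi x))).
Qed.

Lemma period_factorC M j k x :
  period_factor M j (x + ev k) * period_factor M k x =
  period_factor M k (x + ev j) * period_factor M j x.
Proof.
rewrite /period_factor !of_coordD !of_coord_ev.
have Lj := lattice_basis j; have Lk := lattice_basis k.
by rewrite -(factorD M Lj Lk) -(factorD M Lk Lj) addrC.
Qed.

Lemma chern_bundle M : exists E, is_chern (period_factor M) E.
Proof.
apply: chern_exists.
- exact: continuous_period_factor.
- exact: period_factor_neq0.
- exact: period_factorC.
Qed.

Definition chern M : 'M[int]_n := projT1 (cid (chern_bundle M)).
Lemma chernP M : is_chern (period_factor M) (chern M).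
Proof. by rewrite /chern; case: cid. Qed.

Lemma chernE M E : is_chern (period_factor M) E -> chern M = E.
Proof. exact: chern_unique (chernP M). Qed.

Lemma chern_tensor M N : chern (tensor M N) = chern M + chern N.
Proof. exact/chernE/chern_mul/chernP/chernP. Qed.

Lemma chern_top_isomorphic M N : top_isomorphic M N -> chern M = chern N.
Proof.
move=> [h [ch h0 hE]]; apply/esym/chernE.
apply: (@chern_coboundary _ _ (period_factor M) _ _ (h \o phi)) (chernP M).
- by move=> x; exact: (continuous_comp (@continuous_of_coord R g b x) (ch (phi x))).
- by move=> x; exact: h0.
- by move=> j x /=; rewrite of_coordD of_coord_ev /period_factor hE //; exact: lattice_basis.
Qed.

Lemma chern0_top_trivial M : chern M = 0 -> top_isomorphic (trivial_bundle A) M.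
Proof.
move=> M0; have := chernP M; rewrite M0 => /chern0_trivial[h [ch h0 hE]].
exists (h \o psi); split.
- move=> v; have h1 : {for v, continuous psi} by exact: continuous_to_coord.
  have h2 : {for psi v, continuous h} by exact: ch.
  exact: (continuous_comp h1 h2).
- by move=> v; exact: h0.
move=> l Ll v; rewrite /= mulr1.
have factor0 v' : factor M 0 v' = 1.
  have L0 := lattice0; apply: (mulfI (factor_neq0 M L0 v')).
  by have := factorD M L0 L0 v'; rewrite !addr0 mulr1 => <-.
(* The trivialization is known for basis vectors only; the factor relation extends it to sums and
   opposites. *)
move: v; elim/lattice_ind: l / Ll => [v|j v|l Ll IH v|l m Ll Lm IHl IHm v].
- by rewrite factor0 mul1r addr0.
- by rewrite to_coordD (to_coord_basis bfree) hE /period_factor (to_coordK bfree).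
- have := factorD M Ll (latticeN Ll) v; rewrite subrr factor0 => E.
  by have := IH (v - l); rewrite subrK => <-; rewrite mulrA [_ * factor M l _]mulrC -E mul1r.
- by rewrite (factorD M Ll Lm) -mulrA IHm IHl -addrA [m + l]addrC.
Qed.

(** Directions [c] with [\sum_k c k *: b k = 0] are flat because the differential of a holomorphic
    factor is complex linear, hence isotropic for the Chern matrix. Real parts of these relations
    give the invariance under [J_mx b]. *)
Lemma chern_riemann M : (chern M)^T = - chern M /\
  J_mx b *m map_mx (intr : int -> R) (chern M) *m (J_mx b)^T = map_mx intr (chern M).
Proof.
have cM := chernP M; split; first exact: chern_skew cM.
have [F lF FE] := cM.
have flat (c : 'I_n -> C) : \sum_k c k *: b k = 0 -> asymptotically_flat F c.
  move=> c0 j eps eps0; pose f := factor M (b j).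
  have fH : holomorphic f := factor_holomorphic M (lattice_basis j).
  have [cF Ff] := lF j.
  pose D k x := 'D_(b k) f (phi x) / (tpi R * f (phi x)).
  have cD k : continuous (D k).
    move=> x; have cx := @continuous_of_coord R g b x.
    have h1 : {for x, continuous (fun x => 'D_(b k) f (phi x))}.
      exact: (continuous_comp cx (fH.2 (b k) (phi x))).
    have h2 : {for x, continuous (fun x : U => tpi R * f (phi x))}.
      have h0 : {for x, continuous (fun x : U => f (phi x))}.
        exact: (@continuous_period_factor M j x).
      exact: (continuousM (@cst_continuous U C (tpi R) x) h0).
    have n0 : tpi R * f (phi x) != 0.
      by rewrite mulf_neq0 ?tpi_neq0 //; exact: period_factor_neq0.
    have h3 : {for x, continuous (fun x : U => (tpi R * f (phi x))^-1)}.
      by apply: continuousV.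
    exact: (continuousM h1 h3).
  have GD k x : has_ddir (F j) (ev k) (D k x) x.
    apply: (ddir_log cF Ff); rewrite -(of_coord_ev b k).
    exact: (holomorphic_ddir b (ev k) x fH).
  pose K : set U := [set x | forall i, 0 <= x 0 i <= 1].
  have cK : compact K.
    rewrite (_ : K = [set x : U | forall i, `[(0 : R), 1]%classic (x 0 i)]).
      by apply: (@rV_compact R n (fun=> `[(0 : R), 1]%classic)) => i; exact: segment_compact.
    by apply/seteqP; split=> x Kx i; have := Kx i; rewrite /= in_itv.
  pose m := \sum_k cabs (c k) + 1.
  have m0 : 0 < m by rewrite ltr_wpDl // sumr_ge0 // => k _; exact: cabs_ge0.
  have e0 : 0 < eps / m by rewrite divr_gt0.
  have [N0 NP] := choice (fun k => ddir_uniform cK (cD k) (GD k) e0).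
  exists (\max_k N0 k)%N => N x NN Kx.
  have Dc0 : \sum_k c k * D k x = 0.
    rewrite /D; under eq_bigr do rewrite mulrA; rewrite -mulr_suml.
    rewrite (_ : \sum_k _ = 'D_(\sum_k c k *: b k) f (phi x)).
      by rewrite c0 derive0 mul0r.
    rewrite deriveE; last exact: fH.1.
    rewrite linear_sum; apply: eq_bigr => k _; rewrite linearZ /= deriveE //.
    exact: fH.1.
  set Q := \sum_k _; have -> : Q = \sum_k c k *
      (N.+1%:R * (F j (x + N.+1%:R^-1 *: ev k) - F j x) - D k x).
    transitivity (Q - \sum_k c k * D k x); first by rewrite Dc0 subr0.
    rewrite /Q -sumrB.
    by apply: eq_bigr => k _; rewrite [RHS]mulrBr.
  rewrite (le_trans (cabs_sum _ _ _)) //.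
  rewrite (@le_trans _ _ (\sum_k cabs (c k) * (eps / m))) //.
    apply: ler_sum => k _; rewrite cabsM ler_wpM2l ?cabs_ge0 //.
    have kN : (N0 k <= N)%N by rewrite (leq_trans _ NN) // leq_bigmax.
    have := NP k N x kN Kx.
    by rewrite rmorph_nat.
  rewrite -mulr_suml mulrA ler_pdivrMr // mulrC ler_wpM2l ?(ltW eps0) //.
  by rewrite /m lerDl.
(* This is [b p + i (i b p) = 0] written in coordinates, the second [i] being expressed by the
   matrix [J_mx b]. *)
pose c p k : C := cplx ((p == k)%:R) (J_mx b p k).
have cp p : \sum_k c p k *: b k = 0.
  have cE k : c p k = cplx_of_real (p == k)%:R + ii R * cplx_of_real (J_mx b p k).
    by apply: cplxP; rewrite !cplx_simp /=; ring.
  under eq_bigr do rewrite cE scalerDl -scalerA.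
  rewrite big_split /= -scaler_sumr.
  rewrite (bigD1 p) //= eqxx rmorph1 scale1r big1 ?addr0; last first.
    by move=> k /negPf; rewrite eq_sym => ->; rewrite rmorph0 scale0r.
  have -> : \sum_k cplx_of_real (J_mx b p k) *: b k = ii R *: b p.
    rewrite -(of_coord_ev b p) -(of_coord_J bfree) /of_coord; apply: eq_bigr => k _.
    by congr (cplx_of_real _ *: _); rewrite -rowE [RHS]mxE.
  by rewrite scalerA /ii -expr2 sqrCi scaleN1r subrr.
apply/matrixP => q p.
have := flat_isotropic FE (flat _ (cp p)) (flat _ (cp q)).
move/(congr1 (@re R)).
have reE j k : re (c q j * c p k * (chern M j k)%:~R) =
    ((q == j)%:R * (p == k)%:R - J_mx b q j * J_mx b p k) * (chern M j k)%:~R.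
  by rewrite !cplx_simp re_int im_int mulr0 subr0.
rewrite raddf_sum; under eq_bigr do (rewrite raddf_sum; under eq_bigr do rewrite /= reE mulrBl).
under eq_bigr do rewrite sumrB; rewrite sumrB re0.
rewrite (bigD1 q) //= (bigD1 p) //= !eqxx mul1r mul1r.
rewrite big1 => [|k kp]; last by rewrite eq_sym (negPf kp) mulr0 mul0r.
rewrite addr0 big1 => [|j jq]; last first.
  by rewrite big1 // => k _; rewrite eq_sym (negPf jq) !mul0r.
rewrite addr0 => /eqP; rewrite subr_eq0 => /eqP E.
rewrite [RHS]mxE E mxE exchange_big; apply: eq_bigr => k _ /=.
rewrite [(_ *m _) q k]mxE [(J_mx b)^T k p]mxE mulr_suml; apply: eq_bigr => j _.
by rewrite [map_mx _ _ j k]mxE mulrAC.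
Qed.

End FirstChernClass.

(** * Holomorphic exponentials and Appell-Humbert bundles *)

Section ExponentialsOfLinearForms.
Variables (R : realType) (g : nat).
Local Notation C := (Cplx R).
Local Notation V := 'rV[C]_g.

Lemma cexp_cvg (z : C) :
  (fun h : C => h^-1 *: (cexp (h *: (1 : C) + z) - cexp z)) @ 0^' --> cexp z.
Proof.
apply/cvg_cplxP => eps eps0.
have z0 : 0 < cabs (cexp z) by rewrite lt0r cabs_eq0 cexp_neq0 cabs_ge0.
have e0 : 0 < eps / 2 / cabs (cexp z) by rewrite !divr_gt0.
have [d d0 dP] := cexp_deriv0 e0.
exists (cplx_of_real d); first by rewrite /= -(rmorph0 (@cplx_of_real R)) cplx_of_real_lt.
move=> h; rewrite /ball_ /= sub0r normrN normCE cplx_of_real_lt => hd h0.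
have hn : 0 < cabs h by rewrite lt0r cabs_eq0 h0 cabs_ge0.
have -> : h%:A + z = h + z by rewrite [h%:A]mulr1.
rewrite [_ *: _]/(h^-1 * _).
have -> : cexp z - h^-1 * (cexp (h + z) - cexp z) =
    - (cexp z * (cexp h - 1 - h) / h).
  by rewrite cexpD; field.
rewrite cabsN cabsM cabsV cabsM ltr_pdivrMr //.
apply: (@le_lt_trans _ _ (eps / 2 * cabs h)); last by rewrite ltr_pM2r //; lra.
rewrite -[leRHS](@divfK _ (cabs (cexp z))) ?gt_eqF // mulrC ler_pM2r //.
by rewrite mulrAC; apply: dP; exact: ltW.
Qed.

Lemma holomorphic_cst (c : C) : holomorphic (fun _ : V => c).
Proof.
split=> [v|u]; first exact: differentiable_cst.
rewrite (_ : 'D_u _ = cst 0); first exact: cst_continuous.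
by apply/funext => v; rewrite derive_cst.
Qed.

Lemma holomorphic_cexp_linear (f : {linear V -> C^o}) : continuous f ->
  holomorphic (fun v => cexp (f v)).
Proof.
move=> cf.
have df v : differentiable f v by exact: linear_differentiable.
have de (z : C) : derivable (cexp (R := R) : C^o -> C^o) z 1.
  by apply/cvg_ex; exists (cexp z); exact: cexp_cvg.
have dde (z : C) : differentiable (cexp (R := R) : C^o -> C^o) z.
  exact/derivable1_diffP.
have dc v : differentiable ((cexp (R := R) : C^o -> C^o) \o f) v.
  exact: differentiable_comp.
split; first by move=> v; exact: (dc v).
move=> u.
rewrite (_ : 'D_u _ = fun v => f u * cexp (f v)).
  move=> v.
  have ce : {for v, continuous (fun v => cexp (f v))}.
    exact: (continuous_comp (cf v) (@continuous_cexp R (f v))).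
  exact: (continuousM (@cst_continuous V C (f u) v) ce).
apply/funext => v; rewrite (deriveE u (dc v)) diff_comp //= diff_lin // diff1E //.
rewrite derive1E.
have -> : 'D_1 (cexp (R := R) : C^o -> C^o) (f v) = cexp (f v).
  apply: cvg_lim => //; exact: cexp_cvg.
by [].
Qed.

End ExponentialsOfLinearForms.

Section AppellHumbert.
Variables (R : realType) (g : nat) (A : abelian_variety R g).
Local Notation C := (Cplx R).
Local Notation V := 'rV[C]_g.
Local Notation n := (2 * g)%N.
Local Notation U := 'rV[R]_n.
Local Notation ev j := (delta_mx 0 j : U).
Local Notation L := (lattice A).
Variable b : 'I_n -> V.
Hypothesis bfree : forall a : 'I_n -> R,
  \sum_i cplx_of_real (a i) *: b i = 0 -> forall i, a i = 0.
Hypothesis bL : L = [set v | exists m : 'I_n -> int, v = \sum_i b i *~ m i].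
Local Notation phi := (of_coord b).
Local Notation psi := (to_coord b).
Local Notation J := (J_mx b).
Variable e : 'M[int]_n.
Hypotheses (e_skew : e^T = - e)
  (e_J : J *m map_mx (intr : int -> R) e *m J^T = map_mx intr e).

Definition pairing (x y : U) : R := (x *m map_mx intr e *m y^T) 0 0.

Lemma pairingDl x x' y : pairing (x + x') y = pairing x y + pairing x' y.
Proof. by rewrite /pairing !mulmxDl mxE. Qed.
Lemma pairingDr x y y' : pairing x (y + y') = pairing x y + pairing x y'.
Proof. by rewrite /pairing linearD /= mulmxDr mxE. Qed.
Lemma pairingZl a x y : pairing (a *: x) y = a * pairing x y.
Proof. by rewrite /pairing -!scalemxAl mxE. Qed.
Lemma pairingNl x y : pairing (- x) y = - pairing x y.
Proof. by rewrite -scaleN1r pairingZl mulN1r. Qed.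
Lemma pairingC x y : pairing x y = - pairing y x.
Proof.
transitivity ((x *m map_mx intr e *m y^T)^T 0 0); first by rewrite [RHS]mxE.
rewrite !trmx_mul trmxK mulmxA map_trmx e_skew.
by rewrite map_mxN mulmxN mulNmx mxE.
Qed.
Lemma pairing_J x y : pairing (x *m J) (y *m J) = pairing x y.
Proof. by rewrite /pairing trmx_mul !mulmxA -(mulmxA x J) -(mulmxA x) e_J. Qed.
Lemma pairing_Jswap x y : pairing (x *m J) y = pairing (y *m J) x.
Proof.
rewrite -pairing_J -mulmxA (J_mx_sqr bfree) mulmxN mulmx1 pairingNl.
by rewrite [RHS]pairingC.
Qed.
Lemma pairing_ev j k : pairing (ev j) (ev k) = (e j k)%:~R.
Proof. by rewrite /pairing -rowE trmx_delta -colE !mxE. Qed.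

Lemma to_coordZ (a : R) v : psi (cplx_of_real a *: v) = a *: psi v.
Proof. by rewrite /to_coord realifyZ -scalemxAl. Qed.

(** The Hermitian form [H(v, y) = E(i v, y) + i E(v, y)] of the alternating form [E], with the
    antilinear argument [y] taken as a parameter in lattice coordinates. *)
Definition herm_form (y : U) (v : V) : C^o :=
  cplx (pairing (psi v *m J) y) (pairing (psi v) y).

Lemma herm_form_is_linear y : linear (herm_form y).
Proof.
move=> a v w.
have aE : a *: v = cplx_of_real (re a) *: v + ii R *: (cplx_of_real (im a) *: v).
  rewrite scalerA -scalerDl; congr (_ *: _).
  by apply: cplxP; rewrite !cplx_simp /=; ring.
have psiE : psi (a *: v + w) = re a *: psi v + im a *: psi v *m J + psi w.
  by rewrite to_coordD aE to_coordD (to_coord_J bfree) !to_coordZ.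
rewrite /herm_form psiE !mulmxDl -!scalemxAl -(mulmxA _ J J) (J_mx_sqr bfree).
rewrite mulmxN mulmx1 !pairingDl !pairingZl pairingNl.
have scaleE (z : C^o) : a *: z = (a : C) * z by [].
by rewrite scaleE; apply: cplxP; rewrite !cplx_simp /=; ring.
Qed.
HB.instance Definition _ y :=
  GRing.isLinear.Build C V C^o *:%R (herm_form y) (herm_form_is_linear y).

Lemma herm_formDl y y' v : herm_form (y + y') v = herm_form y v + herm_form y' v.
Proof. by rewrite /herm_form !pairingDr; apply: cplxP; rewrite ?cplx_simp. Qed.

Lemma continuous_linear_form (f : {linear V -> C^o}) : continuous f.
Proof.
rewrite (_ : (f : V -> C) = fun v : V => \sum_k v 0 k * f (delta_mx 0 k)).
  move=> v; apply: (@continuous_sum_at C C) => k _.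
  have hc : {for v, continuous (fun v : V => v 0 k : C)} by exact: coord_continuous.
  exact: (continuousM hc (@cst_continuous V C (f (delta_mx 0 k)) v)).
apply/funext => v; rewrite {1}[v]row_sum_delta linear_sum; apply: eq_bigr => k _.
by rewrite linearZ.
Qed.

(** Its [unexp] is [exp(2 pi H(v, l) + pi H(l, l))], the Appell-Humbert factor of the doubled form
    [2 H]. Doubling makes the cocycle defect the integer [E(l, m)], so no semicharacter has to be
    chosen. *)
Definition ah_log (l v : V) : C :=
  - ii R * herm_form (psi l) v - ii R / 2 * herm_form (psi l) l.

Lemma ah_log_cocycle l m v : ah_log (l + m) v =
  ah_log l (v + m) + ah_log m v + cplx_of_real (pairing (psi l) (psi m)).
Proof.
rewrite /ah_log to_coordD !herm_formDl !linearD /=.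
have h : herm_form (psi m) l - herm_form (psi l) m =
    2 * ii R * cplx_of_real (pairing (psi l) (psi m)).
  rewrite /herm_form [pairing (psi m *m J) _]pairing_Jswap [pairing (psi m) _]pairingC.
  by apply: cplxP; rewrite !cplx_simp /=; ring.
have ii2 : ii R * ii R = -1 by rewrite -expr2 sqrCi.
move: (herm_form (psi m) l) (herm_form (psi l) m) h => p q h.
have -> : p = q + 2 * ii R * cplx_of_real (pairing (psi l) (psi m)) by rewrite -h subrKC.
move: (herm_form _ _) (herm_form _ _) (herm_form _ _) (herm_form _ _) (cplx_of_real _).
move=> a c d f t.
rewrite [X in _ = _ + X](_ : t = - (ii R * ii R) * t); last first.
  by rewrite ii2 opprK mul1r.
by field.
Qed.

Definition ah_factor (l v : V) : C := unexp (ah_log l v).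

Lemma pairing_int l m : L l -> L m -> exists k : int, pairing (psi l) (psi m) = k%:~R.
Proof.
have coordL v : L v -> exists p : 'I_n -> int, psi v = \sum_i (p i)%:~R *: ev i.
  rewrite bL => -[p ->]; exists p; apply: (can_inj (of_coordK bfree)).
  rewrite (to_coordK bfree) (big_morph phi (of_coordD b) (of_coord0 b)).
  by apply: eq_bigr => i _; rewrite of_coordZ of_coord_ev rmorph_int scaler_int.
move=> /coordL[p ->] /coordL[q ->].
have sumEl (x : 'I_n -> U) y : pairing (\sum_i x i) y = \sum_i pairing (x i) y.
  by rewrite /pairing !mulmx_suml summxE.
exists (\sum_i \sum_j p i * q j * e i j).
rewrite sumEl rmorph_sum; apply: eq_bigr => i _ /=.
rewrite pairingC sumEl rmorph_sum -sumrN; apply: eq_bigr => j _ /=.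
by rewrite pairingZl pairingC pairingZl pairing_ev !rmorphM /=; ring.
Qed.

Lemma ah_holomorphic l : L l -> holomorphic (ah_factor l).
Proof.
move=> _; pose f : {linear V -> C^o} := (tpi R * - ii R : C) \*: herm_form (psi l).
have -> : ah_factor l = fun v => cexp (f v) * unexp (- (ii R / 2 * herm_form (psi l) l)).
  apply/funext => v; rewrite /ah_factor /ah_log unexpD /unexp; congr (cexp _ * _).
  by rewrite mulrA.
apply: holomorphicM; last exact: holomorphic_cst.
exact/holomorphic_cexp_linear/continuous_linear_form.
Qed.

Lemma ah_neq0 l : L l -> forall v, ah_factor l v != 0.
Proof. by move=> _ v; exact: unexp_neq0. Qed.

Lemma ah_factorD l m : L l -> L m -> forall v,
  ah_factor (l + m) v = ah_factor l (v + m) * ah_factor m v.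
Proof.
move=> Ll Lm v; have [k kE] := pairing_int Ll Lm.
rewrite /ah_factor ah_log_cocycle kE rmorph_int unexpD unexp_int mulr1.
by rewrite unexpD.
Qed.

Definition ah_bundle : line_bundle A :=
  LineBundle (@ah_holomorphic) (@ah_neq0) (@ah_factorD).

(** The defect of [ah_log_cocycle] enters once for each order of the two basis vectors, with
    opposite signs, and skewness turns this into a factor 2. The factor -2 is harmless, since the
    real span is what counts. *)
Lemma chern_ah_bundle : chern bL ah_bundle = - (e *+ 2).
Proof.
apply: chernE; exists (fun j x => ah_log (b j) (phi x)).
  move=> j; split=> //.
  have cl : continuous (fun v => ah_log (b j) v).
    move=> v; have h : {for v, continuous (herm_form (psi (b j)) : V -> C)}.
      exact: (@continuous_linear_form (herm_form (psi (b j)))).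
    exact: (continuousD (continuousM (@cst_continuous V C (- ii R) v) h)
      (@cst_continuous V C (- (ii R / 2 * herm_form (psi (b j)) (b j))) v)).
  by move=> x; exact: (continuous_comp (@continuous_of_coord R g b x) (cl (phi x))).
move=> j k x; rewrite !of_coordD !of_coord_ev.
have h := ah_log_cocycle (b j) (b k) (phi x); have h' := ah_log_cocycle (b k) (b j) (phi x).
rewrite addrC in h'; move: h; rewrite h' !(to_coord_basis bfree) => h.
rewrite [pairing (ev k) _]pairingC in h; rewrite pairing_ev in h.
rewrite mulr2n !mxE rmorphN rmorphD /= -!(rmorph_int (@cplx_of_real R)).
rewrite rmorphN /= in h.
set t := cplx_of_real _ in h *.
have -> : ah_log (b j) (phi x + b k) =
    ah_log (b k) (phi x + b j) + ah_log (b j) (phi x) - t - ah_log (b k) (phi x) - t.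
  by rewrite h; ring.
ring.
Qed.

End AppellHumbert.

(** * Picard numbers *)

Section RiemannGaps.
Variable R : realType.
Local Notation "e ^R" := (map_mx (intr : int -> R) e) (at level 2, format "e ^R").

(** Passage from the size [2 * g] to a successor, for which square matrices form a ring. *)
Lemma riemann_dim_gaps (n g : nat) (J : 'M[R]_n) (T : {vspace 'M[R]_n})
    (s : seq 'M[int]_n) (e0 : 'M[int]_n) :
  n = (2 * g)%N -> (0 < g)%N -> J *m J = - 1%:M ->
  (forall e : 'M[int]_n, is_riemann_form J e^R -> e^R \in T) ->
  {in s, forall e : 'M[int]_n, is_riemann_form J e^R} ->
  (T <= <<[seq e^R | e : 'M[int]_n <- s]>>)%VS ->
  is_riemann_form J e0^R ->
  (forall v : 'rV[R]_n, v != 0 -> 0 < (v *m (J *m e0^R) *m v^T) 0 0) ->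
  ((4 <= g)%N -> \dim T = (g ^ 2)%N \/ (\dim T <= (g - 1) ^ 2 + 1)%N) /\
  ((7 <= g)%N -> ((g - 1) ^ 2 + 1 <= \dim T)%N \/ (\dim T <= (g - 2) ^ 2 + 4)%N).
Proof.
case: n J T s e0 => [|n] J T s e0 ng g0 J2 memT sP Ts e0R e0pos.
  by move/eqP: ng; rewrite eq_sym muln_eq0 /= -leqn0 leqNgt g0.
have [JA <-] := polarized_jordan J2 memT (ex_intro2 _ _ s sP Ts) e0R e0pos.
exact: jordan_dim_gaps JA ng.
Qed.

(** A rational relation becomes integral after multiplication by the product of its denominators,
    and the rank does not change from the rationals to [R]. *)
Lemma Z_independent_row_free (r m : nat) (W : 'M[int]_(r, m)) :
  (forall k : 'rV[int]_r, k *m W = 0 -> k = 0) -> row_free W^R.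
Proof.
move=> Wfree; pose WQ := map_mx (intr : int -> rat) W.
have -> : W^R = map_mx (ratr : rat -> R) WQ.
  by apply/matrixP => i j; rewrite !mxE ratr_int.
rewrite row_free_map -kermx_eq0; apply/rowV0P => u /sub_kermxP uW.
pose d : int := \prod_i denq (u 0 i).
have d0 : d != 0 by apply/prodf_neq0 => i _; rewrite denq_eq0.
pose k : 'rV[int]_r := \row_i (numq (u 0 i) * \prod_(l | l != i) denq (u 0 l)).
have kE : map_mx (intr : int -> rat) k = d%:~R *: u.
  apply/rowP => i; rewrite !mxE /d [X in _ = X%:~R * _](bigD1 i) //= !intrM numqE; ring.
have k0 : k = 0.
  apply: Wfree; apply/matrixP => i j; apply: (@intr_inj rat).
  have : map_mx (intr : int -> rat) (k *m W) = 0.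
    by rewrite map_mxM kE -scalemxAl uW scaler0.
  by move/matrixP/(_ i j); rewrite !mxE => ->.
have : d%:~R *: u = 0 by rewrite -kE k0; apply/rowP => i; rewrite !mxE.
by move/eqP; rewrite scaler_eq0 intr_eq0 (negPf d0) => /eqP.
Qed.

Lemma Z_independent_free (n r : nat) (E : 'I_r -> 'M[int]_n) :
  Z_independent E <-> free (mktuple (fun i => (E i)^R)).
Proof.
split=> [Efree|/freeP Efree k k0 i].
  pose W : 'M[int]_(r, n * n) := \matrix_i mxvec (E i).
  have Wf : row_free W^R.
    apply: Z_independent_row_free => k kW; apply/rowP => i; rewrite mxE.
    apply: (Efree (fun i => k 0 i)); apply: (can_inj mxvecK); rewrite linear0 -kW.
    rewrite mulmx_sum_row linear_sum; apply: eq_bigr => l _.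
    by rewrite rowK -scaler_int intz linearZ.
  apply/freeP => k k0 i.
  have : (\row_i k i) *m W^R = 0.
    transitivity (mxvec (\sum_(l < r) k l *: (mktuple (fun i => (E i)^R))`_l)); last first.
      by rewrite k0 linear0.
    rewrite mulmx_sum_row linear_sum; apply: eq_bigr => l _.
    by rewrite mxE linearZ /= nth_mktuple -map_row rowK map_mxvec.
  rewrite -[RHS](mul0mx _ W^R) => /(row_free_inj Wf) /rowP/(_ i).
  by rewrite !mxE.
have : \sum_(i < r) (k i)%:~R *: (mktuple (fun i => (E i)^R))`_i = 0 :> 'M[R]_n.
  rewrite -[RHS](_ : (0 : 'M[int]_n)^R = 0); last by apply/matrixP => a c; rewrite !mxE.
  rewrite -k0 raddf_sum; apply: eq_bigr => l _ /=.
  by rewrite nth_mktuple scaler_int raddfMz.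
by move/Efree/(_ i)/eqP; rewrite intr_eq0 => /eqP.
Qed.
End RiemannGaps.

Section PicardNumber.
Variables (R : realType) (g : nat) (A : abelian_variety R g).
Local Notation C := (Cplx R).
Local Notation V := 'rV[C]_g.
Local Notation n := (2 * g)%N.
Local Notation U := 'rV[R]_n.
Local Notation ev j := (delta_mx 0 j : U).
Local Notation "e ^R" := (map_mx (intr : int -> R) e) (at level 2, format "e ^R").
Local Notation L := (lattice A).
Variable b : 'I_n -> V.
Hypothesis bfree : forall a : 'I_n -> R,
  \sum_i cplx_of_real (a i) *: b i = 0 -> forall i, a i = 0.
Hypothesis bL : L = [set v | exists m : 'I_n -> int, v = \sum_i b i *~ m i].
Local Notation phi := (of_coord b).
Local Notation J := (J_mx b).

Definition ns_chern (x : neron_severi A) : 'M[int]_n := chern bL (repr x).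

Lemma ns_chern_pi M : ns_chern (\pi_(neron_severi A) M) = chern bL M.
Proof. exact: (chern_top_isomorphic bL (ns_repr M)). Qed.

Fact ns_chern_is_additive : zmod_morphism ns_chern.
Proof.
have D x y : ns_chern (x + y) = ns_chern x + ns_chern y.
  by rewrite ns_chern_pi chern_tensor.
by move=> x y; apply: (addIr (ns_chern y)); rewrite -D !subrK.
Qed.
HB.instance Definition _ :=
  GRing.isZmodMorphism.Build (neron_severi A) 'M[int]_n ns_chern ns_chern_is_additive.

Lemma ns_chern_inj : injective ns_chern.
Proof.
apply: raddf_inj => x x0; rewrite -[x]reprK.
have /ns_eqP/eqP <- := chern0_top_trivial bfree x0.
by [].
Qed.

Lemma ns_chern_independent r (x : 'I_r -> neron_severi A) :
  Z_independent x <-> Z_independent (ns_chern \o x).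
Proof.
have E (m : 'I_r -> int) : ns_chern (\sum_i x i *~ m i) = \sum_i (ns_chern \o x) i *~ m i.
  by rewrite raddf_sum; apply: eq_bigr => i _; rewrite raddfMz.
split=> xi m; first by rewrite -E -(raddf0 ns_chern) => /ns_chern_inj/xi.
by move=> m0; apply: xi; rewrite -E m0 raddf0.
Qed.

(** [e0] is the matrix of the imaginary part of [H] on the lattice basis. Invariance comes from
    [H(i x, i y) = H(x, y)], and positivity from the imaginary part of [H(i v, v)] being
    [H(v, v)]. *)
Lemma polarization_riemann : exists e0 : 'M[int]_n, is_riemann_form J e0^R /\
  forall v : U, v != 0 -> 0 < (v *m (J *m e0^R) *m v^T) 0 0.
Proof.
have [H HL] := polarizable A.
have /choice[m mE] (jk : 'I_n * 'I_n) :
    exists k : int, im (H (b jk.1) (b jk.2)) = k%:~R.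
  have [k kE] := HL _ _ (lattice_basis bL jk.1) (lattice_basis bL jk.2).
  by exists k; rewrite -(re_int R k) -kE -complexIm.
pose e0 : 'M[int]_n := \matrix_(j, k) m (j, k).
have HZl (a : C) x y : H (a *: x) y = a * H x y by rewrite linearZl_LR.
have HZr (a : C) x y : H x (a *: y) = a^* * H x y by rewrite linearZr_LR.
have conjR (a : R) : (cplx_of_real a : C)^* = cplx_of_real a.
  by rewrite conj_Creal //; apply/complex_realP; exists a.
have imH x y : im (H (phi x) (phi y)) = (x *m e0^R *m y^T) 0 0.
  rewrite /of_coord linear_sumr raddf_sum mxE; apply: eq_bigr => k _ /=.
  rewrite HZr conjR imM reR imR mul0r addr0 linear_sumlz raddf_sum mulrC !mxE.
  congr (_ * _); apply: eq_bigr => j _ /=.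
  by rewrite HZl imM reR imR mul0r addr0 (mE (j, k)) !mxE.
have HC x y : im (H x y) = - im (H y x).
  rewrite hermC expr0 mul1r.
  have h := Im_conj (H y x); rewrite -!complexIm in h.
  by have := congr1 (@re R) h; rewrite reN.
have mat_eq (a c : 'M[R]_n) : (forall x y : U, (x *m a *m y^T) 0 0 = (x *m c *m y^T) 0 0) -> a = c.
  move=> h; apply/matrixP => j k; have := h (ev j) (ev k).
  by rewrite !trmx_delta -!rowE -!colE !mxE.
exists e0; split; first split.
- apply: mat_eq => x y; rewrite mulmxN mulNmx [RHS]mxE -imH HC imH opprK.
  transitivity ((x *m (e0^R)^T *m y^T)^T 0 0); first by rewrite [RHS]mxE.
  by rewrite !trmx_mul !trmxK mulmxA.
- apply: mat_eq => x y; rewrite -imH.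
  have := imH (x *m J) (y *m J); rewrite !(of_coord_J bfree) HZl HZr conjCi.
  rewrite mulrA mulrN /ii -expr2 sqrCi opprK mul1r => ->.
  by rewrite trmx_mul !mulmxA.
move=> v v0; rewrite mulmxA -imH (of_coord_J bfree) HZl imM /ii -/(ii R) iiE /=.
rewrite mul0r add0r mul1r.
have phiv0 : phi v != 0.
  by apply: contra_neq v0 => v0; rewrite -[v](of_coordK bfree) v0 -(of_coord0 b) of_coordK.
by have [d d0 ->] := gt0_cplx_of_real (neq0_dnorm_gt0 (s := H) _ phiv0).
Qed.

Theorem picard_gaps rho : (0 < g)%N -> has_picard_number A rho ->
  ((4 <= g)%N -> rho = (g ^ 2)%N \/ (rho <= (g - 1) ^ 2 + 1)%N) /\
  ((7 <= g)%N -> ((g - 1) ^ 2 + 1 <= rho)%N \/ (rho <= (g - 2) ^ 2 + 4)%N).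
Proof.
move=> g0 [[x xi] rho_max].
pose E := ns_chern \o x; pose X := mktuple (fun i => (E i)^R).
have Xfree : free X by apply/Z_independent_free/ns_chern_independent.
pose T := <<X>>%VS.
have dimT : \dim T = rho by rewrite (eqP Xfree) size_tuple.
have [e0 [e0R e0pos]] := polarization_riemann.
have XE : X = [seq e^R | e : 'M[int]_n <- codom E] :> seq _.
  by rewrite /codom -map_comp.
rewrite -dimT; apply: (riemann_dim_gaps (J := J) (s := codom E) (e0 := e0)) => //.
- exact: (J_mx_sqr bfree).
(* An integral Riemann form outside the span would, through its Appell-Humbert bundle, produce
   [rho.+1] independent classes. *)
- move=> e [eT eJ]; apply: contrapT => /negP eX.
  have e_skew : e^T = - e.
    apply/matrixP => i j; apply: (@intr_inj R).
    by move/matrixP/(_ i j): eT; rewrite !mxE rmorphN.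
  pose y := \pi_(neron_severi A) (ah_bundle bfree bL e_skew eJ).
  have cy : ns_chern y = - (e *+ 2).
    by rewrite ns_chern_pi; exact: chern_ah_bundle.
  pose x' (i : 'I_rho.+1) := if unlift ord0 i is Some j then x j else y.
  suff /rho_max : Z_independent x' by rewrite ltnn.
  move=> k; rewrite big_ord_recl /x' unlift_none.
  under eq_bigr do rewrite liftK.
  move=> k0.
  (* A relation involving the new class could be divided by [2 * k ord0] over the reals, which would
     put [e] in the span. *)
  have k00 : k ord0 = 0.
    apply: contraNeq eX => kn0.
    have h : (e *+ 2) *~ k ord0 = \sum_i E i *~ k (lift ord0 i).
      have := congr1 ns_chern k0; rewrite raddf0 raddfD raddfMz /= cy raddf_sum.
      rewrite mulNrz addrC => /eqP; rewrite subr_eq0 => /eqP <-.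
      by apply: eq_bigr => i _; rewrite raddfMz.
    have hR : ((k ord0)%:~R * 2) *: e^R = \sum_i (k (lift ord0 i))%:~R *: (E i)^R.
      transitivity (((e *+ 2) *~ k ord0)^R).
        by rewrite raddfMz raddfMn /= -scalerA scaler_nat scaler_int.
      by rewrite h raddf_sum; apply: eq_bigr => i _; rewrite raddfMz scaler_int.
    have c0 : (k ord0)%:~R * 2 != 0 :> R by rewrite mulf_neq0 ?intr_eq0 ?pnatr_eq0.
    have -> : e^R = ((k ord0)%:~R * 2)^-1 *: \sum_i (k (lift ord0 i))%:~R *: (E i)^R.
      by rewrite -hR scalerA mulVf // scale1r.
    apply/memvZ/memv_suml => i _; apply/memvZ/memv_span.
    by rewrite -[(E i)^R](nth_mktuple (fun i => (E i)^R) 0 i) mem_nth ?size_tuple.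
  move: k0; rewrite k00 mulr0z add0r => /xi ki i.
  by case: (unliftP ord0 i) => [j ->|->].
- move=> _ /codomP[i ->]; have [cT cJ] := chern_riemann bfree bL (repr (x i)).
  by split=> //; rewrite map_trmx cT map_mxN.
- by rewrite -XE.
Qed.

End PicardNumber.

Local Close Scope ring_scope.
Local Close Scope classical_set_scope.
Unset Implicit Arguments.

Theorem theorem1p1 (R : realType) :
  (forall g : nat, (4 <= g)%N ->
     ~ exists (A : abelian_variety R g) (rho : nat),
         has_picard_number A rho /\ ((g - 1) ^ 2 + 1 < rho < g ^ 2)%N) /\
  (forall g : nat, (7 <= g)%N ->
     ~ exists (A : abelian_variety R g) (rho : nat),
         has_picard_number A rho /\
         ((g - 2) ^ 2 + 4 < rho < (g - 1) ^ 2 + 1)%N).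
Proof.
have gaps (g : nat) (A : abelian_variety R g) (rho : nat) :
    has_picard_number A rho -> (0 < g)%N ->
    ((4 <= g)%N -> rho = (g ^ 2)%N \/ (rho <= (g - 1) ^ 2 + 1)%N) /\
    ((7 <= g)%N -> ((g - 1) ^ 2 + 1 <= rho)%N \/ (rho <= (g - 2) ^ 2 + 4)%N).
  by move=> Arho g0; have [b [bfree bL]] := latticeP A; exact: picard_gaps bfree bL _ g0 Arho.
split=> g g_ge [A [rho [Arho /andP[lo hi]]]].
  have [/(_ g_ge) h _] := gaps g A rho Arho (leq_trans (isT : 0 < 4)%N g_ge).
  case: h => [rhoE|]; first by rewrite rhoE ltnn in hi.
  by rewrite leqNgt lo.
have [_ /(_ g_ge) h] := gaps g A rho Arho (leq_trans (isT : 0 < 7)%N g_ge).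
by case: h; rewrite leqNgt ?lo ?hi.
Qed.
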